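(* Let $d\ge2$. For all $\delta,\epsilon>0$ and every collection $\mathcal U$ of dyadic rectangles in $\mathbb R^d$ whose shadow $\operatorname{sh}(\mathcal U)$ has finite measure, one can select a set $V\supset\operatorname{sh}(\mathcal U)$ with $|V|\le(1+\delta)|\operatorname{sh}(\mathcal U)|$ such that, with $F(I,j,\mathcal U')$ defined relative to $V$ as in the context, for all subcollections $\mathcal U'\subset\mathcal U$, $$\sum_{j=1}^\infty\sum_{I\in\mathcal D}2^{-\epsilon j}\,|F(I,j,\mathcal U')|\lesssim|\operatorname{sh}(\mathcal U')|.$$ In fact, for any integer $n>1$, any choice of $1<p<\infty$, and all $\mathcal U'\subset\mathcal U$, $$\Bigl\|\sum_{j=1}^\infty\sum_{I\in\mathcal D}2^{-\epsilon j}\bigl(\operatorname M\mathbf 1_{F(I,j,\mathcal U')}\bigr)^n\Bigr\|_{L^p(\mathbb R^d)}\lesssim|\operatorname{sh}(\mathcal U')|^{1/p}.$$ The implied constants in these estimates depend only on the dimension $d$ and the choices of $\epsilon,\delta$.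
   Context: The dyadic intervals are $\mathcal D=\{[j2^k,(j+1)2^k): j,k\in\mathbb Z\}$. A dyadic rectangle in $\mathbb R^d$ is a product $R=R_{(1)}\times\cdots\times R_{(d)}$ with each $R_{(i)}\in\mathcal D$. The shadow of a collection $\mathcal U$ of dyadic rectangles is $\operatorname{sh}(\mathcal U)=\bigcup_{R\in\mathcal U}R$. $|A|$ denotes Lebesgue measure. For an interval $I$ and $\mu>0$, $\mu I$ is the interval with the same center as $I$ and length $\mu|I|$. The notation $A\lesssim B$ means $A\le KB$ for a constant $K$, with the dependence of $K$ as specified in the claim. The strong maximal function is $\operatorname M f(x)=\sup_{R\ni x}|R|^{-1}\int_R|f(y)|\,dy$, the supremum being over all (not necessarily dyadic) rectangles $R$ in $\mathbb R^d$ with sides parallel to the coordinate axes that contain $x$. Given $V\supset\operatorname{sh}(\mathcal U)$ and $R\in\mathcal U$, define the embeddedness in the first coordinate $$\operatorname{emb}(R,V)=\sup\{\mu\ge1:\ (\mu R_{(1)})\times R_{(2)}\times\cdots\times R_{(d)}\subset V\}.$$ For $\mathcal U'\subset\mathcal U$, $j\in\{1,2,\dots\}$ and $I\in\mathcal D$, define $$F(I,j,\mathcal U')=\bigcup\{\,I\times R':\ I\times R'\in\mathcal U',\ 2^{j-1}\le\operatorname{emb}(I\times R',V)<2^j\,\},$$ where $R'$ denotes a dyadic rectangle in the last $d-1$ coordinates.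
   Formalization: The implied constant in the L^p estimate is allowed to depend on p as well as on d, ε, δ (but not on n), since a constant uniform in p is false, e.g. for U = {[0,2^k)×[0,2^-k) : 1≤k≤N}, δ = 1/8, as p→∞. *)

(* Defs.v *)
From HB Require Import structures.
From mathcomp Require Import all_boot all_order all_algebra.
From mathcomp Require Import all_classical all_reals all_analysis.

Set Implicit Arguments.
Unset Strict Implicit.
Unset Printing Implicit Defensive.

Import Order.TTheory GRing.Theory Num.Theory.
Import numFieldNormedType.Exports.

Local Open Scope classical_set_scope.
Local Open Scope ring_scope.

(* R^d with the product of the Borel sigma-algebras of the factors. *)
Notation Rn R d := (d.-tuple (measurableTypeR R)).

Definition box {R : realType} {d : nat} (A : 'I_d -> set R) : set (Rn R d) :=
  [set x | forall i, A i (tnth x i)].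

Definition cons_Rn {R : realType} {d : nat}
    (p : measurableTypeR R * Rn R d) : Rn R d.+1 :=
  [tuple of p.1 :: p.2].

Lemma measurable_cons_Rn (R : realType) (d : nat) :
  measurable_fun [set: measurableTypeR R * Rn R d] (@cons_Rn R d).
Proof. exact: measurable_cons. Qed.

(* Lebesgue measure on R^d: the d-fold product of the one-dimensional one,
   transported along R * R^d ~ R^(d+1) (see leb_box). *)
Fixpoint leb {R : realType} (d : nat) : {measure set (Rn R d) -> \bar R} :=
  match d return {measure set (Rn R d) -> \bar R} with
  | 0 => \d_([tuple] : Rn R 0)
  | d'.+1 =>
      measure_function_pushforward__canonical__measure_function_Measure
        (lebesgue_measure \x^ leb d')%E (measurable_cons_Rn (R:=R) (d:=d'))
  end.

Lemma measurable_box (R : realType) (d : nat) (A : 'I_d -> set R) :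
  (forall i, measurable (A i : set (measurableTypeR R))) -> measurable (box A).
Proof.
move=> mA.
have -> : box A = \bigcap_(i in [set: 'I_d]) ((fun x : Rn R d => tnth x i) @^-1` A i).
  by apply/seteqP; split => [x h i _|x h i]; [exact: h|exact: (h i I)].
apply: fin_bigcap_measurable; first exact: finite_finset.
move=> i _; rewrite -[X in measurable X]setTI.
by apply: measurable_tnth; [exact: measurableT|exact: mA].
Qed.

Lemma leb_box (R : realType) (d : nat) (A : 'I_d -> set R) :
  (forall i, measurable (A i : set (measurableTypeR R))) ->
  leb d (box A) = (\prod_(i < d) lebesgue_measure (A i))%E.
Proof.
elim: d A => [|d IH] A mA.
  by rewrite big_ord0 /= diracE mem_set// => -[].
rewrite big_ord_recl /= -IH; last by move=> i; exact: mA.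
rewrite -product_measure2E; [|exact: mA|by apply: measurable_box => i; exact: mA].
rewrite /pushforward; congr (_ _); apply/seteqP; split => -[x y] /=.
- move=> h; split => [|i /=].
    by have := h ord0.
  by have := h (lift ord0 i); rewrite tnthS.
- move=> [h0 h] i; have [j ->|->] := unliftP ord0 i; last exact: h0.
  by rewrite tnthS; exact: h.
Qed.

(* The pair (j, k) stands for the dyadic interval [j 2^k, (j + 1) 2^k). *)
Notation dyadic := (int * int)%type.

Definition dlength {R : realType} (I : dyadic) : R := 2 ^ I.2.

Definition dcenter {R : realType} (I : dyadic) : R :=
  (I.1%:~R + 2^-1) * dlength I.

Definition dint {R : realType} (I : dyadic) : set R :=
  `[I.1%:~R * dlength I, (I.1 + 1)%:~R * dlength I[%classic.

(* The interval mu I, half-open as I is, so that it is I itself at mu = 1. *)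
Definition dilate {R : realType} (mu : R) (I : dyadic) : set R :=
  `[dcenter I - mu * dlength I / 2, dcenter I + mu * dlength I / 2[%classic.

Lemma dlength_gt0 (R : realType) (I : dyadic) : 0 < dlength I :> R.
Proof. exact: exprz_gt0. Qed.

Lemma dilate1 (R : realType) (I : dyadic) : dilate 1 I = dint I :> set R.
Proof.
have -> : dint I =
    `[I.1%:~R * dlength I, I.1%:~R * dlength I + dlength I[%classic :> set R.
  by rewrite /dint intrD mulrDl mul1r.
rewrite /dilate /dcenter mul1r mulrDl [2^-1 * _]mulrC addrK -addrA.
by rewrite -splitr.
Qed.

Lemma dint_inj (R : realType) : injective (@dint R).
Proof.
have lt_dint (I : dyadic) :
    I.1%:~R * dlength I < (I.1 + 1)%:~R * dlength I :> R.
  by rewrite ltr_pM2r ?dlength_gt0// ltr_int ltzD1.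
have le_l (I J : dyadic) : dint I = dint J :> set R ->
    J.1%:~R * dlength J <= I.1%:~R * dlength I :> R.
  move=> IJ; have : dint I (I.1%:~R * dlength I : R).
    by rewrite /dint /= in_itv /= lexx lt_dint.
  by rewrite IJ /dint /= in_itv /= => /andP[].
have le_r (I J : dyadic) : dint I = dint J :> set R ->
    (J.1 + 1)%:~R * dlength J <= (I.1 + 1)%:~R * dlength I :> R.
  move=> IJ; rewrite leNgt; apply/negP => lt_IJ.
  have : dint J ((I.1 + 1)%:~R * dlength I : R).
    rewrite /dint /= in_itv /= lt_IJ andbT.
    by apply: (le_trans (le_l _ _ IJ)); exact: ltW.
  by rewrite -IJ /dint /= in_itv /= ltxx andbF.
move=> [j k] [j' k'] IJ.
have el : j%:~R * 2 ^ k = j'%:~R * 2 ^ k' :> R.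
  by apply/le_anti; rewrite (le_l _ _ IJ) (le_l _ _ (esym IJ)).
have er : (j + 1)%:~R * 2 ^ k = (j' + 1)%:~R * 2 ^ k' :> R.
  by apply/le_anti; rewrite (le_r _ _ IJ) (le_r _ _ (esym IJ)).
move: er; rewrite !intrD !mulrDl el !mul1r => /addrI ekk.
have ek : k = k'.
  apply: (@ieexprIz R 2) => //.
  by rewrite -[2%R]/(1 + 1) -subr_eq0 addrK oner_eq0.
move: el; rewrite ek => /mulIf.
have n0 : (2 : R) ^ k' != 0 by rewrite expfz_neq0.
by move=> /(_ n0) /intr_inj ->.
Qed.

(* A dyadic rectangle is given by its sides R_(1), ..., R_(d), in this order. *)
Notation drect d := (d.-tuple dyadic).

Definition rect {R : realType} {d : nat} (S : drect d) : set (Rn R d) :=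
  box (fun i => dint (tnth S i)).

Definition shadow {R : realType} {d : nat} (U : set (drect d)) : set (Rn R d) :=
  \bigcup_(S in U) rect S.

(* (mu R_(1)) x R_(2) x ... x R_(d); coordinates are numbered from 0. *)
Definition rect_dilate1 {R : realType} {d : nat} (mu : R) (S : drect d) :
    set (Rn R d) :=
  box (fun i => if val i == 0%N then dilate mu (tnth S i) else dint (tnth S i)).

Definition emb {R : realType} {d : nat} (S : drect d) (V : set (Rn R d)) : \bar R :=
  ereal_sup [set mu%:E | mu in [set mu : R | 1 <= mu /\ rect_dilate1 mu S `<=` V]].

(* F(I, j, U') relative to V; only used for j >= 1. *)
Definition Fset {R : realType} {d : nat} (V : set (Rn R d))
    (I : dyadic) (j : nat) (U' : set (drect d)) : set (Rn R d) :=
  \bigcup_(S in [set S | U' S /\ ohead S = Some I /\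
                         ((2 ^+ j.-1)%:E <= emb S V < (2 ^+ j)%:E)%E]) rect S.

(* Sides parallel to the axes, non-degenerate and bounded, of any kind (open,
   closed or half-open). *)
Definition is_rectangle {R : realType} {d : nat} (B : set (Rn R d)) : Prop :=
  exists2 A : 'I_d -> set R,
    (forall i, is_interval (A i) /\ (0 < lebesgue_measure (A i) < +oo)%E) &
    B = box A.

Definition strong_maximal {R : realType} {d : nat} (f : Rn R d -> R)
    (x : Rn R d) : \bar R :=
  ereal_sup [set ((leb d B)^-1 * \int[leb d]_(y in B) `|f y|%:E)%E |
             B in [set B : set (Rn R d) | is_rectangle B /\ B x]].

(* Main.v *)
Require Import Defs.
From HB Require Import structures.
From mathcomp Require Import all_boot all_order all_algebra.
From mathcomp Require Import all_classical all_reals all_analysis.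
From mathcomp Require Import ring lra zify measurable_realfun.
Import Order.TTheory GRing.Theory Num.Theory.
Import numFieldNormedType.Exports.
Local Open Scope classical_set_scope.
Local Open Scope ring_scope.
Set Implicit Arguments.
Unset Strict Implicit.
Unset Printing Implicit Defensive.

(** The enlarged set V is built from the crowded rectangles, those whose
    proportion inside sh(U) exceeds 1 - c with c = eta ^ d: V is the union of
    their dilations by 1 + 2 ^ -a in the first coordinate, a being fixed by
    delta.  A crowded rectangle lies in the set obtained from sh(U) by d
    successive saturations, each adding the points at which some dyadic average
    of the current indicator along one coordinate exceeds 1 - eta
    ([shadow_crowded_sub]).  The weak-type inequality for a dyadic maximal
    function holds with constant 1, so a saturation multiplies the measure by at
    most (1 - eta)^-1.  The final dilation costs a factor 1 + 2 ^ -a, as one sees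
    on lines parallel to the first axis, where a union of dyadic intervals is
    the disjoint union of the maximal ones ([lebesgue_dilate_union]).  Hence
    |V| <= (1 + 2 ^ -a) (1 - eta) ^ -d |sh(U)| ([leb_enlarge]).

    Now let R = I x R' belong to the j-th class, so emb(R, V) < 2 ^ j, and let J0
    be the dyadic ancestor of I that is 2 ^ (j + a) times longer.  The
    (1 + 2 ^ -a)-dilation of J0 contains the 2 ^ j-dilation of I, so J0 x R' cannot
    be crowded ([emb_ge_of_crowded]).  The rectangles J x T' of the family with
    J containing J0 therefore miss a proportion at least c of R
    ([fresh_large]).  Sort the intervals I by the residue of their scale modulo
    j + a, and let the fresh part of F(I, j) be what remains after removal of
    the F(J, j) with J longer and in the same residue class.  The fresh parts
    are disjoint inside each class, so they overlap at most j + a times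
    ([sum_fresh]), while 1_F(I, j) <= c^-1 M 1_fresh(I, j) for an iterated dyadic
    maximal operator M ([Fset_le_itermax]).

    The passage from the fresh parts back to the sets F(I, j) uses the weighted
    inequality of Fefferman and Stein,
    int (M f) ^ q w <= C int f ^ q (M~ w), where M~ iterates the one-coordinate
    maximal operators in the opposite order ([doob_weighted],
    [itermax_weighted]).  Applied with q = 2 twice, it bounds
    int g w by B int_(sh U') M~ M~ w, where
    g = sum_j 2 ^ (- eps j) sum_I (M 1_F(I, j)) ^ 2; the constant B is finite because
    sum_j 2 ^ (- eps j) (j + a) converges ([sqrsum_dual]).  Taking w = 1 gives the
    L^1 bound, and w = g ^ (p - 1), with Young's inequality and the L^p' bound
    for M~ M~, gives the L^p bound ([duality_Lp]).

    The maximal function of an indicator is at most 1, so the exponent n may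
    be replaced by 2.  The strong maximal operator is dominated by 6 ^ d times M
    as soon as M uses, along each coordinate, both the dyadic grid and a grid
    shifted by a third of the mesh: every interval lies in a cell of one of
    them of length at most 6 times its own ([interval_cell]).

    All estimates are made for bounded functions, finitely many scales and
    finitely many rectangles, with constants independent of the truncation;
    monotone convergence removes it at the end. *)

(** * Integration on R^d one coordinate at a time *)

Section Coordinates.
Context {R : realType}.
Local Notation mu := (@lebesgue_measure R).

Definition upd {d} (i : 'I_d) (x : Rn R d) (y : R) : Rn R d :=
  [tuple if j == i then y else tnth x j | j < d].

Lemma tnth_upd d (i j : 'I_d) (x : Rn R d) (y : R) :
  tnth (upd i x y) j = if j == i then y else tnth x j.
Proof. by rewrite tnth_mktuple. Qed.

Lemma upd_upd d (i : 'I_d) (x : Rn R d) (y z : R) :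
  upd i (upd i x y) z = upd i x z.
Proof. by apply: eq_from_tnth => j; rewrite !tnth_upd; case: (j == i). Qed.

Lemma upd_id d (i : 'I_d) (x : Rn R d) : upd i x (tnth x i) = x.
Proof. by apply: eq_from_tnth => j; rewrite tnth_upd; case: eqP => [->|]. Qed.

Lemma upd_ord0 d (t : R) (x : Rn R d) (y : R) :
  upd ord0 (cons_Rn (t, x)) y = cons_Rn (y, x).
Proof.
apply: eq_from_tnth => j; rewrite tnth_upd.
have [k ->|->] := unliftP ord0 j; first by rewrite !tnthS.
by rewrite !tnth0.
Qed.

Lemma upd_lift d (i : 'I_d) (t : R) (x : Rn R d) (y : R) :
  upd (lift ord0 i) (cons_Rn (t, x)) y = cons_Rn (t, upd i x y).
Proof.
apply: eq_from_tnth => j; rewrite tnth_upd.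
have [k ->|->] := unliftP ord0 j; last by rewrite !tnth0.
by rewrite !tnthS tnth_upd (inj_eq (@lift_inj _ _)).
Qed.

Lemma measurable_upd d (i : 'I_d) dT (T : measurableType dT)
    (f : T -> Rn R d) (g : T -> measurableTypeR R) :
  measurable_fun [set: T] f -> measurable_fun [set: T] g ->
  measurable_fun [set: T] (fun t => upd i (f t) (g t)).
Proof.
move=> mf mg; apply/measurable_fun_tnthP => j.
rewrite (_ : _ \o _ = fun t => if j == i then g t else tnth (f t) j); last first.
  by apply/funext => t /=; rewrite tnth_upd.
case: (j == i) => //.
by apply: (measurableT_comp (measurable_tnth j) mf).
Qed.

Lemma measurable_cons_fun d dT (T : measurableType dT)
    (g : T -> measurableTypeR R) (f : T -> Rn R d) :
  measurable_fun [set: T] g -> measurable_fun [set: T] f ->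
  measurable_fun [set: T] (fun t => cons_Rn (g t, f t)).
Proof. by move=> mg mf; exact: measurable_cons. Qed.

Local Open Scope ereal_scope.

Lemma sigma_finite_leb d : sigma_finite [set: Rn R d] (leb d).
Proof.
exists (fun n : nat => box (fun _ : 'I_d => `](- n%:R)%R, n%:R%R[%classic : set R)).
  apply/seteqP; split => // x _.
  pose m := (\sum_(i < d) `|tnth x i|)%R.
  exists (Num.truncn m).+1 => //= i.
  rewrite /= in_itv /= -ltr_norml.
  apply: le_lt_trans (truncnS_gt m).
  by rewrite /m (bigD1 i)//= lerDl sumr_ge0.
move=> n; split; first by apply: measurable_box => i; exact: measurable_itv.
rewrite leb_box; last by move=> i; exact: measurable_itv.
rewrite ltey_eq; apply/orP; left; apply: prode_fin_num => i _.
by rewrite lebesgue_measure_itv /=; case: ifP.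
Qed.

Definition lebs d : set (Rn R d) -> \bar R := leb d.

HB.instance Definition _ d :=
  isMeasure.Build _ _ _ (@lebs d) (measure0 (leb d)) (measure_ge0 (leb d))
    (@measure_semi_sigma_additive _ _ _ (leb d)).
HB.instance Definition _ d :=
  Measure_isSigmaFinite.Build _ _ _ (@lebs d) (@sigma_finite_leb d).

Lemma integral_leb_cons d (f : Rn R d.+1 -> \bar R) :
  measurable_fun [set: Rn R d.+1] f -> (forall x, 0 <= f x) ->
  \int[leb d.+1]_x f x = \int[leb d]_x \int[mu]_t f (cons_Rn (t, x)).
Proof.
move=> mf f0.
pose L : {sigma_finite_measure set (Rn R d) -> \bar R} := @lebs d.
have mg : measurable_fun setT (f \o @cons_Rn R d).
  by apply: measurableT_comp => //; exact: measurable_cons_Rn.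
transitivity (\int[(mu \x^ leb d)%E]_z (f \o @cons_Rn R d) z).
  have f0' : {in setT, forall y, 0 <= f y} by move=> y _; exact: f0.
  have := @ge0_integral_pushforward _ _ _ _ R _ (@measurable_cons_Rn R d)
    (mu \x^ leb d)%E setT f measurableT mf f0'.
  by rewrite preimage_setT.
rewrite -(fubini_tonelli2 (m1 := mu) (m2 := L) (f \o @cons_Rn R d))//=.
apply: eq_measure_integral => A mA _; apply/esym.
apply: product_measure_unique => //= B C mB mC.
by rewrite product_measure2E.
Qed.

End Coordinates.

Section Averages.
Context {R : realType}.
Local Notation mu := (@lebesgue_measure R).

Lemma measurable_fun2 d1 d2 d3 d4 (T1 : measurableType d1)
    (T2 : measurableType d2) (T3 : measurableType d3) (T : measurableType d4)
    (H : T1 -> T2 -> T3) (f : T -> T1) (g : T -> T2) :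
  measurable_fun [set: T1 * T2] (fun p => H p.1 p.2) ->
  measurable_fun [set: T] f -> measurable_fun [set: T] g ->
  measurable_fun [set: T] (fun t => H (f t) (g t)).
Proof.
move=> mH mf mg.
exact: (measurableT_comp mH (measurable_fun_pair mf mg)).
Qed.

Local Open Scope ereal_scope.

Lemma measurable_integral d1 d2 (T1 : measurableType d1)
    (T2 : measurableType d2) (m : {sigma_finite_measure set T2 -> \bar R})
    (H : T1 -> T2 -> \bar R) :
  measurable_fun [set: T1 * T2] (fun p => H p.1 p.2) ->
  (forall x y, 0 <= H x y) ->
  measurable_fun [set: T1] (fun x => \int[m]_y H x y).
Proof.
move=> mH H0.
exact: (@measurable_fun_fubini_tonelli_F _ _ _ _ R m (fun p => H p.1 p.2)).
Qed.

(** Tonelli for the two copies of the i-th coordinate, the one of x and the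
    free variable y.  Averages along the i-th coordinate are integrals of this
    kind with a symmetric kernel, so this is what makes them self-adjoint. *)
Lemma integral_upd_swap d (i : 'I_d) (H : Rn R d -> measurableTypeR R -> \bar R) :
  measurable_fun [set: Rn R d * measurableTypeR R] (fun p => H p.1 p.2) ->
  (forall x y, 0 <= H x y) ->
  \int[leb d]_x \int[mu]_y H x y =
  \int[leb d]_x \int[mu]_y H (upd i x y) (tnth x i).
Proof.
elim: d i H => [|d IH] i H mH H0; first by case: i.
have mH1 : measurable_fun [set: Rn R d.+1] (fun x => \int[mu]_y H x y).
  exact: measurable_integral.
have mH2 : measurable_fun [set: Rn R d.+1]
    (fun x => \int[mu]_y H (upd i x y) (tnth x i)).
  apply: measurable_integral => //.
  apply: (measurable_fun2 mH); first exact: measurable_upd.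
  exact: (measurableT_comp (measurable_tnth i)).
rewrite (integral_leb_cons mH1); last by move=> x; exact: integral_ge0.
rewrite (integral_leb_cons mH2); last by move=> x; exact: integral_ge0.
have swap x : \int[mu]_t \int[mu]_y H (cons_Rn (t, x)) y =
    \int[mu]_y \int[mu]_t H (cons_Rn (t, x)) y.
  apply: (fubini_tonelli (m1 := mu) (m2 := mu)
    (fun p => H (cons_Rn (p.1, x)) p.2)) => //.
  by apply: (measurable_fun2 mH) => //; exact: measurable_cons_fun.
have [j ->|->] := unliftP ord0 i; last first.
  apply: eq_integral => x _; rewrite swap.
  apply: eq_integral => t _; apply: eq_integral => y _.
  by rewrite upd_ord0 tnth0.
transitivity (\int[leb d]_x \int[mu]_y \int[mu]_t H (cons_Rn (t, x)) y).
  by apply: eq_integral => x _; exact: swap.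
rewrite (IH j (fun x y => \int[mu]_t H (cons_Rn (t, x)) y)); last 2 first.
- apply: measurable_integral => //.
  apply: (measurable_fun2 mH) => //.
    apply: measurable_cons_fun => //.
    by apply: measurableT_comp.
  by apply: measurableT_comp.
- by move=> x y; apply: integral_ge0.
apply: eq_integral => x _.
under [RHS]eq_integral do under eq_integral do rewrite upd_lift tnthS.
apply: (fubini_tonelli (m1 := mu) (m2 := mu)
  (fun p => H (cons_Rn (p.2, upd j x p.1)) (tnth x j))) => //.
apply: (measurable_fun2 mH) => //.
by apply: measurable_cons_fun => //; exact: measurable_upd.
Qed.

End Averages.

(** * A weighted maximal inequality *)
Section BoundedFunctions.
Context {R : realType} {dT : measure_display} {T : measurableType dT}.
Implicit Types f g : T -> R.

(** Bounded functions have finite averages, so that averages, maxima and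
    their differences can be handled in R; integrals over the whole space may
    still be infinite. *)
Definition nnb f := [/\ measurable_fun setT f, forall x, 0 <= f x &
  exists c, forall x, f x <= c].

Lemma nnb_ge0 f x : nnb f -> 0 <= f x. Proof. by case. Qed.

Lemma nnb_meas f : nnb f -> measurable_fun setT f. Proof. by case. Qed.

Lemma nnb_EFin f : nnb f -> measurable_fun setT (fun x => (f x)%:E).
Proof. by case=> mf _ _; exact/measurable_EFinP. Qed.

Lemma nnb_cst c : 0 <= c -> nnb (fun _ : T => c).
Proof. by move=> c0; split => //; exists c. Qed.

Lemma nnbM f g : nnb f -> nnb g -> nnb (fun x => f x * g x).
Proof.
move=> [mf f0 [a fa]] [mg g0 [b gb]]; split.
- exact: measurable_funM.
- by move=> x; rewrite mulr_ge0.
- by exists (a * b) => x; rewrite ler_pM.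
Qed.

Lemma nnbD f g : nnb f -> nnb g -> nnb (fun x => f x + g x).
Proof.
move=> [mf f0 [a fa]] [mg g0 [b gb]]; split.
- exact: measurable_funD.
- by move=> x; rewrite addr_ge0.
- by exists (a + b) => x; rewrite lerD.
Qed.

Lemma nnb_sum (I : Type) (s : seq I) (F : I -> T -> R) :
  (forall i, nnb (F i)) -> nnb (fun x => \sum_(i <- s) F i x).
Proof.
move=> nF; elim: s => [|i s IH].
  under eq_fun do rewrite big_nil.
  exact: nnb_cst.
under eq_fun do rewrite big_cons.
exact: nnbD.
Qed.

Lemma nnb_max f g : nnb f -> nnb g -> nnb (fun x => Num.max (f x) (g x)).
Proof.
move=> [mf f0 [a fa]] [mg g0 [b gb]]; split.
- exact: measurable_maxr.
- by move=> x; rewrite le_max f0.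
- by exists (Num.max a b) => x; rewrite ge_max !le_max fa gb orbT.
Qed.

Lemma nnb_powR f r : 0 <= r -> nnb f -> nnb (fun x => f x `^ r).
Proof.
move=> r0 [mf f0 [a fa]]; split.
- exact: (measurableT_comp (measurable_powR r)).
- by move=> x; exact: powR_ge0.
- exists (a `^ r) => x.
  by rewrite ge0_ler_powR// nnegrE (le_trans (f0 x)).
Qed.

Lemma nnb_indic (A : set T) : measurable A -> nnb (\1_A : T -> R).
Proof.
move=> mA; split.
- exact: measurable_indic.
- by move=> x; rewrite indicE.
- by exists 1 => x; rewrite indicE; case: (_ \in _).
Qed.

End BoundedFunctions.

Section Doob.
Context {R : realType} {dT : measure_display} {T : measurableType dT}.
Variable P : {measure set T -> \bar R}.
Implicit Types f u w : T -> R.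

(** Young's inequality for b ^ (q - 1) and a.  The power q - 1 on the right is
    what is left to pair with an average, see [runmax_powR_le]. *)
Lemma powR_telescope (q a b : R) : 1 < q -> 0 <= b -> b <= a ->
  a `^ q - b `^ q <= q / (q - 1) * (a * (a `^ (q - 1) - b `^ (q - 1))).
Proof.
move=> q1 b0 ba.
have a0 : 0 <= a by exact: le_trans ba.
have qp : 0 < q - 1 by rewrite subr_gt0.
have q0 : 0 < q by lra.
have := @conjugate_powR R (b `^ (q - 1)) a (q / (q - 1)) q.
rewrite -powRrM (_ : (q - 1) * (q / (q - 1)) = q); last by field; lra.
move=> /(_ (powR_ge0 _ _) a0 (divr_gt0 q0 qp) q0) H.
have {}H := H ltac:(by field; lra).
rewrite mulrBr mulr_powRB1//.
have : q / (q - 1) * (b `^ (q - 1) * a) <=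
    q / (q - 1) * (b `^ q / (q / (q - 1)) + a `^ q / q).
  by rewrite ler_wpM2l// divr_ge0 ?ltW.
rewrite mulrDr [X in _ <= X + _](_ : _ = b `^ q); last by field; lra.
rewrite [X in _ <= _ + X](_ : _ = a `^ q / (q - 1)); last by field; lra.
have -> : q / (q - 1) = 1 + (q - 1)^-1 by field; lra.
lra.
Qed.

Definition invar (r : T -> T -> Prop) u := forall x y, r x y -> u x = u y.

Variables (E : nat -> (T -> R) -> T -> R) (e : nat -> T -> T -> Prop).

Fixpoint runmax f m x : R :=
  if m is k.+1 then Num.max (runmax f k x) (E k f x) else 0.

(** Conditional expectations for partitions that get finer with k, e k being
    the relation of lying in the same atom.  In [chain_adj] the factor u is
    constant on atoms, so it commutes with E k, which is self-adjoint. *)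
Record averaging_chain : Prop := AveragingChain {
  chain_nested : forall k x y, e k.+1 x y -> e k x y ;
  chain_nnb : forall k f, nnb f -> nnb (E k f) ;
  chain_invar : forall k f, nnb f -> invar (e k) (E k f) ;
  chain_le : forall k f g, nnb f -> nnb g -> (forall x, f x <= g x) ->
    forall x, E k f x <= E k g x ;
  chainD : forall k f g, nnb f -> nnb g ->
    forall x, E k (fun x => f x + g x) x = E k f x + E k g x ;
  chain_id : forall k u, nnb u -> invar (e k) u -> forall x, E k u x = u x ;
  chain_adj : forall k u f w, nnb u -> nnb f -> nnb w -> invar (e k) u ->
    (\int[P]_x (u x * E k f x * w x)%:E =
     \int[P]_x (u x * f x * E k w x)%:E)%E }.

Hypothesis HE : averaging_chain.

Lemma runmax_ge0 f m x : 0 <= runmax f m x.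
Proof. by elim: m => [|m IH] //=; rewrite le_max IH. Qed.

Lemma runmax_le f k m x : (k <= m)%N -> runmax f k x <= runmax f m x.
Proof.
elim: m => [|m IH]; first by rewrite leqn0 => /eqP ->.
rewrite leq_eqVlt => /orP[/eqP -> //|]; rewrite ltnS => /IH h.
by rewrite /= le_max h.
Qed.

Lemma le_runmax f k m x : (k < m)%N -> E k f x <= runmax f m x.
Proof. by move=> /(runmax_le f x); apply: le_trans; rewrite /= le_max lexx orbT. Qed.

Lemma runmax_nnb f m : nnb f -> nnb (runmax f m).
Proof.
move=> nf; elim: m => [|m IH] /=; first exact: nnb_cst.
by apply: nnb_max => //; exact: chain_nnb.
Qed.

Lemma runmax_mono f g m : nnb f -> nnb g -> (forall x, f x <= g x) ->
  forall x, runmax f m x <= runmax g m x.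
Proof.
move=> nf ng fg x; elim: m => //= m IH.
by rewrite ge_max !le_max IH (chain_le HE)// orbT.
Qed.

Lemma chain_nested_le k l x y : (k <= l)%N -> e l x y -> e k x y.
Proof.
elim: l => [|l IH]; first by rewrite leqn0 => /eqP ->.
rewrite leq_eqVlt => /orP[/eqP -> //|]; rewrite ltnS => /IH h.
by move/(chain_nested HE).
Qed.

Lemma runmax_invar f m k : (m <= k.+1)%N -> nnb f -> invar (e k) (runmax f m).
Proof.
move=> + nf x y exy; elim: m => //= m IH mk.
rewrite IH; last exact: ltnW.
by congr Num.max; apply: (chain_invar HE nf); exact: chain_nested_le exy.
Qed.

(* f contributes at most half of its average where it is at most half of it,
   so the remaining part carries at least the other half *)
Let big f k x := f x * (E k f x < 2 * f x)%R%:R.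

Lemma big_nnb f k : nnb f -> nnb (big f k).
Proof.
move=> nf; apply: nnbM => //.
have -> : (fun x => (E k f x < 2 * f x)%R%:R : R) =
    \1_[set x | (E k f x < 2 * f x)%R].
  by apply/funext => x; rewrite indicE; congr (_%:R); rewrite mem_setE.
apply: nnb_indic.
have mE := nnb_meas (chain_nnb HE k nf).
have mf : measurable_fun setT (fun x => 2 * f x).
  by apply: measurable_funM => //; exact: nnb_meas.
have := measurable_fun_ltr mE mf measurableT (Y := [set true]) I.
by rewrite setTI.
Qed.

Lemma avg_le_big f k x : nnb f -> E k f x <= 2 * E k (big f k) x.
Proof.
move=> nf.
have nb := big_nnb k nf.
have nE := chain_nnb HE k nf.
pose h := fun x => 2^-1 * E k f x.
have nh : nnb h by apply: nnbM => //; exact: nnb_cst.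
have ih : invar (e k) h by move=> y z yz; rewrite /h (chain_invar HE nf yz).
have : E k f x <= E k (fun x => big f k x + h x) x.
  apply: (chain_le HE) => //; first exact: nnbD.
  move=> y; rewrite /big /h.
  have := nnb_ge0 y nf; have := nnb_ge0 y nE.
  by case: ltP => /= ? ? ?; lra.
rewrite (chainD HE)// (chain_id HE nh)// /h; lra.
Qed.

Variables (q : R) (q1 : 1 < q).

(* the weight of the k-th average in the telescoping of runmax ^ q; being
   constant on the atoms of level k, it lets that average be moved to w *)
Let D f k x := runmax f k.+1 x `^ (q - 1) - runmax f k x `^ (q - 1).

Let D_ge0 f k x : 0 <= D f k x.
Proof.
rewrite /D subr_ge0 ge0_ler_powR//; last exact: runmax_le.
- by rewrite subr_ge0 ltW.
- by rewrite nnegrE runmax_ge0.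
- by rewrite nnegrE runmax_ge0.
Qed.

Let D_nnb f k : nnb f -> nnb (D f k).
Proof.
move=> nf.
have q0 : 0 <= q - 1 by rewrite subr_ge0 ltW.
have [m1 p1 [c1 h1]] := nnb_powR q0 (runmax_nnb k.+1 nf).
have [m2 p2 _] := nnb_powR q0 (runmax_nnb k nf).
split.
- exact: measurable_funB.
- by move=> x; exact: D_ge0.
- by exists c1 => x; rewrite /D lerBlDr (le_trans (h1 x))// lerDl.
Qed.

Let D_invar f k : nnb f -> invar (e k) (D f k).
Proof.
move=> nf x y xy; rewrite /D (runmax_invar (leqnn _) nf xy).
by rewrite (runmax_invar (leqnSn _) nf xy).
Qed.

(** Only the times at which the running maximum jumps count, and there its
    new value is the current average. *)
Lemma runmax_powR_le f m x :
  runmax f m x `^ q <= q / (q - 1) * \sum_(k < m) D f k x * E k f x.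
Proof.
elim: m => [|m IH].
  by rewrite big_ord0 mulr0 /= powR0// gt_eqF// (lt_trans ltr01).
rewrite big_ord_recr /= mulrDr.
rewrite -[leLHS](subrK (runmax f m x `^ q)) addrC lerD//.
rewrite [D _ _ _ * _]mulrC /D /=.
have [h|h] := leP (E m f x) (runmax f m x).
  by rewrite !subrr mulr0 mulr0.
by apply: powR_telescope => //; [exact: runmax_ge0|exact: ltW].
Qed.

(** The sum over all k would telescope to the power of the final maximum; the
    jumps kept here lead to values below 2 f, which bounds them by f itself. *)
Lemma sum_D_big f m x : 0 <= f x ->
  \sum_(k < m) D f k x * (E k f x < 2 * f x)%R%:R <=
  Num.min (runmax f m x) (2 * f x) `^ (q - 1).
Proof.
move=> f0.
have qp : 0 < q - 1 by rewrite subr_gt0.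
elim: m => [|m IH]; first by rewrite big_ord0 powR_ge0.
rewrite big_ord_recr /=.
have [h|h] := leP (E m f x) (runmax f m x).
  by rewrite /D /= (max_idPl h) subrr mul0r addr0.
case: ltP => /= h2.
  rewrite mulr1.
  move: IH; rewrite min_l; last by rewrite (le_trans (ltW h))// ltW.
  rewrite /D /= (max_idPr (ltW h)) => IH.
  by rewrite addrCA gerDl subr_le0.
rewrite mulr0 addr0 (le_trans IH)//.
rewrite ge0_ler_powR ?(ltW qp)// ?nnegrE ?le_min ?runmax_ge0 ?mulr_ge0//.
by rewrite ge_min lexx orbT.
Qed.

(** The Fefferman-Stein inequality for a discrete chain.  By
    [runmax_powR_le], runmax f ^ q is at most a combination of the averages
    E k f <= 2 E k (big f k) with coefficients D f k constant on atoms.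
    Adjointness turns int D_k (E k (big f k)) w into int D_k (big f k) (E k w),
    where E k w is at most the maximal function of w, and the sum of the
    D_k (big f k) is at most f (2 f) ^ (q - 1) by [sum_D_big]. *)
Lemma doob_weighted f w m : nnb f -> nnb w ->
  (\int[P]_x (runmax f m x `^ q * w x)%:E <=
   (q / (q - 1) * 2 `^ q)%:E * \int[P]_x (f x `^ q * runmax w m x)%:E)%E.
Proof.
move=> nf nw.
have qp : 0 < q - 1 by rewrite subr_gt0.
have q0 : 0 < q by lra.
pose c := q / (q - 1).
have c0 : 0 <= c by rewrite divr_ge0// ltW.
have nD k := D_nnb k nf.
have nb k := big_nnb k nf.
have nEb k := chain_nnb HE k (nb k).
have nEw k := chain_nnb HE k nw.
have nm := runmax_nnb m nw.
have int_le (g h : T -> R) : nnb g -> nnb h -> (forall x, g x <= h x) ->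
    (\int[P]_x (g x)%:E <= \int[P]_x (h x)%:E)%E.
  move=> ng nh gh; apply: ge0_le_integral => //.
  - by move=> x _; rewrite lee_fin nnb_ge0.
  - exact: nnb_EFin.
  - exact: nnb_EFin.
  - by move=> x _; rewrite lee_fin.
have n1 k : nnb (fun x => D f k x * E k (big f k) x * w x).
  exact: nnbM (nnbM (nD k) (nEb k)) nw.
have n2 k : nnb (fun x => D f k x * big f k x * E k w x).
  exact: nnbM (nnbM (nD k) (nb k)) (nEw k).
have n3 k : nnb (fun x => D f k x * big f k x * runmax w m x).
  exact: nnbM (nnbM (nD k) (nb k)) (runmax_nnb m nw).
have s1 : nnb (fun x => \sum_(k < m) D f k x * E k (big f k) x * w x).
  by apply: nnb_sum => k; exact: n1.
have s2 : nnb (fun x => \sum_(k < m) D f k x * big f k x * E k w x).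
  by apply: nnb_sum => k; exact: n2.
apply: (@le_trans _ _ ((2 * c)%:E *
    \int[P]_x (\sum_(k < m) D f k x * E k (big f k) x * w x)%:E)%E).
  rewrite -ge0_integralZl//; last 3 first.
  - exact: nnb_EFin.
  - by move=> x _; rewrite lee_fin (nnb_ge0 x s1).
  - by rewrite lee_fin mulr_ge0.
  apply: (int_le _ (fun x => 2 * c *
    (\sum_(k < m) D f k x * E k (big f k) x * w x))).
  - by apply: nnbM => //; apply: nnb_powR; [exact: ltW|exact: runmax_nnb].
  - by apply: nnbM => //; apply: nnb_cst; rewrite mulr_ge0.
  move=> x; rewrite -mulr_suml mulrA ler_wpM2r ?(nnb_ge0 x nw)//.
  apply: le_trans (runmax_powR_le f m x) _.
  rewrite -/c [2 * c]mulrC -[c * 2 * _]mulrA ler_wpM2l// mulr_sumr ler_sum// => k _.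
  by rewrite mulrCA ler_wpM2l// avg_le_big.
rewrite (_ : \int[P]_x _ =
    \int[P]_x (\sum_(k < m) D f k x * big f k x * E k w x)%:E)%E; last first.
  under eq_integral do rewrite -sumEFin.
  rewrite ge0_integral_sum//; last 2 first.
  - by move=> k; exact: nnb_EFin.
  - by move=> k x _; rewrite lee_fin (nnb_ge0 x (n1 k)).
  under [RHS]eq_integral do rewrite -sumEFin.
  rewrite ge0_integral_sum//; last 2 first.
  - by move=> k; exact: nnb_EFin.
  - by move=> k x _; rewrite lee_fin (nnb_ge0 x (n2 k)).
  apply: eq_bigr => k _; apply: (chain_adj HE) => //.
  exact: D_invar.
have nfq : nnb (fun x => f x `^ q * runmax w m x).
  by apply: nnbM => //; apply: nnb_powR => //; exact: ltW.
rewrite -ge0_integralZl//; last 3 first.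
- exact: nnb_EFin.
- by move=> x _; rewrite lee_fin (nnb_ge0 x s2).
- by rewrite lee_fin mulr_ge0.
rewrite -ge0_integralZl//; last 3 first.
- exact/nnb_EFin.
- by move=> x _; rewrite lee_fin (nnb_ge0 x nfq).
- by rewrite lee_fin mulr_ge0// powR_ge0.
apply: (int_le
  (fun x => 2 * c * (\sum_(k < m) D f k x * big f k x * E k w x))
  (fun x => c * 2 `^ q * (f x `^ q * runmax w m x))).
- by apply: nnbM => //; apply: nnb_cst; rewrite mulr_ge0.
- by apply: nnbM => //; apply: nnb_cst; rewrite mulr_ge0// powR_ge0.
move=> x.
have fx := nnb_ge0 x nf.
apply: (@le_trans _ _ (2 * c * (f x * (2 * f x) `^ (q - 1) * runmax w m x))).
  apply: ler_wpM2l; first by rewrite mulr_ge0.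
  apply: (@le_trans _ _ (f x * (\sum_(k < m) D f k x * (E k f x < 2 * f x)%R%:R) *
      runmax w m x)).
    rewrite mulr_sumr mulr_suml ler_sum// => k _.
    rewrite /big (mulrCA (D f k x)) ler_wpM2l//; last exact: le_runmax.
    by rewrite !mulr_ge0.
  rewrite ler_wpM2r ?runmax_ge0// ler_wpM2l//.
  apply: le_trans (sum_D_big m fx) _.
  rewrite ge0_ler_powR ?(ltW qp)// ?nnegrE ?le_min ?runmax_ge0 ?mulr_ge0//.
  by rewrite ge_min lexx orbT.
rewrite powRM// -(@mulr_powRB1 _ 2 q)// -(@mulr_powRB1 _ (f x) q)//.
lra.
Qed.

End Doob.

(** * Grid intervals and averages along one coordinate *)

Section Grids.
Context {R : realType}.
Local Notation mu := (@lebesgue_measure R).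

(** The two grids of mesh 2 ^ k: the dyadic one, and one shifted by a third of
    the mesh.  The sign of the shift alternates with k because
    2 (- 1 / 3) = 1 / 3 - 1, so that doubling the mesh keeps every other
    endpoint and the shifted grids are nested too. *)
Definition gshift (g : bool) (k : int) : R := if g then (-1) ^ k / 3 else 0.

Definition gidx (g : bool) (k : int) (x : R) : int :=
  Num.floor (x / 2 ^ k - gshift g k).

Lemma exp2_gt0 (k : int) : 0 < 2 ^ k :> R.
Proof. by rewrite exprz_gt0. Qed.

Lemma gidxE g k x m : (gidx g k x == m) =
  ((m%:~R + gshift g k) * 2 ^ k <= x < ((m + 1)%:~R + gshift g k) * 2 ^ k).
Proof.
by rewrite floor_eq lerBrDr ltrBlDr ler_pdivlMr ?exp2_gt0// ltr_pdivrMr ?exp2_gt0.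
Qed.

Lemma gidx_itv g k x : [set y | gidx g k y = gidx g k x] =
  `[((gidx g k x)%:~R + gshift g k) * 2 ^ k,
    ((gidx g k x)%:~R + gshift g k) * 2 ^ k + 2 ^ k[%classic.
Proof.
have E (m : int) : (m%:~R + gshift g k) * 2 ^ k + 2 ^ k =
    ((m + 1)%:~R + gshift g k) * 2 ^ k :> R by rewrite intrD; ring.
by apply/seteqP; split => y /=; rewrite in_itv /= E -gidxE => /eqP.
Qed.

Lemma gshiftS g k : exists e : int, 2 * gshift g (k + 1) = gshift g k + e%:~R.
Proof.
rewrite /gshift; case: g; last by exists 0; rewrite mulr0 addr0.
have n1 : (-1 : R) != 0 by rewrite oppr_eq0 oner_eq0.
exists (- (-1) ^ k).
rewrite expfzDr// expr1z intrN.
have -> : ((-1) ^ k)%:~R = (-1) ^ k :> R by rewrite rmorphXz// ?unitrN1// rmorphN1.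
lra.
Qed.

(** By [gshiftS] the index at scale k + 1 is the integral part of half of the
    shifted index at scale k. *)
Lemma gidxS g k x y : gidx g k x = gidx g k y -> gidx g (k + 1) x = gidx g (k + 1) y.
Proof.
have [e he] := gshiftS g k.
have E z : gidx g (k + 1) z = Num.floor ((z / 2 ^ k - gshift g k - e%:~R) / 2).
  congr Num.floor; rewrite expfzDr// expr1z invfM.
  have -> : gshift g (k + 1) = (gshift g k + e%:~R) / 2 by lra.
  lra.
rewrite !E => xy.
wlog suff : x y xy / Num.floor ((x / 2 ^ k - gshift g k - e%:~R) / 2) <=
    Num.floor ((y / 2 ^ k - gshift g k - e%:~R) / 2).
  by move=> H; apply/eqP; rewrite eq_le (H x y)// (H y x).
rewrite floor_ge_int; set m := Num.floor _.
have : m%:~R <= (x / 2 ^ k - gshift g k - e%:~R) / 2 by exact: floor_le.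
rewrite !ler_pdivlMr// !lerBrDr.
have -> : m%:~R * 2 + e%:~R = (m * 2 + e)%:~R :> R by rewrite intrD intrM.
by rewrite -!lerBrDr -!floor_ge_int -/(gidx g k x) -/(gidx g k y) xy.
Qed.

Lemma gidx_le g k l x y : k <= l -> gidx g k x = gidx g k y -> gidx g l x = gidx g l y.
Proof.
move=> kl; rewrite -(subrK k l) addrC.
have : 0 <= l - k by rewrite subr_ge0.
case: (l - k) => // n _; elim: n => [|n IH h]; first by rewrite addr0.
by rewrite -addn1 PoszD addrA; apply/gidxS/IH.
Qed.

Lemma lebesgue_gidx g k x : mu [set y | gidx g k y = gidx g k x] = (2 ^ k)%:E.
Proof.
rewrite gidx_itv lebesgue_measure_itv /= lte_fin ltrDl exp2_gt0.
by rewrite -EFinD addrAC subrr add0r.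
Qed.

Lemma measurable_gidx g k : measurable_fun setT (fun x : R => (gidx g k x)%:~R : R).
Proof.
apply: nondecreasing_measurable => // x y xy.
rewrite ler_int le_floor// lerB// ler_pM2r// invr_gt0.
exact: exp2_gt0.
Qed.

Definition samecell (g : bool) (k : int) (x y : R) : R :=
  (gidx g k y == gidx g k x)%:R.

Lemma samecellC g k x y : samecell g k x y = samecell g k y x.
Proof. by rewrite /samecell eq_sym. Qed.

Lemma samecell_ge0 g k x y : 0 <= samecell g k x y.
Proof. by rewrite /samecell. Qed.

Lemma measurable_samecell g k dT (T : measurableType dT)
    (f h : T -> measurableTypeR R) :
  measurable_fun setT f -> measurable_fun setT h ->
  measurable_fun setT (fun t => samecell g k (f t) (h t)).
Proof.
move=> mf mh.
have mF := measurableT_comp (measurable_gidx g k) mf.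
have mH := measurableT_comp (measurable_gidx g k) mh.
have := measurable_fun_eqr mH mF measurableT (Y := [set true]) I.
rewrite setTI => m1.
have -> : (fun t => samecell g k (f t) (h t)) =
    \1_[set t | gidx g k (h t) == gidx g k (f t)].
  by apply/funext => t; rewrite indicE; congr (_%:R); rewrite mem_setE.
apply: measurable_indic; move: m1; congr measurable.
by apply/seteqP; split => t /=; rewrite eqr_int.
Qed.

Lemma integral_samecell g k x :
  (\int[mu]_y (samecell g k x y)%:E = (2 ^ k)%:E)%E.
Proof.
rewrite -(lebesgue_gidx g k x) -[in RHS](setIT [set y | _]).
rewrite -integral_indic//; last by rewrite gidx_itv; exact: measurable_itv.
apply: eq_integral => y _; rewrite indicE /samecell; congr ((nat_of_bool _)%:R%:E).
by apply/idP/idP => [/eqP ?|]; rewrite inE// => /eqP.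
Qed.

End Grids.

Section Average.
Context {R : realType} {d : nat}.
Local Notation mu := (@lebesgue_measure R).
Implicit Types (f u w : Rn R d -> R) (i : 'I_d) (g : bool) (k : int).

Definition avg i g k f (x : Rn R d) : R :=
  fine (\int[mu]_y (samecell g k (tnth x i) y * f (upd i x y))%:E)%E / 2 ^ k.

Let kern i g k f (x : Rn R d) (y : measurableTypeR R) : R :=
  samecell g k (tnth x i) y * f (upd i x y).

Let measurable_kern i g k f : measurable_fun setT f ->
  measurable_fun [set: Rn R d * measurableTypeR R] (fun p => kern i g k f p.1 p.2).
Proof.
move=> mf; apply: measurable_funM.
  apply: measurable_samecell => //.
  exact: (measurableT_comp (measurable_tnth i)).
by apply: (measurableT_comp mf); exact: measurable_upd.
Qed.

Let measurable_kern1 i g k f x : measurable_fun setT f ->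
  measurable_fun [set: measurableTypeR R] (kern i g k f x).
Proof.
move=> mf; exact: (measurable_fun2 (measurable_kern i g k mf)).
Qed.

Let kern_ge0 i g k f x y : nnb f -> 0 <= kern i g k f x y.
Proof. by move=> nf; rewrite mulr_ge0 ?samecell_ge0// nnb_ge0. Qed.

Let measurable_samecell1 g k (x : R) :
  measurable_fun [set: measurableTypeR R] (fun y => (samecell g k x y)%:E).
Proof. by apply/measurable_EFinP; exact: measurable_samecell. Qed.

Let integral_kern_le i g k f x c : nnb f -> (forall y, f y <= c) ->
  (\int[mu]_y (kern i g k f x y)%:E <= (c * 2 ^ k)%:E)%E.
Proof.
move=> nf fc.
have c0 : 0 <= c by exact: le_trans (nnb_ge0 x nf) (fc x).
rewrite EFinM -(integral_samecell g k (tnth x i)) -ge0_integralZl//; last first.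
  by move=> y _; rewrite lee_fin samecell_ge0.
apply: ge0_le_integral => //.
- by move=> y _; rewrite lee_fin kern_ge0.
- apply/measurable_EFinP; exact: (measurable_kern1 i g k x (nnb_meas nf)).
- by apply/measurable_EFinP; apply: measurable_funM => //; exact: measurable_samecell.
- by move=> y _; rewrite -EFinM lee_fin [c * _]mulrC ler_wpM2l ?samecell_ge0.
Qed.

Lemma avgE i g k f x : nnb f -> (avg i g k f x)%:E =
  ((2 ^ k)^-1%:E * \int[mu]_y (samecell g k (tnth x i) y * f (upd i x y))%:E)%E.
Proof.
move=> nf; rewrite /avg mulrC EFinM fineK//.
have [_ _ [c fc]] := nf.
rewrite ge0_fin_numE; last first.
  by apply: integral_ge0 => y _; rewrite lee_fin (kern_ge0 _ _ _ _ y nf).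
exact: le_lt_trans (integral_kern_le i g k x nf fc) (ltry _).
Qed.

Lemma avg_bound i g k f c x : nnb f -> (forall y, f y <= c) -> avg i g k f x <= c.
Proof.
move=> nf fc; rewrite -lee_fin avgE//.
apply: (@le_trans _ _ ((2 ^ k)^-1%:E * (c * 2 ^ k)%:E)%E).
  rewrite lee_wpmul2l//; last exact: integral_kern_le.
  by rewrite lee_fin invr_ge0 ltW// exp2_gt0.
by rewrite -EFinM lee_fin mulrC mulfK// gt_eqF// exp2_gt0.
Qed.

Lemma avg_nnb i g k f : nnb f -> nnb (avg i g k f).
Proof.
move=> nf; have [mf f0 [c fc]] := nf; split.
- apply: measurable_funM => //.
  apply: (measurableT_comp (fine_measurable measurableT)) => //.
  apply: (@measurable_integral R _ _ _ _ mu (fun x y => (kern i g k f x y)%:E)).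
    by apply/measurable_EFinP; exact: measurable_kern.
  by move=> x y; rewrite lee_fin kern_ge0.
- move=> x; apply: divr_ge0; last exact/ltW/exp2_gt0.
  apply: fine_ge0.
  by apply: integral_ge0 => y _; rewrite lee_fin (kern_ge0 _ _ _ _ y nf).
- by exists c => x; exact: avg_bound.
Qed.

Lemma avg_le i g k f h x : nnb f -> nnb h -> (forall y, f y <= h y) ->
  avg i g k f x <= avg i g k h x.
Proof.
move=> nf nh fh; rewrite -lee_fin !avgE//.
apply: lee_wpmul2l; first by rewrite lee_fin invr_ge0 ltW// exp2_gt0.
apply: ge0_le_integral => //.
- by move=> y _; rewrite lee_fin (kern_ge0 _ _ _ _ y nf).
- apply/measurable_EFinP; exact: (measurable_kern1 i g k x (nnb_meas nf)).
- apply/measurable_EFinP; exact: (measurable_kern1 i g k x (nnb_meas nh)).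
- by move=> y _; rewrite lee_fin ler_wpM2l ?samecell_ge0.
Qed.

Lemma avgD i g k f h x : nnb f -> nnb h ->
  avg i g k (fun x => f x + h x) x = avg i g k f x + avg i g k h x.
Proof.
move=> nf nh; apply: EFin_inj; rewrite EFinD !avgE//; last exact: nnbD.
rewrite -ge0_muleDr.
- congr (_ * _)%E; rewrite -ge0_integralD//.
  + by apply: eq_integral => y _; rewrite -EFinD mulrDr.
  + by move=> y _; rewrite lee_fin (kern_ge0 _ _ _ _ y nf).
  + apply/measurable_EFinP; exact: (measurable_kern1 i g k x (nnb_meas nf)).
  + by move=> y _; rewrite lee_fin (kern_ge0 _ _ _ _ y nh).
  + apply/measurable_EFinP; exact: (measurable_kern1 i g k x (nnb_meas nh)).
- by apply: integral_ge0 => y _; rewrite lee_fin (kern_ge0 _ _ _ _ y nf).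
- by apply: integral_ge0 => y _; rewrite lee_fin (kern_ge0 _ _ _ _ y nh).
Qed.

Lemma avgZ i g k c f x : 0 <= c -> nnb f ->
  avg i g k (fun y => c * f y) x = c * avg i g k f x.
Proof.
move=> c0 nf; apply: EFin_inj; rewrite (EFinM c) !avgE//; last first.
  by apply: nnbM => //; exact: nnb_cst.
rewrite muleCA; congr (_ * _)%E; rewrite -ge0_integralZl//.
- by apply: eq_integral => y _; rewrite -EFinM mulrCA.
- apply/measurable_EFinP; exact: (measurable_kern1 i g k x (nnb_meas nf)).
- by move=> y _; rewrite lee_fin (kern_ge0 _ _ _ _ y nf).
Qed.

Definition cellrel i g k (x x' : Rn R d) : Prop :=
  exists2 y, x' = upd i x y & gidx g k y = gidx g k (tnth x i).

Lemma avg_id i g k u x : nnb u -> invar (cellrel i g k) u -> avg i g k u x = u x.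
Proof.
move=> nu iu; apply: EFin_inj; rewrite avgE//.
transitivity ((2 ^ k)^-1%:E * \int[mu]_y ((u x)%:E * (samecell g k (tnth x i) y)%:E))%E.
  congr (_ * _)%E; apply: eq_integral => y _; rewrite -EFinM; congr EFin.
  rewrite /samecell; case: eqP => [h|_]; last by rewrite mul0r mulr0.
  by rewrite mul1r mulr1; apply/esym/iu; exists y.
rewrite ge0_integralZl//; last 2 first.
- by move=> y _; rewrite lee_fin samecell_ge0.
- by rewrite lee_fin nnb_ge0.
rewrite integral_samecell muleCA -EFinM mulVf ?mulr1//.
exact/lt0r_neq0/exp2_gt0.
Qed.

Lemma avg_invar i g k f : invar (cellrel i g k) (avg i g k f).
Proof.
move=> x _ [y -> h]; rewrite /avg; congr (_ / _); congr fine.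
apply: eq_integral => z _; rewrite upd_upd tnth_upd eqxx.
by congr (_ * _)%:E; rewrite /samecell h.
Qed.

(** The averaging kernel is symmetric in the two copies of the coordinate, and
    it only relates points of one cell, on which u is constant. *)
Lemma avg_adj i g k u f w : nnb u -> nnb f -> nnb w -> invar (cellrel i g k) u ->
  (\int[leb d]_x (u x * avg i g k f x * w x)%:E =
   \int[leb d]_x (u x * f x * avg i g k w x)%:E)%E.
Proof.
move=> nu nf nw iu.
pose H x y := ((2 ^ k)^-1 * (u x * w x * kern i g k f x y))%:E.
have mx (h : Rn R d -> R) : nnb h ->
    measurable_fun [set: Rn R d * measurableTypeR R] (fun p => h p.1).
  by move=> nh; apply: measurableT_comp => //; exact: nnb_meas.
have k0 : 0 <= (2 ^ k)^-1 :> R by rewrite invr_ge0 ltW// exp2_gt0.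
have mH : measurable_fun [set: Rn R d * measurableTypeR R] (fun p => H p.1 p.2).
  apply/measurable_EFinP; apply: measurable_funM => //.
  apply: measurable_funM; last by apply: measurable_kern; exact: nnb_meas.
  by apply: measurable_funM; exact: mx.
have H0 x y : (0 <= H x y)%E.
  by rewrite lee_fin !mulr_ge0// ?(nnb_ge0 _ nu) ?(nnb_ge0 _ nw) ?samecell_ge0 ?(nnb_ge0 _ nf).
have pull (a : R) h x : 0 <= a -> nnb h ->
    (\int[mu]_y ((2 ^ k)^-1 * (a * kern i g k h x y))%:E = (a * avg i g k h x)%:E)%E.
  move=> a0 nh; rewrite EFinM avgE// muleCA.
  rewrite -ge0_integralZl//; last 2 first.
  - apply/measurable_EFinP; exact: (measurable_kern1 i g k x (nnb_meas nh)).
  - by move=> y _; rewrite lee_fin (kern_ge0 _ _ _ _ y nh).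
  rewrite -ge0_integralZl//.
  - apply: measurable_funeM.
    apply/measurable_EFinP; exact: (measurable_kern1 i g k x (nnb_meas nh)).
  - by move=> y _; rewrite -EFinM lee_fin mulr_ge0// (kern_ge0 _ _ _ _ y nh).
transitivity (\int[leb d]_x \int[mu]_y H x y)%E.
  apply: eq_integral => x _; rewrite /H pull//; first by congr EFin; ring.
  by rewrite mulr_ge0 ?(nnb_ge0 _ nu) ?(nnb_ge0 _ nw).
rewrite (integral_upd_swap i mH H0); apply: eq_integral => x _.
rewrite -pull//; last by rewrite mulr_ge0 ?(nnb_ge0 _ nu) ?(nnb_ge0 _ nf).
apply: eq_integral => y _; congr EFin; congr (_ * _).
rewrite /kern upd_upd upd_id tnth_upd eqxx samecellC.
rewrite /samecell; case: eqP => [h|_]; last by rewrite !mul0r !mulr0.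
rewrite -(iu x (upd i x y)); last by exists y.
by rewrite !mul1r mulrAC.
Qed.

End Average.

(** * One-coordinate maximal functions *)

Section CoordinateMaximal.
Context {R : realType} {d : nat}.
Implicit Types (f u w : Rn R d -> R) (i : 'I_d) (g : bool) (k : int) (n : nat).

(** A chain must refine as its index grows, so the scales -n, ..., n are listed
    from the longest intervals to the shortest. *)
Definition scale n m : int := n%:Z - m%:Z.

Lemma avg_chain i g n : averaging_chain (leb d)
  (fun m => avg i g (scale n m)) (fun m => @cellrel R d i g (scale n m)).
Proof.
split.
- move=> m x _ [y -> h]; exists y => //.
  by apply: gidx_le h; rewrite /scale; lia.
- by move=> m f; exact: avg_nnb.
- by move=> m f _; exact: avg_invar.
- by move=> m f h nf nh fh x; exact: avg_le.
- by move=> m f h nf nh x; exact: avgD.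
- by move=> m u nu iu x; exact: avg_id.
- by move=> m u f w nu nf nw iu; exact: avg_adj.
Qed.

Definition gridmax n i g f : Rn R d -> R :=
  runmax (fun m => avg i g (scale n m)) f (2 * n).+1.

Definition coordmax n i f x := Num.max (gridmax n i false f x) (gridmax n i true f x).

Lemma avg_le_gridmax n i g k f x : `|k| <= n%:Z -> avg i g k f x <= gridmax n i g f x.
Proof.
move=> kn.
have e : k = scale n `|n%:Z - k|%N by rewrite /scale; lia.
rewrite [in leLHS]e; apply: (le_runmax (fun m => avg i g (scale n m))).
by lia.
Qed.

Lemma gridmax_le_coordmax n i g f x : gridmax n i g f x <= coordmax n i f x.
Proof. by rewrite /coordmax le_max; case: g; rewrite lexx ?orbT. Qed.

Lemma avg_le_coordmax n i g k f x : `|k| <= n%:Z -> avg i g k f x <= coordmax n i f x.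
Proof.
by move=> kn; exact: le_trans (avg_le_gridmax _ _ _ _ kn) (gridmax_le_coordmax _ _ _ _ _).
Qed.

Lemma coordmax_nnb n i f : nnb f -> nnb (coordmax n i f).
Proof.
by move=> nf; apply: nnb_max; exact: (runmax_nnb (avg_chain _ _ _) _ nf).
Qed.

Lemma gridmax_mono n i g f h x : nnb f -> nnb h -> (forall x, f x <= h x) ->
  gridmax n i g f x <= gridmax n i g h x.
Proof. by move=> nf nh fh; exact: (runmax_mono (avg_chain i g n)). Qed.

Lemma coordmax_mono n i f h : nnb f -> nnb h -> (forall x, f x <= h x) ->
  forall x, coordmax n i f x <= coordmax n i h x.
Proof.
move=> nf nh fh x.
rewrite {1}/coordmax ge_max; apply/andP; split.
  exact: le_trans (gridmax_mono n i false x nf nh fh) (gridmax_le_coordmax _ _ _ _ _).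
exact: le_trans (gridmax_mono n i true x nf nh fh) (gridmax_le_coordmax _ _ _ _ _).
Qed.

Lemma gridmax_bound n i g f c x : 0 <= c -> nnb f -> (forall y, f y <= c) ->
  gridmax n i g f x <= c.
Proof.
move=> c0 nf fc; rewrite /gridmax; elim: (2 * n).+1 => //= m IH.
by rewrite ge_max IH avg_bound.
Qed.

Lemma coordmax_bound n i f c x : 0 <= c -> nnb f -> (forall y, f y <= c) ->
  coordmax n i f x <= c.
Proof.
move=> c0 nf fc; rewrite /coordmax ge_max.
by apply/andP; split; exact: gridmax_bound.
Qed.

Lemma gridmax_scale n m i g f x : nnb f -> (n <= m)%N ->
  gridmax n i g f x <= gridmax m i g f x.
Proof.
move=> nf nm; rewrite {1}/gridmax.
have : ((2 * n).+1 <= (2 * n).+1)%N by [].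
elim: {1 3}(2 * n).+1 => [_|l IH ln] /=; first exact: runmax_ge0.
rewrite ge_max IH ?(ltnW ln)//=; apply: avg_le_gridmax; rewrite /scale; lia.
Qed.

Lemma coordmax_scale n m i f x : nnb f -> (n <= m)%N ->
  coordmax n i f x <= coordmax m i f x.
Proof.
move=> nf nm; rewrite {1}/coordmax ge_max; apply/andP; split.
  exact: le_trans (gridmax_scale i false x nf nm) (gridmax_le_coordmax _ _ _ _ _).
exact: le_trans (gridmax_scale i true x nf nm) (gridmax_le_coordmax _ _ _ _ _).
Qed.

Lemma ge0_le_nnb f h : nnb f -> nnb h -> (forall x, f x <= h x) ->
  (\int[leb d]_x (f x)%:E <= \int[leb d]_x (h x)%:E)%E.
Proof.
move=> nf nh fh; apply: ge0_le_integral => //.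
- by move=> x _; rewrite lee_fin nnb_ge0.
- exact: nnb_EFin.
- exact: nnb_EFin.
- by move=> x _; rewrite lee_fin.
Qed.

Lemma ge0_integralZl_nnb c f : 0 <= c -> nnb f ->
  (\int[leb d]_x (c * f x)%:E = c%:E * \int[leb d]_x (f x)%:E)%E.
Proof.
move=> c0 nf; under eq_integral do rewrite EFinM.
apply: ge0_integralZl => //; first exact: nnb_EFin.
by move=> x _; rewrite lee_fin nnb_ge0.
Qed.

Lemma ge0_integralD_nnb f h : nnb f -> nnb h ->
  (\int[leb d]_x (f x + h x)%:E =
   \int[leb d]_x (f x)%:E + \int[leb d]_x (h x)%:E)%E.
Proof.
move=> nf nh; under eq_integral do rewrite EFinD.
apply: ge0_integralD => //; try exact: nnb_EFin;
  by move=> x _; rewrite lee_fin nnb_ge0.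
Qed.

(** The leading factor 2 pays for the maximum over the two grids. *)
Definition doobC (q : R) := 2 * (q / (q - 1) * 2 `^ q).

Lemma doobC_ge0 q : 1 < q -> 0 <= doobC q.
Proof.
move=> q1; rewrite !mulr_ge0 ?powR_ge0//; first by lra.
by rewrite invr_ge0; lra.
Qed.

Lemma coordmax_weighted q n i f w : 1 < q -> nnb f -> nnb w ->
  (\int[leb d]_x (coordmax n i f x `^ q * w x)%:E <=
   (doobC q)%:E * \int[leb d]_x (f x `^ q * coordmax n i w x)%:E)%E.
Proof.
move=> q1 nf nw.
have q0 : 0 <= q by lra.
have c0 := doobC_ge0 q1.
have ng g : nnb (gridmax n i g f) by exact: (runmax_nnb (avg_chain _ _ _) _ nf).
have nwg g : nnb (gridmax n i g w) by exact: (runmax_nnb (avg_chain _ _ _) _ nw).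
have nq g : nnb (fun x => gridmax n i g f x `^ q * w x).
  by apply: nnbM => //; exact: nnb_powR.
have nm : nnb (fun x => f x `^ q * coordmax n i w x).
  by apply: nnbM; [exact: nnb_powR|exact: coordmax_nnb].
have one g : (\int[leb d]_x (gridmax n i g f x `^ q * w x)%:E <=
    (q / (q - 1) * 2 `^ q)%:E * \int[leb d]_x (f x `^ q * coordmax n i w x)%:E)%E.
  apply: le_trans (doob_weighted (avg_chain i g n) q1 _ nf nw) _.
  apply: lee_wpmul2l.
    by rewrite lee_fin mulr_ge0 ?powR_ge0// divr_ge0//; lra.
  apply: ge0_le_nnb => //; first by apply: nnbM; [exact: nnb_powR|exact: nwg].
  by move=> x; rewrite ler_wpM2l ?powR_ge0// (gridmax_le_coordmax n i g w).
apply: (@le_trans _ _ (\int[leb d]_x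
    (gridmax n i false f x `^ q * w x + gridmax n i true f x `^ q * w x)%:E)%E).
  apply: ge0_le_nnb.
  - by apply: nnbM => //; apply: nnb_powR => //; exact: coordmax_nnb.
  - exact: nnbD.
  - move=> x; rewrite -mulrDl ler_wpM2r ?(nnb_ge0 x nw)// /coordmax.
    case: (leP (gridmax n i false f x) (gridmax n i true f x)) => _.
      by rewrite lerDr powR_ge0.
    by rewrite lerDl powR_ge0.
rewrite ge0_integralD_nnb// /doobC mulrDl mul1r EFinD ge0_muleDl; last 2 first.
- by rewrite lee_fin mulr_ge0 ?powR_ge0// divr_ge0//; lra.
- by rewrite lee_fin mulr_ge0 ?powR_ge0// divr_ge0//; lra.
by apply: leeD; exact: one.
Qed.

Definition itermax n (L : seq 'I_d) f : Rn R d -> R := foldr (coordmax n) f L.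

Lemma itermax_nnb n L f : nnb f -> nnb (itermax n L f).
Proof. by move=> nf; elim: L => //= i L; exact: coordmax_nnb. Qed.

Lemma itermax_mono n L f h : nnb f -> nnb h -> (forall x, f x <= h x) ->
  forall x, itermax n L f x <= itermax n L h x.
Proof.
move=> nf nh fh; elim: L => //= i L IH.
by apply: coordmax_mono => //; exact: itermax_nnb.
Qed.

Lemma itermax_bound n L f c x : 0 <= c -> nnb f -> (forall y, f y <= c) ->
  itermax n L f x <= c.
Proof.
move=> c0 nf fc; elim: L x => //= i L IH x.
by apply: coordmax_bound => //; exact: itermax_nnb.
Qed.

Lemma itermax_scale n m L f x : nnb f -> (n <= m)%N ->
  itermax n L f x <= itermax m L f x.
Proof.
move=> nf nm; elim: L x => //= i L IH x.
apply: (@le_trans _ _ (coordmax n i (itermax m L f) x)).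
  by apply: coordmax_mono => //; exact: itermax_nnb.
by apply: coordmax_scale => //; exact: itermax_nnb.
Qed.

(** The coordinates are peeled off from the outermost one, and each step puts
    its operator on the weight; this is why the order is reversed there. *)
Lemma itermax_weighted q n L f w : 1 < q -> nnb f -> nnb w ->
  (\int[leb d]_x (itermax n L f x `^ q * w x)%:E <=
   (doobC q ^+ size L)%:E * \int[leb d]_x (f x `^ q * itermax n (rev L) w x)%:E)%E.
Proof.
move=> q1 nf; elim: L w => [|i L IH] w nw; first by rewrite expr0 mul1e.
apply: le_trans (coordmax_weighted n i q1 (itermax_nnb _ _ nf) nw) _.
rewrite [size _]/= exprS (EFinM (doobC q)) -[X in (_ <= X)%E]muleA.
apply: lee_wpmul2l; first by rewrite lee_fin doobC_ge0.
apply: le_trans (IH _ (coordmax_nnb n i nw)) _.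
by rewrite /= rev_cons -cats1 /itermax foldr_cat.
Qed.

(** An average over a box taken one coordinate at a time, so that each factor
    is bounded by a one-coordinate maximal function. *)
Definition boxavg (gr : 'I_d -> bool) (sc : 'I_d -> int) (L : seq 'I_d) f :=
  foldr (fun i => avg i (gr i) (sc i)) f L.

Lemma boxavg_nnb gr sc L f : nnb f -> nnb (boxavg gr sc L f).
Proof. by move=> nf; elim: L => //= i L; exact: avg_nnb. Qed.

Lemma boxavg_le_itermax n gr sc L f x : nnb f -> (forall i, `|sc i| <= n%:Z) ->
  boxavg gr sc L f x <= itermax n L f x.
Proof.
move=> nf scn; elim: L x => //= i L IH x.
apply: (@le_trans _ _ (avg i (gr i) (sc i) (itermax n L f) x)).
  by apply: avg_le => //; [exact: boxavg_nnb|exact: itermax_nnb].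
exact: avg_le_coordmax.
Qed.

End CoordinateMaximal.

Section BoxAverage.
Context {R : realType}.
Local Notation mu := (@lebesgue_measure R).

Lemma avg_lift d (i : 'I_d) g k (f : Rn R d.+1 -> R) t x :
  avg (lift ord0 i) g k f (cons_Rn (t, x)) =
  avg i g k (fun y => f (cons_Rn (t, y))) x.
Proof.
rewrite /avg; congr (_ / _); congr fine; apply: eq_integral => y _.
by rewrite upd_lift tnthS.
Qed.

Lemma boxavg_lift d (gr : 'I_d.+1 -> bool) sc (L : seq 'I_d) (f : Rn R d.+1 -> R) t x :
  boxavg gr sc (map (lift ord0) L) f (cons_Rn (t, x)) =
  boxavg (gr \o lift ord0) (sc \o lift ord0) L (fun y => f (cons_Rn (t, y))) x.
Proof.
elim: L x => //= i L IH x; rewrite avg_lift.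
by congr (avg _ _ _ _ _); apply/funext => y; exact: IH.
Qed.

Lemma cons_Rn_surj d (x : Rn R d.+1) : exists t y, x = cons_Rn (t, y).
Proof.
exists (thead x), [tuple of behead x].
by apply: val_inj; rewrite /= [in LHS](tuple_eta x).
Qed.

Lemma nnb_cons d (f : Rn R d.+1 -> R) t : nnb f ->
  nnb (fun y : Rn R d => f (cons_Rn (t, y))).
Proof.
move=> [mf f0 [c fc]]; split => //; last by exists c.
by apply: (measurableT_comp mf); exact: measurable_cons_fun.
Qed.

(** Tonelli: if every side of B lies in the grid cell of the corresponding
    coordinate of x, the iterated average over these cells dominates the
    integral over B. *)
Lemma boxavg_ge_int d (gr : 'I_d -> bool) sc (f : Rn R d -> R) x (B : 'I_d -> set R) :
  nnb f -> (forall i, measurable (B i : set (measurableTypeR R))) ->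
  (forall i y, B i y -> gidx (gr i) (sc i) y = gidx (gr i) (sc i) (tnth x i)) ->
  (\int[leb d]_(y in box B) (f y)%:E <=
   ((\prod_(i < d) 2 ^ sc i) * boxavg gr sc (rev (enum 'I_d)) f x)%:E)%E.
Proof.
elim: d gr sc f x B => [|d IH] gr sc f x B nf mB Bx.
  have -> : enum 'I_0 = [::] by apply: size0nil; rewrite size_enum_ord.
  rewrite big_ord0 mul1r /= integral_dirac//; last first.
    by apply: measurable_funTS; exact: nnb_EFin.
    exact: measurable_box.
  have -> : x = [tuple] :> Rn R 0 by exact: tuple0.
  by rewrite /= diracE mem_set ?mul1e// => -[].
have [t [z xE]] := cons_Rn_surj x.
rewrite {}xE {x} in Bx *.
have mbB := measurable_box mB.
have nfB : nnb (fun y => f y * \1_(box B) y).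
  by apply: nnbM => //; exact: nnb_indic.
rewrite integral_mkcond.
rewrite (_ : \int[leb d.+1]_y _ = \int[leb d.+1]_y (f y * \1_(box B) y)%:E)%E; last first.
  apply: eq_integral => y _; rewrite patchE indicE.
  by case: (y \in _); rewrite ?mulr1 ?mulr0.
rewrite integral_leb_cons; last 2 first.
- exact: nnb_EFin.
- by move=> y; rewrite lee_fin (nnb_ge0 y nfB).
rewrite enum_ordSl rev_cons -map_rev -cats1 /boxavg foldr_cat -/(boxavg _ _ _ _) /=.
rewrite boxavg_lift big_ord_recl /= -mulrA (EFinM (2 ^ sc ord0)).
set F := avg ord0 _ _ f.
have nF : nnb F by exact: avg_nnb.
have nFt := nnb_cons t nF.
have mB' i : measurable (B (lift ord0 i) : set (measurableTypeR R)) by exact: mB.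
have {}IH := IH (gr \o lift ord0) (sc \o lift ord0) _ z _ nFt mB'.
apply: (@le_trans _ _ ((2 ^ sc ord0)%:E *
    \int[leb d]_(y in box (fun i => B (lift ord0 i))) (F (cons_Rn (t, y)))%:E)%E); last first.
  apply: lee_wpmul2l; first by rewrite lee_fin ltW// exp2_gt0.
  apply: IH => i y By /=; rewrite (Bx _ _ By).
  by rewrite tnthS.
have mbB' := measurable_box mB'.
rewrite -ge0_integralZl//; last 3 first.
- by apply: measurable_funTS; exact: nnb_EFin.
- by move=> y _; rewrite lee_fin (nnb_ge0 _ nF).
- by rewrite lee_fin ltW// exp2_gt0.
rewrite [leRHS]integral_mkcond.
have mK : measurable_fun [set: measurableTypeR R * Rn R d]
    (fun p => (f (cons_Rn (p.1, p.2)) * \1_(box B) (cons_Rn (p.1, p.2)))%:E).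
  apply: (measurableT_comp (nnb_EFin nfB)).
  exact: measurable_cons_fun.
apply: ge0_le_integral => //.
- by move=> y _; apply: integral_ge0 => s _; rewrite lee_fin (nnb_ge0 _ nfB).
- apply: (@measurable_integral R _ _ _ _ mu
    (fun y s => (f (cons_Rn (s, y)) * \1_(box B) (cons_Rn (s, y)))%:E)).
    apply: (measurableT_comp (nnb_EFin nfB)).
    exact: measurable_cons_fun.
  by move=> y s; rewrite lee_fin (nnb_ge0 _ nfB).
- apply/(measurable_restrictT _ mbB').
  apply: measurable_funTS; apply: measurable_funeM.
  exact: nnb_EFin.
move=> y _; rewrite patchE; case: ifPn => [|] yB; last first.
  rewrite integral0_eq// => s _; rewrite indicE memNset ?mulr0// => h.
  move/negP: yB; apply; rewrite inE => i; have := h (lift ord0 i).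
  by rewrite tnthS.
rewrite /F avgE// muleA -EFinM mulfV ?gt_eqF ?exp2_gt0// mul1e.
apply: ge0_le_integral => //.
- by move=> s _; rewrite lee_fin (nnb_ge0 _ nfB).
- apply: (measurableT_comp (nnb_EFin nfB)).
  exact: measurable_cons_fun.
- apply/measurable_EFinP; apply: measurable_funM.
    exact: measurable_samecell.
  apply: (measurableT_comp (nnb_meas nf)).
  exact: measurable_upd.
move=> s _; rewrite lee_fin upd_ord0 indicE.
case: (boolP (_ \in _)) => [|_]; last by rewrite mulr0 mulr_ge0 ?samecell_ge0 ?(nnb_ge0 _ nf).
rewrite inE => /(_ ord0) /Bx; rewrite !tnth0 /samecell => ->.
by rewrite eqxx mul1r mulr1.
Qed.

End BoxAverage.

(** * Saturation of a set along the coordinates *)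

Section WeakDoob.
Context {R : realType} {dT : measure_display} {T : measurableType dT}.
Variables (P : {measure set T -> \bar R}).
Variables (E : nat -> (T -> R) -> T -> R) (e : nat -> T -> T -> Prop).
Hypothesis HE : averaging_chain P E e.

Lemma measurable_gt_nnb (c : R) f : nnb f -> measurable [set x : T | c < f x].
Proof.
move=> nf.
have := measurable_fun_ltr (measurable_cst c) (nnb_meas nf) measurableT (Y := [set true]) I.
by rewrite setTI.
Qed.

(** The weak-type inequality with constant 1.  Let D k be the set where the
    average of level k is the first to exceed 1 - eta; it is a union of atoms,
    so (1 - eta) P (D k) <= P (D k `&` A).  Summing over k, and adding the part
    of A where no average is large, gives the claim. *)
Lemma measure_saturation (eta : R) (A : set T) m : 0 < eta < 1 -> measurable A ->
  ((1 - eta)%:E * P (A `|` [set x | (1 - eta < runmax E \1_A m x)%R]) <= P A)%E.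
Proof.
move=> /andP[eta0 eta1] mA.
have nA : nnb (\1_A : T -> R) by exact: nnb_indic.
pose S k := [set x | 1 - eta < runmax E \1_A k x].
have mS k : measurable (S k) by apply: measurable_gt_nnb; exact: (runmax_nnb HE).
have SS k : S k `<=` S k.+1.
  by move=> x; rewrite /S /= => h; rewrite lt_max h.
pose D k := S k.+1 `\` S k.
have mD k : measurable (D k) by exact: measurableD.
have nD k : nnb (\1_(D k) : T -> R) by exact: nnb_indic.
have eS k l x y : (k <= l.+1)%N -> e l x y -> S k x = S k y.
  by move=> kl xy; rewrite /S /= (runmax_invar HE kl nA xy).
have iD k : invar (e k) (\1_(D k) : T -> R).
  move=> x y xy; rewrite !indicE; congr ((nat_of_bool _)%:R).
  by apply/idP/idP; rewrite !inE /D /= !(eS _ k x y).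
have nE k := chain_nnb HE k nA.
have nDE k : nnb (fun x => \1_(D k) x * E k \1_A x * 1).
  by apply: nnbM (nnb_cst ler01); exact: nnbM.
have nDA k : nnb (fun x => \1_(D k) x * \1_A x : R) by exact: nnbM.
have nsum F : (forall k, nnb (F k)) -> nnb (fun x : T => \sum_(k < m) F k x : R).
  by move=> nF; apply: nnb_sum => k; exact: nF.
have sumD (f : T -> R) x : 0 <= f x -> \sum_(k < m) \1_(D k) x * f x = \1_(S m) x * f x.
  move=> f0; rewrite -mulr_suml; congr (_ * _).
  elim: (m) => [|k IH].
    rewrite big_ord0 indicE memNset// /S /= ltNge subr_ge0 => /negP; apply.
    exact: ltW.
  rewrite big_ord_recr /= IH.
  have [h|h] := pselect (S k x).
    rewrite !indicE (mem_set h) (mem_set (SS _ _ h)) memNset ?addr0//.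
    by case.
  rewrite !indicE (memNset h) add0r /D; have [h'|h'] := pselect (S k.+1 x).
    by rewrite !mem_set.
  by rewrite !memNset// => -[].
have nAS : nnb (\1_(A `\` S m) : T -> R) by apply/nnb_indic/measurableD.
have mAS : measurable (A `|` S m) by exact: measurableU.
have eta' : 0 <= 1 - eta by rewrite subr_ge0 ltW.
apply: (@le_trans _ _ (\int[P]_x (\1_(A `\` S m) x +
    \sum_(k < m) \1_(D k) x * E k \1_A x * 1)%:E)%E).
  rewrite -[P _]/(P (A `|` S m)) -[in X in (_ * X)%E](setIT (A `|` S m)) -integral_indic//.
  rewrite -ge0_integralZl//; last first.
    by apply/measurable_EFinP; exact: measurable_indic.
  apply: ge0_le_integral => //.
  - by move=> x _; rewrite -EFinM lee_fin mulr_ge0// indicE.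
  - apply: measurable_funeM; apply/measurable_EFinP; exact: measurable_indic.
  - apply: nnb_EFin; apply: nnbD => //; exact: nsum.
  move=> x _; rewrite -EFinM lee_fin.
  have sum0 : 0 <= \sum_(k < m) \1_(D k) x * E k \1_A x * 1.
    exact: (nnb_ge0 x (nsum _ nDE)).
  have [Sx|nSx] := pselect (S m x).
    rewrite indicE mem_set; last by right.
    rewrite indicE memNset; last by case.
    rewrite mulr1 add0r.
    have -> : 1 - eta = \sum_(k < m) \1_(D k) x * (1 - eta).
      by rewrite (sumD (fun=> 1 - eta)) // indicE mem_set ?mul1r.
    apply: ler_sum => k _; rewrite mulr1 indicE.
    case: (boolP (x \in D k)) => [|_]; last by rewrite !mul0r.
    rewrite !mul1r inE => -[/= + /negP]; rewrite /S /= -leNgt => + h.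
    by rewrite lt_max ltNge h /=; exact: ltW.
  have [Ax|nAx] := pselect (A x); last first.
    by rewrite indicE memNset ?mulr0 ?addr_ge0 ?indicE//; case.
  rewrite indicE mem_set ?mulr1; last by left.
  rewrite indicE mem_set; last by split.
  by rewrite -[leLHS]addr0 lerD// lerBlDr lerDl ltW.
under eq_integral do rewrite EFinD -sumEFin.
rewrite ge0_integralD//; last 3 first.
- exact: nnb_EFin.
- by move=> x _; apply: sume_ge0 => k _; rewrite lee_fin (nnb_ge0 x (nDE k)).
- by apply: emeasurable_sum => k; exact: nnb_EFin.
rewrite ge0_integral_sum//; last 2 first.
- by move=> k; exact: nnb_EFin.
- by move=> k x _; rewrite lee_fin (nnb_ge0 x (nDE k)).
rewrite (eq_bigr (fun k : 'I_m => \int[P]_x (\1_(D k) x * \1_A x)%:E)%E); last first.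
  move=> k _; rewrite (chain_adj HE)//; last exact: nnb_cst.
  apply: eq_integral => x _; rewrite (chain_id HE) ?mulr1//.
  exact: nnb_cst.
rewrite -ge0_integral_sum//; last first.
  by move=> k; exact: nnb_EFin.
have -> : (\int[P]_x (\1_(A `\` S m) x)%:E = P (A `\` S m))%E.
  by rewrite integral_indic ?setIT//; exact: measurableD.
rewrite (_ : \int[P]_x _ = P (S m `&` A))%E; last first.
  rewrite -[in RHS](setIT (_ `&` _)) -integral_indic//; last exact: measurableI.
  apply: eq_integral => x _; rewrite sumEFin sumD ?indicE//.
  by rewrite in_setI -natrM mulnb.
rewrite -measureU//; last 3 first.
- exact: measurableD.
- exact: measurableI.
- by apply/seteqP; split => // x [[_ h] [h' _]].
rewrite (_ : _ `|` _ = A)//; apply/seteqP; split => [x [[]|[]]//|x Ax].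
by have [h|h] := pselect (S m x); [right|left].
Qed.

End WeakDoob.

Section Saturation.
Context {R : realType} {d : nat}.
Implicit Types (A : set (Rn R d)) (eta : R).

(** Only the dyadic grid is used here, dyadic rectangles being the target. *)
Definition saturate eta (i : 'I_d) A : set (Rn R d) :=
  A `|` \bigcup_(k in [set: int]) [set x | 1 - eta < avg i false k \1_A x].

Lemma measurable_saturate eta i A : measurable A -> measurable (saturate eta i A).
Proof.
move=> mA; apply: measurableU => //.
apply: countable_bigcupT_measurable => // k.
by apply: measurable_gt_nnb; apply: avg_nnb; exact: nnb_indic.
Qed.

Lemma measure_saturate eta i A : 0 < eta < 1 -> measurable A ->
  (leb d (saturate eta i A) <= (1 - eta)^-1%:E * leb d A)%E.
Proof.
move=> /[dup] heta /andP[eta0 eta1] mA.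
have nA : nnb (\1_A : Rn R d -> R) by exact: nnb_indic.
pose F n := A `|` [set x | 1 - eta < gridmax n i false \1_A x].
have mF n : measurable (F n).
  apply: measurableU => //; apply: measurable_gt_nnb.
  exact: (runmax_nnb (avg_chain _ _ _) _ nA).
have UF : \bigcup_n F n = saturate eta i A.
  apply/seteqP; split => x.
    move=> [n _ [|/=]]; first by left.
    rewrite /gridmax; elim: (2 * n).+1 => [|m IH] /=.
      by rewrite subr_lt0 ltNge ltW.
    by rewrite lt_max => /orP[/IH //|h]; right; exists (scale n m).
  move=> [Ax|[k _ /= h]]; first by exists 0%N => //; left.
  exists `|k|%N => //; right; apply: lt_le_trans h _.
  by apply: avg_le_gridmax; lia.
have ndF : nondecreasing_seq F.
  move=> n m nm; apply/subsetPset => x [Ax|/= h]; [by left|right => /=].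
  by apply: lt_le_trans h _; exact: gridmax_scale.
have mU : measurable (\bigcup_n F n) by rewrite UF; exact: measurable_saturate.
have cF := nondecreasing_cvg_mu (mu := leb d) mF mU ndF.
rewrite -UF -(cvg_lim _ cF)//; apply: lime_le; first by apply/cvg_ex; eexists; exact: cF.
near=> n; rewrite /=.
have := measure_saturation (avg_chain i false n) (2 * n).+1 heta mA.
rewrite -/(gridmax n i false _) -/(F n) => h.
have e1 : 0 < 1 - eta by rewrite subr_gt0.
rewrite -(lee_pmul2l _ (x := (1 - eta)%:E))// muleA -EFinM mulfV ?gt_eqF// mul1e.
exact: h.
Unshelve. all: by end_near.
Qed.

Definition saturates eta (L : seq 'I_d) A := foldr (saturate eta) A L.

Lemma measurable_saturates eta L A : measurable A -> measurable (saturates eta L A).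
Proof. by move=> mA; elim: L => //= i L; exact: measurable_saturate. Qed.

Lemma measure_saturates eta L A : 0 < eta < 1 -> measurable A ->
  (leb d (saturates eta L A) <= ((1 - eta)^-1 ^+ size L)%:E * leb d A)%E.
Proof.
move=> he mA; elim: L => [|i L IH]; first by rewrite expr0 mul1e.
apply: le_trans (measure_saturate i he (measurable_saturates _ _ mA)) _.
rewrite [size _]/= exprS EFinM -[X in (_ <= X)%E]muleA; apply: lee_wpmul2l => //.
by move: he => /andP[? ?]; rewrite lee_fin invr_ge0; lra.
Qed.

(** An average of 1_A is at most 1, and at most 1 - eta off the saturation of
    A, hence it is at most (1 - eta) + eta 1_(saturate A).  Iterating this convex
    combination yields the power of eta, so an iterated average above
    1 - eta ^ size L forces its point into the iterated saturation. *)
Lemma boxavg_saturates eta sc L A x : 0 < eta < 1 -> measurable A ->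
  boxavg (fun=> false) sc L \1_A x <=
  1 - eta ^+ size L + eta ^+ size L * \1_(saturates eta L A) x.
Proof.
move=> /[dup] he /andP[e0 e1] mA; elim: L x => [|i L IH] x /=.
  by rewrite expr0 subrr add0r mul1r.
set e' := eta ^+ size L; set B := saturates eta L A.
have mB : measurable B by exact: measurable_saturates.
have nA : nnb (\1_A : Rn R d -> R) by exact: nnb_indic.
have nB : nnb (\1_B : Rn R d -> R) by exact: nnb_indic.
have e'0 : 0 <= e' by rewrite exprn_ge0 ?ltW.
have e'1 : 0 <= 1 - e' by rewrite subr_ge0 exprn_ile1 ?ltW.
have nc (c : R) : 0 <= c -> nnb (fun _ : Rn R d => c) by exact: nnb_cst.
apply: (@le_trans _ _ (avg i false (sc i) (fun y => (1 - e') + e' * \1_B y) x)).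
  by apply: avg_le => //; [exact: boxavg_nnb|exact: nnbD (nc _ e'1) (nnbM (nc _ e'0) nB)].
rewrite (avgD _ _ _ x (nc _ e'1) (nnbM (nc _ e'0) nB)) avgZ//.
rewrite (avg_id x (nc _ e'1))//.
have h : avg i false (sc i) \1_B x <= 1 - eta + eta * \1_(saturate eta i B) x.
  rewrite indicE; case: (boolP (_ \in _)) => [_|/negP h].
    by rewrite mulr1 subrK; exact: avg_bound.
  rewrite mulr0 addr0 leNgt; apply/negP => h'; apply: h; rewrite inE.
  by right; exists (sc i).
rewrite exprS -/e' -/B.
by have := ler_wpM2l e'0 h; lra.
Qed.

End Saturation.

(** * Dyadic intervals and rectangles *)

Section DyadicIntervals.
Context {R : realType}.
Local Notation mu := (@lebesgue_measure R).
Local Notation dint := (@Defs.dint R).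
Implicit Types (I J : dyadic) (x y theta : R).

Definition dleft I : R := I.1%:~R * 2 ^ I.2.

Lemma dintP I x : dint I x <-> dleft I <= x < dleft I + 2 ^ I.2.
Proof. by rewrite /dint /dlength /= in_itv /= intrD mulrDl mul1r. Qed.

Lemma dint_gidx I x : dint I x <-> gidx false I.2 x = I.1.
Proof.
rewrite dintP; split => [h|/eqP]; first apply/eqP.
all: by move: h || idtac; rewrite gidxE /gshift !addr0 intrD mulrDl mul1r.
Qed.

Definition dcell (k : int) x : dyadic := (gidx false k x, k).

Lemma dcell_self k x : dint (dcell k x) x.
Proof. exact/dint_gidx. Qed.

Lemma dleft_in I : dint I (dleft I).
Proof. by apply/dintP; rewrite lexx ltrDl exp2_gt0. Qed.

Lemma dcell_eq I x : dint I x -> I = dcell I.2 x.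
Proof. by move=> /dint_gidx h; rewrite /dcell h; case: I {h}. Qed.

Lemma dint_nested I J x : dint I x -> dint J x -> I.2 <= J.2 ->
  dint I `<=` dint J.
Proof.
move=> /dint_gidx Ix /dint_gidx Jx IJ y /dint_gidx Iy; apply/dint_gidx.
by rewrite -Jx; apply: (gidx_le IJ); rewrite Iy.
Qed.

Lemma measurable_dint I : measurable (dint I : set (measurableTypeR R)).
Proof. exact: measurable_itv. Qed.

Lemma lebesgue_dint I : mu (dint I) = (2 ^ I.2)%:E.
Proof.
rewrite -(lebesgue_gidx false I.2 (dleft I)); congr (mu _).
have /dint_gidx -> := dleft_in I.
by apply/seteqP; split => x /dint_gidx.
Qed.

Lemma dint_sub_ends I J : dint I `<=` dint J ->
  dleft J <= dleft I /\ dleft I + 2 ^ I.2 <= dleft J + 2 ^ J.2.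
Proof.
move=> IJ; have /IJ/dintP/andP[h1 h2] := dleft_in I; split => //.
rewrite leNgt; apply/negP => h.
have /IJ/dintP : dint I (dleft J + 2 ^ J.2) by apply/dintP; rewrite h ltW.
by rewrite ltxx andbF.
Qed.

Lemma dint_sub_scale I J : dint I `<=` dint J -> I.2 <= J.2.
Proof.
move=> /dint_sub_ends[h1 h2]; rewrite leNgt; apply/negP => h.
have : 2 ^ J.2 < 2 ^ I.2 :> R by rewrite ltr_eXz2l// ltr1n.
lra.
Qed.

Lemma dilateE (m : R) I : dilate m I =
  `[dleft I - (m - 1) * 2 ^ I.2 / 2, dleft I + 2 ^ I.2 + (m - 1) * 2 ^ I.2 / 2[%classic.
Proof.
rewrite /dilate.
have -> : dcenter I - m * dlength I / 2 = dleft I - (m - 1) * 2 ^ I.2 / 2.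
  by rewrite /dcenter /dlength /dleft; lra.
have -> : dcenter I + m * dlength I / 2 = dleft I + 2 ^ I.2 + (m - 1) * 2 ^ I.2 / 2.
  by rewrite /dcenter /dlength /dleft; lra.
by [].
Qed.

Lemma dilate_sub theta I J : 0 <= theta -> dint I `<=` dint J ->
  dilate (1 + theta) I `<=` dilate (1 + theta) J.
Proof.
move=> t0 IJ; rewrite !dilateE addrAC subrr add0r.
have [h1 h2] := dint_sub_ends IJ.
have h3 : theta * 2 ^ I.2 <= theta * 2 ^ J.2 :> R by rewrite ler_wpM2l//; lra.
by apply: subset_itv; rewrite bnd_simp; lra.
Qed.

(** The ends of m I stick out of I by less than m |I| / 2, and those of
    (1 + theta) J out of J by theta |J| / 2. *)
Lemma dilate_sub_of_scale (m theta : R) I J : 0 <= theta -> 1 <= m ->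
  dint I `<=` dint J -> m * 2 ^ I.2 <= theta * 2 ^ J.2 ->
  dilate m I `<=` dilate (1 + theta) J.
Proof.
move=> t0 m1 IJ h; rewrite !dilateE [1 + _ - 1]addrAC subrr add0r.
have [h1 h2] := dint_sub_ends IJ.
have h3 : 0 < 2 ^ I.2 :> R by exact: exp2_gt0.
by apply: subset_itv; rewrite bnd_simp; lra.
Qed.

Lemma measurable_dilate m I : measurable (dilate m I : set (measurableTypeR R)).
Proof. exact: measurable_itv. Qed.

Lemma lebesgue_dilate theta I : 0 <= theta ->
  mu (dilate (1 + theta) I) = ((1 + theta) * 2 ^ I.2)%:E.
Proof.
move=> t0; rewrite dilateE lebesgue_measure_itv /= lte_fin.
have h3 : 0 < 2 ^ I.2 :> R by exact: exp2_gt0.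
have h4 : 0 <= theta * 2 ^ I.2 :> R by rewrite mulr_ge0// ltW.
rewrite ifT; last by lra.
by rewrite -EFinD; congr EFin; lra.
Qed.

Lemma measurable_bigcup_count (U : countType) (D : set U) dT (T : measurableType dT)
    (F : U -> set T) :
  (forall i, D i -> measurable (F i)) -> measurable (\bigcup_(i in D) F i).
Proof.
move=> mF; rewrite bigcup_mkcond; apply: countable_bigcupT_measurable => // i.
by case: ifPn => // /set_mem; exact: mF.
Qed.

(** Dilation preserves inclusions of dyadic intervals ([dilate_sub]), so only the
    maximal intervals of J count, and these are disjoint. *)
Lemma lebesgue_dilate_union (J : set dyadic) theta : 0 <= theta ->
  (mu (\bigcup_(I in J) dilate (1 + theta) I) <=
   (1 + theta)%:E * mu (\bigcup_(I in J) dint I))%E.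
Proof.
move=> t0; set W := \bigcup_(I in J) dint I.
have mW : measurable (W : set (measurableTypeR R)).
  by apply: measurable_bigcup_count => I _; exact: measurable_dint.
have t1 : 0 < 1 + theta by lra.
have [Woo|Wfin] := eqVneq (mu W) +oo%E.
  by rewrite Woo gt0_muley ?leey// lte_fin.
(* a bound on the scales, so that every interval lies in a maximal one *)
have [K hK] : exists K : nat, forall I, J I -> I.2 <= K%:Z.
  have muW : mu W \is a fin_num by rewrite ge0_fin_numE// ltey.
  exists (Num.truncn (fine (mu W))) => I JI; rewrite leNgt; apply/negP => KI.
  have : ((2 ^ I.2)%:E <= mu W)%E.
    rewrite -lebesgue_dint; apply: le_measure; rewrite ?inE//.
      exact: measurable_dint.
    by move=> x Ix; exists I.
  rewrite -(fineK muW) lee_fin leNgt => /negP; apply.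
  apply: lt_le_trans (truncnS_gt _) _; set k := Num.truncn _ in KI *.
  have -> : I.2 = (`|I.2|%N)%:Z by lia.
  rewrite -exprnP -natrX ler_nat; apply: leq_trans (ltnW (ltn_expl _ _)) => //; lia.
pose Jmax := [set I | J I /\ forall I', J I' -> dint I `<=` (dint I' : set R) -> I' = I].
have step I : J I -> ~ Jmax I ->
    exists I', [/\ J I', dint I `<=` dint I' & I.2 < I'.2].
  move=> JI nmI; apply: contrapT => no; apply: nmI; split => // I' JI' II'.
  have [e2|ne2] := eqVneq I.2 I'.2.
    by rewrite (dcell_eq (dleft_in I)) e2 -dcell_eq//; apply: II'; exact: dleft_in.
  exfalso; apply: no; exists I'; split => //.
  by rewrite lt_neqAle ne2 (dint_sub_scale II').
have maxP I : J I -> exists2 I', Jmax I' & dint I `<=` dint I'.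
  move=> JI; have [n hn] : exists n : nat, K%:Z - I.2 <= n%:Z.
    by exists `|K%:Z - I.2|%N; lia.
  elim: n I JI hn => [|n IH] I JI hn.
    exists I => //; apply: contrapT => /(step _ JI)[I' [JI' _ lt2]].
    by have := hK _ JI'; lia.
  have [mI|/(step _ JI)[I' [JI' II' lt2]]] := pselect (Jmax I); first by exists I.
  have [|I2 mI2 sub2] := IH _ JI'; first by lia.
  by exists I2 => //; exact: subset_trans sub2.
pose pinv : nat -> option dyadic := @pickle_inv _.
pose F (D : dyadic -> set R) n := if pinv n is Some Q then
  if Q \in Jmax then D Q else set0 else set0.
have mF D : (forall I, measurable (D I : set (measurableTypeR R))) ->
    forall n, measurable (F D n : set (measurableTypeR R)).
  by move=> mD n; rewrite /F; case: (pinv _) => // I; case: ifP.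
have tF : trivIset setT (F dint).
  apply/trivIsetP => n m _ _; rewrite /F => nm; apply/seteqP; split => // x [].
  case en: (pinv n) => [I|//]; case em: (pinv m) => [I'|//].
  case: ifPn => // /set_mem mI Ix; case: ifPn => // /set_mem mI' I'x.
  have e : I = I'.
    have [h|h] := leP I.2 I'.2.
      by apply/esym/(proj2 mI); [exact: (proj1 mI')|exact: (dint_nested Ix I'x h)].
    by apply: (proj2 mI'); [exact: (proj1 mI)|exact: (dint_nested I'x Ix (ltW h))].
  move/eqP: nm; apply.
  have := @pickle_invK _ n : oapp _ _ (pinv n) = n; have := @pickle_invK _ m : oapp _ _ (pinv m) = m.
  by rewrite en em /= e => -> ->.
have UF D : \bigcup_n F D n = \bigcup_(I in Jmax) D I.
  apply/seteqP; split => x.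
    move=> [n _]; rewrite /F; case: (pinv _) => // I.
    by case: ifPn => // /set_mem mI Dx; exists I.
  move=> [I mI Dx]; exists (pickle I); first exact: Logic.I.
  by rewrite /F /pinv pickleK_inv mem_set.
have mFd := mF _ measurable_dint.
have mFD := mF _ (measurable_dilate (1 + theta)).
have mU : measurable (\bigcup_(I in J) dilate (1 + theta) I : set (measurableTypeR R)).
  by apply: measurable_bigcup_count => I _; exact: measurable_dilate.
apply: (@le_trans _ _ (\sum_(n <oo) mu (F (dilate (1 + theta)) n))%E).
  apply: (@measure_sigma_subadditive _ _ _ mu _ _ mFD mU).
  rewrite UF => x [I JI Ix]; have [I' mI' II'] := maxP _ JI.
  by exists I' => //; exact: dilate_sub Ix.
apply: (@le_trans _ _ ((1 + theta)%:E * \sum_(n <oo) mu (F dint n))%E).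
  rewrite -nneseriesZl//; apply: lee_nneseries => // n _.
  rewrite /F; case: (pinv _) => [I|]; last by rewrite !measure0 mule0.
  case: ifP => _; last by rewrite !measure0 mule0.
  by rewrite lebesgue_dilate// lebesgue_dint EFinM.
apply: lee_wpmul2l; first by rewrite lee_fin ltW.
rewrite -measure_semi_bigcup//; last by rewrite UF; apply: measurable_bigcup_count => I _; exact: measurable_dint.
apply: le_measure; rewrite ?inE//.
  by rewrite UF; apply: measurable_bigcup_count => I _; exact: measurable_dint.
by rewrite UF => x [I [JI _] Ix]; exists I.
Qed.

End DyadicIntervals.

(** * The enlarged set *)

Section Enlargement.
Context {R : realType}.
Local Notation mu := (@lebesgue_measure R).
Local Notation dint := (@Defs.dint R).

Lemma measurable_rect d (S : drect d) : measurable (rect S : set (Rn R d)).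
Proof. by apply: measurable_box => i; exact: measurable_dint. Qed.

Lemma leb_rect d (S : drect d) :
  leb d (rect S : set (Rn R d)) = (\prod_(i < d) 2 ^ (tnth S i).2)%:E.
Proof.
rewrite /rect leb_box; last by move=> i; exact: measurable_dint.
by rewrite -prodEFin; apply: eq_bigr => i _; rewrite lebesgue_dint.
Qed.

Lemma leb_rect_gt0 d (S : drect d) : (0 < leb d (rect S : set (Rn R d)))%E.
Proof. by rewrite leb_rect lte_fin prodr_gt0// => i _; exact: exp2_gt0. Qed.

Lemma measurable_shadow d (U : set (drect d)) : measurable (shadow U : set (Rn R d)).
Proof. by apply: measurable_bigcup_count => S _; exact: measurable_rect. Qed.

Lemma rect_dint d (S : drect d) (x : Rn R d) i : rect S x -> dint (tnth S i) (tnth x i).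
Proof. exact. Qed.

Lemma rect_cons d I (S : drect d) (t : R) (x : Rn R d) :
  rect [tuple of I :: S] (cons_Rn (t, x)) <-> dint I t /\ rect S x.
Proof.
split=> [h|[h1 h2] i].
  split=> [|i]; first by have := h ord0; rewrite !tnth0.
  by have := h (lift ord0 i); rewrite !tnthS.
by have [j ->|->] := unliftP ord0 i; rewrite ?tnthS ?tnth0//; exact: h2.
Qed.

Lemma rect_dilate1_cons d m I (S : drect d) (t : R) (x : Rn R d) :
  rect_dilate1 m [tuple of I :: S] (cons_Rn (t, x)) <-> dilate m I t /\ rect S x.
Proof.
split=> [h|[h1 h2] i].
  split=> [|i]; first by have := h ord0; rewrite !tnth0.
  by have := h (lift ord0 i); rewrite !tnthS.
by have [j ->|->] := unliftP ord0 i; rewrite ?tnthS ?tnth0//; exact: h2.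
Qed.

Lemma measurable_rect_dilate1 d m (S : drect d) :
  measurable (rect_dilate1 m S : set (Rn R d)).
Proof.
apply: measurable_box => i; case: ifP => _; first exact: measurable_dilate.
exact: measurable_dint.
Qed.

Lemma leb_cons d (A : set (Rn R d.+1)) : measurable A ->
  (leb d.+1 A = \int[leb d]_x mu [set t | A (cons_Rn (t, x))])%E.
Proof.
move=> mA.
have mAx x : measurable ([set t | A (cons_Rn (t, x))] : set (measurableTypeR R)).
  have mc : measurable_fun [set: measurableTypeR R] (fun t => cons_Rn (t, x) : Rn R d.+1).
    exact: measurable_cons_fun.
  by have := mc measurableT _ mA; rewrite setTI.
rewrite -[in LHS](setIT A) -integral_indic//.
rewrite integral_leb_cons; last 2 first.
- by apply/measurable_EFinP; exact: measurable_indic.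
- by move=> x; rewrite lee_fin indicE.
apply: eq_integral => x _.
by rewrite -[in RHS](setIT [set t | _]) -integral_indic.
Qed.

Lemma measurable_mu_slice d (A : set (Rn R d.+1)) : measurable A ->
  measurable_fun [set: Rn R d] (fun x => mu [set t | A (cons_Rn (t, x))]).
Proof.
move=> mA.
have mAx x : measurable ([set t | A (cons_Rn (t, x))] : set (measurableTypeR R)).
  have mc : measurable_fun [set: measurableTypeR R] (fun t => cons_Rn (t, x) : Rn R d.+1).
    exact: measurable_cons_fun.
  by have := mc measurableT _ mA; rewrite setTI.
have -> : (fun x => mu [set t | A (cons_Rn (t, x))]) =
    (fun x => \int[mu]_t (\1_A (cons_Rn (t, x)))%:E)%E.
  apply/funext => x.
  by rewrite -[in LHS](setIT [set t | _]) -integral_indic.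
apply: (@measurable_integral R _ _ _ _ mu (fun x t => (\1_A (cons_Rn (t, x)))%:E)).
  apply/measurable_EFinP; apply: (measurableT_comp (measurable_indic _)) => //.
  exact: measurable_cons_fun.
by move=> x t; rewrite lee_fin indicE.
Qed.

(** These are the rectangles that V has to contain, with room to spare in the
    first coordinate, so that a rectangle of small embeddedness has no crowded
    stretching along it; see [emb_ge_of_crowded]. *)
Definition crowded d (c : R) (U : set (drect d)) : set (drect d) :=
  [set S | ((1 - c)%:E * leb d (rect S : set (Rn R d)) <
            leb d (rect S `&` shadow U : set (Rn R d)))%E].

Lemma crowded_sub d (c : R) (U : set (drect d)) : 0 < c -> U `<=` crowded c U.
Proof.
move=> c0 S US; rewrite /crowded /= setIidl; last by move=> x Sx; exists S.
have := leb_rect_gt0 S; rewrite leb_rect => h.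
by rewrite -EFinM lte_fin gtr_pMl// gtrBl.
Qed.

(** If x is outside the saturation, the average of the indicator of sh(U) over
    any dyadic rectangle through x is at most 1 - eta ^ d, by
    [boxavg_saturates]. *)
Lemma shadow_crowded_sub d (eta : R) (U : set (drect d)) : 0 < eta < 1 ->
  (shadow (crowded (eta ^+ d) U) : set (Rn R d)) `<=`
  saturates eta (rev (enum 'I_d)) (shadow U).
Proof.
move=> he x [S /= cS Sx]; apply: contrapT => nx.
have mU := measurable_shadow U.
have mS := measurable_rect S.
have nU : nnb (\1_(shadow U : set (Rn R d)) : Rn R d -> R) by exact: nnb_indic.
move: cS; rewrite /crowded /= ltNge => /negP; apply.
have -> : leb d (rect S `&` shadow U : set (Rn R d)) =
    (\int[leb d]_(y in rect S) (\1_(shadow U) y)%:E)%E.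
  by rewrite integral_indic// setIC.
apply: le_trans (boxavg_ge_int (gr := fun=> false) (sc := fun i => (tnth S i).2)
  (x := x) nU _ _) _.
- by move=> i; exact: measurable_dint.
- by move=> i y /dint_gidx ->; have /dint_gidx -> := rect_dint i Sx.
rewrite leb_rect -EFinM lee_fin mulrC ler_wpM2r//.
  by apply: prodr_ge0 => i _; rewrite ltW// exp2_gt0.
apply: le_trans (boxavg_saturates _ _ _ he mU) _.
by rewrite size_rev size_enum_ord indicE memNset// mulr0 addr0.
Qed.

Definition enlarge d (theta c : R) (U : set (drect d)) : set (Rn R d) :=
  \bigcup_(S in crowded c U) rect_dilate1 (1 + theta) S.

Lemma measurable_enlarge d theta c (U : set (drect d)) : measurable (enlarge theta c U).
Proof. by apply: measurable_bigcup_count => S _; exact: measurable_rect_dilate1. Qed.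

(** Only the first sides are dilated, so the one-dimensional bound applies on
    each line parallel to the first axis. *)
Lemma leb_dilate_shadow d (theta : R) (W : set (drect d.+1)) : 0 <= theta ->
  (leb d.+1 (\bigcup_(S in W) rect_dilate1 (1 + theta) S) <=
   (1 + theta)%:E * leb d.+1 (shadow W : set (Rn R d.+1)))%E.
Proof.
move=> t0.
have mW := measurable_shadow W.
have mD : measurable (\bigcup_(S in W) rect_dilate1 (1 + theta) S : set (Rn R d.+1)).
  by apply: measurable_bigcup_count => S _; exact: measurable_rect_dilate1.
have t1 : (0 <= (1 + theta)%:E :> \bar R)%E by rewrite lee_fin; lra.
rewrite (leb_cons mD) (leb_cons mW) -ge0_integralZl//; last exact: measurable_mu_slice.
apply: ge0_le_integral => //.
- exact: measurable_mu_slice.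
- by apply: measurable_funeM; exact: measurable_mu_slice.
move=> x _.
pose J := [set I : dyadic | exists2 S : drect d, W [tuple of I :: S] & rect S x].
have consP (S : drect d.+1) : exists I (S' : drect d), S = [tuple of I :: S'].
  by exists (thead S), [tuple of behead S]; exact: tuple_eta.
have -> : [set t | (\bigcup_(S in W) rect_dilate1 (1 + theta) S) (cons_Rn (t, x))] =
    \bigcup_(I in J) dilate (1 + theta) I.
  apply/seteqP; split => t /=.
    move=> [S WS]; have [I [S' SE]] := consP S; rewrite SE in WS *.
    by move=> /rect_dilate1_cons[h1 h2]; exists I => //; exists S'.
  by move=> [I [S' WS' h1 h2]]; exists [tuple of I :: S'] => //; apply/rect_dilate1_cons.
have -> : [set t | shadow W (cons_Rn (t, x))] = \bigcup_(I in J) dint I.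
  apply/seteqP; split => t /=.
    move=> [S WS]; have [I [S' SE]] := consP S; rewrite SE in WS *.
    by move=> /rect_cons[h1 h2]; exists I => //; exists S'.
  by move=> [I [S' WS' h1 h2]]; exists [tuple of I :: S'] => //; apply/rect_cons.
exact: lebesgue_dilate_union.
Qed.

Lemma leb_enlarge d (theta eta : R) (U : set (drect d.+1)) :
  0 <= theta -> 0 < eta < 1 ->
  (leb d.+1 (enlarge theta (eta ^+ d.+1) U) <=
   ((1 + theta) * (1 - eta)^-1 ^+ d.+1)%:E * leb d.+1 (shadow U : set (Rn R d.+1)))%E.
Proof.
move=> t0 he; apply: le_trans (leb_dilate_shadow _ t0) _.
rewrite (EFinM (1 + theta)) -[X in (_ <= X)%E]muleA; apply: lee_wpmul2l.
  by rewrite lee_fin; lra.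
have mU := measurable_shadow U.
have := measure_saturates (rev (enum 'I_d.+1)) he mU.
rewrite size_rev size_enum_ord; apply: le_trans.
apply: le_measure; rewrite ?inE//.
- exact: measurable_shadow.
- exact: measurable_saturates.
- exact: shadow_crowded_sub.
Qed.

Lemma shadow_sub_enlarge d (theta c : R) (U : set (drect d)) : 0 <= theta -> 0 < c ->
  shadow U `<=` enlarge theta c U.
Proof.
move=> t0 c0 x [S US Sx]; exists S; first exact: crowded_sub.
move=> i; have := Sx i; case: ifP => // _.
rewrite -(@dilate1 R) -[X in dilate X _ _ -> _]addr0.
by apply: subset_itv; rewrite bnd_simp; have := dlength_gt0 R (tnth S i); nra.
Qed.

End Enlargement.

(** * Rectangles of comparable embeddedness *)

Section Embeddedness.
Context {R : realType} {d : nat}.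
Local Notation mu := (@lebesgue_measure R).
Local Notation dint := (@Defs.dint R).

Definition prodset (B : set R) (C : set (Rn R d)) : set (Rn R d.+1) :=
  [set z | B (tnth z ord0) /\ C [tuple tnth z (lift ord0 i) | i < d]].

Lemma prodset_cons B C t x : prodset B C (cons_Rn (t, x)) <-> B t /\ C x.
Proof.
rewrite /prodset /= tnth0; split => -[Bt Cx]; split => //; move: Cx;
  congr C; apply: eq_from_tnth => i; by rewrite tnth_mktuple tnthS.
Qed.

Lemma measurable_prodset B C : measurable (B : set (measurableTypeR R)) ->
  measurable C -> measurable (prodset B C).
Proof.
move=> mB mC; apply: measurableI.
  rewrite -[X in measurable X]setTI.
  exact: (measurable_tnth (ord0 : 'I_d.+1) measurableT mB).
have mt : measurable_fun [set: Rn R d.+1]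
    (fun z => [tuple tnth z (lift ord0 i) | i < d] : Rn R d).
  apply/measurable_fun_tnthP => i.
  rewrite (_ : _ \o _ = fun z => tnth z (lift ord0 i)); last first.
    by apply/funext => z /=; rewrite tnth_mktuple.
  exact: measurable_tnth.
by rewrite -[X in measurable X]setTI; exact: mt.
Qed.

Lemma leb_prodset B C : measurable (B : set (measurableTypeR R)) ->
  measurable C -> leb d.+1 (prodset B C) = (mu B * leb d C)%E.
Proof.
move=> mB mC; rewrite -product_measure2E//= /pushforward; congr (_ _).
by apply/seteqP; split => -[t x] /= h; [exact/prodset_cons|exact/(prodset_cons B C)].
Qed.

Lemma rect_prodset I (S : drect d) :
  rect [tuple of I :: S] = prodset (dint I) (rect S).
Proof.
apply/seteqP; split => z; have [t [x ->]] := cons_Rn_surj z.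
  by move=> /rect_cons h; apply/prodset_cons.
by move=> /prodset_cons h; apply/rect_cons.
Qed.

Variables (a : nat) (c : R) (U U' : set (drect d.+1)) (n : nat).
Hypothesis U'U : U' `<=` U.
Let V := enlarge (2 ^- a) c U.

(** The truncation makes finitely many scales and finitely many rectangles
    enough, so that every maximal function is a maximum of bounded averages. *)
Definition truncated (m : nat) (W : set (drect d.+1)) : set (drect d.+1) :=
  [set S | W S /\ forall i, `|(tnth S i).1| <= m%:Z /\ `|(tnth S i).2| <= m%:Z].

Let F j I : set (Rn R d.+1) := Fset V I j (truncated n U').

Definition larger (N : nat) (I : dyadic) : set dyadic :=
  [set J : dyadic | exists m : nat, J.2 = I.2 + (m.+1 * N)%:Z].

(** Removing only the intervals longer by a power of 2 ^ (j + a) makes each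
    removed one contain the ancestor of I to which [emb_ge_of_crowded] applies,
    at the price of j + a residue classes in [sum_fresh]. *)
Definition fresh j I : set (Rn R d.+1) :=
  F j I `\` \bigcup_(J in larger (j + a) I) F j J.

Lemma measurable_Fset (V' : set (Rn R d.+1)) I j (W : set (drect d.+1)) :
  measurable (Fset V' I j W).
Proof. by apply: measurable_bigcup_count => S _; exact: measurable_rect. Qed.

Lemma measurable_fresh j I : measurable (fresh j I).
Proof.
apply: measurableD; first exact: measurable_Fset.
by apply: measurable_bigcup_count => J _; exact: measurable_Fset.
Qed.

Lemma ohead_cons (S : drect d.+1) I : ohead S = Some I ->
  exists S' : drect d, S = [tuple of I :: S'].
Proof.
move=> h; exists [tuple of behead S].
rewrite {1}(tuple_eta S); apply: val_inj => /=; congr cons.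
by move: h; rewrite [in ohead _](tuple_eta S) /= => -[].
Qed.

Lemma Fset_dint (V' : set (Rn R d.+1)) I j (W : set (drect d.+1)) x :
  Fset V' I j W x -> dint I (tnth x ord0).
Proof.
move=> [S [_ [/ohead_cons[S' ->] _]]].
have [t [y ->]] := cons_Rn_surj x.
by move=> /rect_cons[+ _]; rewrite tnth0.
Qed.

(** An end of 2 ^ j I is within 2 ^ j |I| / 2 of I, which is 2 ^ -a |J| / 2, the
    margin that the dilation of J provides. *)
Lemma emb_ge_of_crowded j I J (S : drect d) : crowded c U [tuple of J :: S] ->
  dint I `<=` dint J -> J.2 = I.2 + (j + a)%:Z ->
  ((2 ^+ j)%:E <= emb [tuple of I :: S] V)%E.
Proof.
move=> cJ IJ eJ; apply: ereal_sup_ubound; exists (2 ^+ j) => //=; split.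
  by rewrite exprn_ege1// ler1n.
move=> z; have [t [x ->]] := cons_Rn_surj z.
move=> /rect_dilate1_cons[h1 h2]; exists [tuple of J :: S] => //.
apply/rect_dilate1_cons; split => //; move: h1.
apply: dilate_sub_of_scale => //; first by rewrite exprn_ege1// ler1n.
rewrite eJ expfzDr// -exprnP exprD.
have -> : 2 ^- a * (2 ^ I.2 * (2 ^+ j * 2 ^+ a)) = 2 ^+ j * 2 ^ I.2 * (2 ^- a * 2 ^+ a) :> R by ring.
by rewrite mulVf ?mulr1// expf_neq0.
Qed.

(** Suppose that the longer intervals cover more than 1 - c of R = I x S'.
    They all contain J0, the ancestor of I at distance j + a, so what they
    cover of R is I x (S' `&` P) for a set P that does not depend on the first
    coordinate, and J0 x (S' `&` P) lies in sh(U).  Then J0 x S' is crowded and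
    emb(R, V) >= 2 ^ j, a contradiction. *)
Lemma fresh_large j I (S : drect d.+1) : truncated n U' S -> ohead S = Some I ->
  ((2 ^+ j.-1)%:E <= emb S V < (2 ^+ j)%:E)%E ->
  (c%:E * leb d.+1 (rect S : set (Rn R d.+1)) <= leb d.+1 (rect S `&` fresh j I))%E.
Proof.
move=> tS hS eS; have [S' SE] := ohead_cons hS.
have mS : measurable (rect S : set (Rn R d.+1)) by exact: measurable_rect.
have mS' : measurable (rect S' : set (Rn R d)) by exact: measurable_rect.
pose W := \bigcup_(J in larger (j + a) I) F j J.
have mW : measurable W by apply: measurable_bigcup_count => J _; exact: measurable_Fset.
have mH := measurable_fresh j I.
have SF : rect S `<=` F j I by move=> x Sx; exists S.
have finS A : measurable A -> leb d.+1 (rect S `&` A : set (Rn R d.+1)) \is a fin_num.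
  move=> mA; rewrite ge0_fin_numE//.
  apply: (@le_lt_trans _ _ (leb d.+1 (rect S : set (Rn R d.+1)))).
    by apply: le_measure; rewrite ?inE//; exact: measurableI.
  by rewrite leb_rect ltry.
have split : (leb d.+1 (rect S : set (Rn R d.+1)) =
    leb d.+1 (rect S `&` fresh j I) + leb d.+1 (rect S `&` W))%E.
  rewrite -measureU; [|exact: measurableI|exact: measurableI|].
    congr (_ _); apply/seteqP; split => x; last by move=> [][].
    move=> Sx; have [Wx|nWx] := pselect (W x); first by right.
    by left; split => //; split => //; exact: SF.
  by apply/seteqP; split => // x [[_ [_ h]] [_ h']].
rewrite leNgt; apply/negP => small.
pose J0 := dcell (I.2 + (j + a)%:Z) (dleft I : R).
have IJ0 : dint I `<=` dint J0.
  by apply: (dint_nested (dleft_in I) (dcell_self _ _)) => /=; rewrite lerDl.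
pose P : set (Rn R d) := \bigcup_(T in [set T : drect d.+1 | truncated n U' T /\
   exists2 J, ohead T = Some J & dint J0 `<=` dint J]) rect [tuple of behead T].
have mP : measurable P by apply: measurable_bigcup_count => T _; exact: measurable_rect.
have mSP : measurable (rect S' `&` P) by exact: measurableI.
have WP : rect S `&` W `<=` prodset (dint I) (rect S' `&` P).
  move=> z [Sz [J [m Jm] [T [tT [hT _]] Tz]]]; move: Sz Tz.
  have [T' TE] := ohead_cons hT; rewrite SE TE.
  have [t [x ->]] := cons_Rn_surj z.
  move=> /rect_cons[It S'x] /rect_cons[Jt T'x].
  apply/prodset_cons; split => //; split => //; exists T.
    split => //; exists J => //.
    apply: (dint_nested (IJ0 _ It) Jt) => /=; rewrite Jm lerD2l lez_nat.
    by rewrite leq_pmull.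
  suff -> : [tuple of behead T] = T' by [].
  by apply: val_inj; rewrite TE.
have PU : prodset (dint J0) (rect S' `&` P) `<=`
    rect [tuple of J0 :: S'] `&` shadow U.
  move=> z; have [t [x ->]] := cons_Rn_surj z.
  move=> /prodset_cons[J0t [S'x [T [[UT _] [J hT J0J]] Tx]]].
  split; first by apply/rect_cons.
  exists T; first exact: U'U.
  have [T' TE] := ohead_cons hT; move: Tx; rewrite TE => Tx; apply/rect_cons.
  split; first exact: J0J.
  by move: Tx; congr (rect _ _); exact: val_inj.
have lebP : leb d (rect S' `&` P : set (Rn R d)) \is a fin_num.
  rewrite ge0_fin_numE//.
  apply: (@le_lt_trans _ _ (leb d (rect S' : set (Rn R d)))).
    by apply: le_measure; rewrite ?inE.
  by rewrite leb_rect ltry.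
have le1 : (leb d.+1 (rect S `&` W) <= (2 ^ I.2)%:E * leb d (rect S' `&` P))%E.
  rewrite -lebesgue_dint -leb_prodset//; last exact: measurable_dint.
  apply: le_measure; rewrite ?inE//; first exact: measurableI.
  by apply: measurable_prodset => //; exact: measurable_dint.
have le2 : ((2 ^ J0.2)%:E * leb d (rect S' `&` P) <=
    leb d.+1 (rect [tuple of J0 :: S'] `&` shadow U : set (Rn R d.+1)))%E.
  rewrite -lebesgue_dint -leb_prodset//; last exact: measurable_dint.
  apply: le_measure; rewrite ?inE//.
    by apply: measurable_prodset => //; exact: measurable_dint.
  by apply: measurableI; [exact: measurable_rect|exact: measurable_shadow].
have crowdedJ : crowded c U [tuple of J0 :: S'].
  rewrite /crowded /=; apply: lt_le_trans le2.
  have lebR K : leb d.+1 (rect [tuple of K :: S'] : set (Rn R d.+1)) =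
      ((2 ^ K.2)%:E * leb d (rect S' : set (Rn R d)))%E.
    by rewrite rect_prodset leb_prodset ?lebesgue_dint//; exact: measurable_dint.
  have lt1 : ((1 - c)%:E * leb d.+1 (rect S : set (Rn R d.+1)) <
      leb d.+1 (rect S `&` W))%E.
    move: small split; rewrite -(fineK (finS _ mH)) -(fineK (finS _ mW)) leb_rect.
    move: (\prod_(i < d.+1) _) (fine _) (fine _) => X f w.
    rewrite -!EFinD -!EFinM !lte_fin => h1 [h2]; rewrite h2 in h1 *; lra.
  have {lt1 le1} := lt_le_trans lt1 le1.
  rewrite SE !lebR (_ : J0.2 = I.2 + (j + a)%:Z)// -(fineK lebP) leb_rect.
  rewrite expfzDr// -!EFinM !lte_fin => lt1.
  have p0 : 0 < 2 ^ (j + a)%:Z :> R by exact: exp2_gt0.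
  by have := ltr_pM2l p0 ((1 - c) * (2 ^ I.2 * \prod_(i < d) 2 ^ (tnth S' i).2))
       (2 ^ I.2 * fine (leb d (rect S' `&` P))); rewrite lt1; nra.
have := emb_ge_of_crowded crowdedJ IJ0 erefl.
rewrite -SE leNgt => /negP; apply.
by case/andP: eS.
Qed.

Lemma Fset_le_itermax j I x :
  c * \1_(F j I) x <= itermax n (rev (enum 'I_d.+1)) \1_(fresh j I) x.
Proof.
have nH : nnb (\1_(fresh j I) : Rn R d.+1 -> R) by apply: nnb_indic; exact: measurable_fresh.
rewrite indicE; case: (boolP (x \in _)) => [|_]; last first.
  by rewrite mulr0; apply: nnb_ge0; exact: itermax_nnb.
rewrite inE mulr1 => -[S [tS [hS eS]] Sx].
have large := fresh_large tS hS eS.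
have mS : measurable (rect S : set (Rn R d.+1)) by exact: measurable_rect.
have : (leb d.+1 (rect S `&` fresh j I) <= ((\prod_(i < d.+1) 2 ^ (tnth S i).2) *
    boxavg (fun=> false) (fun i => (tnth S i).2) (rev (enum 'I_d.+1)) \1_(fresh j I) x)%:E)%E.
  have -> : leb d.+1 (rect S `&` fresh j I) =
      (\int[leb d.+1]_(y in rect S) (\1_(fresh j I) y)%:E)%E.
    have mH := measurable_fresh j I.
    by rewrite (integral_indic _ mS mH) setIC.
  apply: (boxavg_ge_int (gr := fun=> false) (sc := fun i => (tnth S i).2) (x := x) nH).
  - by move=> i; exact: measurable_dint.
  - by move=> i y /dint_gidx ->; have /dint_gidx -> := rect_dint i Sx.
move=> /(le_trans large); rewrite leb_rect -EFinM lee_fin mulrC ler_pM2l; last first.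
  by apply: prodr_gt0 => i _; exact: exp2_gt0.
move=> h; apply: le_trans h _; apply: boxavg_le_itermax => // i.
by have [_ /(_ i)[]] := tS.
Qed.

(** Two intervals whose fresh parts share a point are nested, and if their
    scales agree modulo j + a then the fresh part of the shorter excludes the
    longer.  So a point lies in one fresh part for each residue at most. *)
Lemma sum_fresh (s : seq dyadic) j x : uniq s -> (0 < j)%N ->
  \sum_(I <- s) \1_(fresh j I) x <= (j + a)%:R * \1_(shadow U' : set (Rn R d.+1)) x :> R.
Proof.
move=> us j0; set N := (j + a)%N.
have N0 : (0 < N)%N by rewrite addn_gt0 j0.
have [Ux|nUx] := pselect ((shadow U' : set (Rn R d.+1)) x); last first.
  rewrite [\1_(shadow U') x]indicE (memNset nUx) mulr0 big1// => I _.
  by rewrite indicE memNset// => -[[S [[US _] _] Sx] _]; apply: nUx; exists S.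
rewrite [\1_(shadow U') x]indicE (mem_set Ux) mulr1.
pose s' := [seq I <- s | x \in fresh j I].
have -> : \sum_(I <- s) \1_(fresh j I) x = (size s')%:R :> R.
  rewrite size_filter -sum1_count natr_sum [RHS]big_mkcond /=.
  by apply: eq_bigr => I _; rewrite indicE; case: ifP.
rewrite ler_nat.
pose phi (I : dyadic) := `|(I.2 %% N)%Z|%N.
have excl I J : I \in s' -> J \in s' -> I.2 <= J.2 -> phi I = phi J -> I = J.
  rewrite !mem_filter => /andP[/set_mem xI _] /andP[/set_mem xJ _] IJ e.
  have dI := Fset_dint (proj1 xI); have dJ := Fset_dint (proj1 xJ).
  have [e2|ne2] := eqVneq I.2 J.2.
    by rewrite (dcell_eq dI) (dcell_eq dJ) e2.
  exfalso; apply: (proj2 xI); exists J; last exact: (proj1 xJ).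
  have Nz : N%:Z != 0 by lia.
  have e' : (I.2 %% N)%Z = (J.2 %% N)%Z.
    by have := modz_ge0 I.2 Nz; have := modz_ge0 J.2 Nz; rewrite /phi in e; lia.
  have := divz_eq I.2 N; have := divz_eq J.2 N; rewrite -e'.
  set q1 := (I.2 %/ _)%Z; set q2 := (J.2 %/ _)%Z => hJ hI.
  have q12 : q1 < q2 by nia.
  exists (absz (q2 - q1 - 1)%R); rewrite hI hJ PoszM.
  have -> : ((absz (q2 - q1 - 1)%R).+1)%:Z = q2 - q1 by lia.
  rewrite mulrBl; lia.
have inj : {in s' &, injective phi}.
  move=> I J Is Js e; have [h|h] := leP I.2 J.2; first exact: excl.
  by apply/esym/excl => //; exact: ltW.
rewrite -(size_map phi) -(size_iota 0 N); apply: uniq_leq_size.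
  by rewrite map_inj_in_uniq// filter_uniq.
move=> _ /mapP[I _ ->]; rewrite mem_iota add0n /=.
have Nz : N%:Z != 0 by lia.
have := ltz_pmod I.2 (_ : 0 < N%:Z); have := modz_ge0 I.2 Nz.
by rewrite /phi => h1 /(_ ltac:(lia)); lia.
Qed.

End Embeddedness.

(** * Duality *)

Section Duality.
Context {R : realType} {d : nat}.
Variables (g : Rn R d -> R) (S : set (Rn R d)).
Variables (M : (Rn R d -> R) -> Rn R d -> R) (A B p : R).
Hypotheses (p1 : 1 < p) (A0 : 0 < A) (B0 : 0 < B).
Hypotheses (ng : nnb g) (mS : measurable S) (finS : (leb d S < +oo)%E).
Hypothesis nM : forall w, nnb w -> nnb (M w).
Hypothesis M1 : forall x, M (fun=> 1) x <= 1.
Hypothesis dualM : forall w, nnb w ->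
  (\int[leb d]_x (g x * w x)%:E <= B%:E * \int[leb d]_x (\1_S x * M w x)%:E)%E.
Hypothesis powM : forall w, nnb w ->
  (\int[leb d]_x (M w x `^ (p / (p - 1)))%:E <=
   A%:E * \int[leb d]_x (w x `^ (p / (p - 1)))%:E)%E.

(** With w = g ^ (p - 1), Young's inequality splits M w on S into
    (2 B A)^-1 (M w) ^ p' and the constant (2 B A) ^ (p - 1).  The integral of
    the first term is at most int g ^ p / (2 B), which is half of the left-hand
    side after multiplication by B and is absorbed; doubling the rest gives
    this constant. *)
Definition dualC := 2 * B * (2 * B * A) `^ (p - 1).

Let nS : nnb (\1_S : Rn R d -> R). Proof. exact: nnb_indic. Qed.

Let intS : (\int[leb d]_x (\1_S x)%:E = leb d S)%E.
Proof. by rewrite integral_indic// setIT. Qed.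

Lemma duality_L1 : (\int[leb d]_x (g x)%:E <= B%:E * leb d S)%E.
Proof.
have n1 : nnb (fun _ : Rn R d => 1 : R) by exact: nnb_cst.
have := dualM n1; under eq_integral do rewrite mulr1.
move=> h; apply: le_trans h _; apply: lee_wpmul2l; first by rewrite lee_fin ltW.
rewrite -intS; apply: ge0_le_nnb => //; first exact: nnbM (nM n1).
by move=> x; rewrite -[leRHS]mulr1 ler_wpM2l// indicE.
Qed.

(* a crude Young inequality: either b ^ (p' - 1) is large enough for the first
   term to dominate, or b is at most the second *)
Let young (b : R) : 0 <= b ->
  b <= (2 * B * A)^-1 * b `^ (p / (p - 1)) + (2 * B * A) `^ (p - 1).
Proof.
move=> b0.
have q0 : 0 < p - 1 by rewrite subr_gt0.
have c0 : 0 < 2 * B * A by rewrite !mulr_gt0.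
have qp : 0 < p / (p - 1) by rewrite divr_gt0//; lra.
have [h|h] := leP (2 * B * A) (b `^ (p / (p - 1) - 1)).
  apply: ler_wpDr; first exact: powR_ge0.
  by rewrite mulrC ler_pdivlMr// -(mulr_powRB1 b0 qp) ler_wpM2l.
apply: ler_wpDl; first by rewrite mulr_ge0 ?powR_ge0// invr_ge0 ltW.
have e : (p / (p - 1) - 1) * (p - 1) = 1 by field; lra.
rewrite [leLHS](_ : b = (b `^ (p / (p - 1) - 1)) `^ (p - 1)); last first.
  by rewrite -powRrM e powRr1.
by apply: ge0_ler_powR; rewrite ?nnegrE ?powR_ge0 ?ltW.
Qed.

(** The absorption described at [dualC] needs the integral of g ^ p to be
    finite beforehand; it is, because g is bounded and integrable. *)
Lemma duality_Lp : (\int[leb d]_x (g x `^ p)%:E <= dualC%:E * leb d S)%E.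
Proof.
have p0 : 0 < p by exact: lt_trans p1.
have q0 : 0 < p - 1 by rewrite subr_gt0.
have c0 : 0 < 2 * B * A by rewrite !mulr_gt0.
have nw : nnb (fun x => g x `^ (p - 1)) by apply: nnb_powR => //; exact: ltW.
have ngp : nnb (fun x => g x `^ p) by apply: nnb_powR => //; exact: ltW.
set X := (\int[leb d]_x (g x `^ p)%:E)%E.
have X0 : (0 <= X)%E by apply: integral_ge0 => x _; rewrite lee_fin powR_ge0.
have finS' : leb d S \is a fin_num by rewrite ge0_fin_numE.
have XE : X = (\int[leb d]_x (g x * g x `^ (p - 1))%:E)%E.
  by apply: eq_integral => x _; rewrite mulr_powRB1// (nnb_ge0 x ng).
have finX : X \is a fin_num.
  rewrite ge0_fin_numE//; have [_ _ [c gc]] := ng.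
  apply: (@le_lt_trans _ _ (((`|c| `^ (p - 1)) * B)%:E * leb d S)%E); last first.
    by rewrite -(fineK finS') -EFinM ltry.
  apply: (@le_trans _ _ (\int[leb d]_x (`|c| `^ (p - 1) * g x)%:E)%E).
    rewrite XE; apply: ge0_le_nnb; first exact: nnbM.
      by apply: nnbM => //; apply: nnb_cst; exact: powR_ge0.
    move=> x; rewrite mulrC; apply: ler_wpM2r; first exact: (nnb_ge0 x ng).
    apply: ge0_ler_powR; first exact: ltW.
    - by rewrite nnegrE (nnb_ge0 x ng).
    - by rewrite nnegrE.
    - exact: le_trans (gc x) (ler_norm c).
  rewrite ge0_integralZl_nnb ?powR_ge0// EFinM -muleA; apply: lee_wpmul2l.
    by rewrite lee_fin powR_ge0.
  exact: duality_L1.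
have nMw := nM nw.
have qE : 0 <= p / (p - 1) by rewrite divr_ge0 ?ltW.
have nMq : nnb (fun x => M (fun y => g y `^ (p - 1)) x `^ (p / (p - 1))) by exact: nnb_powR.
have step : (X <= B%:E * ((2 * B * A)^-1%:E * (A%:E * X) +
    ((2 * B * A) `^ (p - 1))%:E * leb d S))%E.
  rewrite {1}XE; apply: le_trans (dualM nw) _; apply: lee_wpmul2l; first by rewrite lee_fin ltW.
  apply: (@le_trans _ _ (\int[leb d]_x ((2 * B * A)^-1 *
      M (fun y => g y `^ (p - 1)) x `^ (p / (p - 1)) +
      (2 * B * A) `^ (p - 1) * \1_S x)%:E)%E).
    apply: ge0_le_nnb; first exact: nnbM.
      apply: nnbD; apply: nnbM => //; apply: nnb_cst; last exact: powR_ge0.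
      by rewrite invr_ge0 ltW.
    move=> x; have := young (nnb_ge0 x nMw); rewrite indicE.
    case: (_ \in _) => h; first by rewrite mul1r mulr1.
    rewrite mul0r mulr0 addr0 mulr_ge0 ?powR_ge0// invr_ge0 ltW//.
  have cinv : 0 <= (2 * B * A)^-1 by rewrite invr_ge0 ltW.
  rewrite ge0_integralD_nnb; last 2 first.
  - by apply: nnbM => //; exact: nnb_cst.
  - by apply: nnbM => //; apply: nnb_cst; exact: powR_ge0.
  rewrite !ge0_integralZl_nnb ?powR_ge0// intS leeD2r//; apply: lee_wpmul2l => //.
  apply: le_trans (powM nw) _; apply: lee_wpmul2l; first by rewrite lee_fin ltW.
  apply: ge0_le_nnb => //; first exact: nnb_powR.
  move=> x; rewrite -powRrM (_ : (p - 1) * (p / (p - 1)) = p)//; field; lra.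
move: step; rewrite -(fineK finX) -(fineK finS') -!EFinM !lee_fin.
set y := fine X; set t := (_ `^ _).
have -> : B * ((2 * B * A)^-1 * (A * y) + t * fine (leb d S)) =
    y / 2 + B * t * fine (leb d S).
  by field; rewrite !gt_eqF.
rewrite /dualC -/t; lra.
Qed.

End Duality.

Section SquareSum.
Context {R : realType} {d : nat}.
Variables (a : nat) (c : R) (U U' : set (drect d.+1)) (n : nat).
Hypotheses (c01 : 0 < c < 1) (U'U : U' `<=` U).
Let V := enlarge (2 ^- a) c U.
Let F j I : set (Rn R d.+1) := Fset V I j (truncated n U').
Let L := rev (enum 'I_d.+1).
Let D : R := doobC 2 ^+ d.+1.

(** One factor comes from each of the two uses of the weighted inequality in
    the proof of [sqrsum_dual]. *)
Definition dualmax (w : Rn R d.+1 -> R) := itermax n (rev L) (itermax n (rev L) w).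

Let D0 : 0 <= D. Proof. by rewrite exprn_ge0// doobC_ge0// ltr1n. Qed.

Let cD : 0 <= c ^- 2 * D ^+ 2.
Proof.
apply: mulr_ge0; last exact: exprn_ge0.
by rewrite invr_ge0 exprn_ge0// ltW//; case/andP: c01.
Qed.

Let weighted_sqr (f w : Rn R d.+1 -> R) : nnb f -> nnb w ->
  (\int[leb d.+1]_x (itermax n L f x ^+ 2 * w x)%:E <=
   D%:E * \int[leb d.+1]_x (f x ^+ 2 * itermax n (rev L) w x)%:E)%E.
Proof.
move=> nf nw; have nT := itermax_nnb n L nf.
have := itermax_weighted n L (ltr1n R 2) nf nw.
rewrite {2}/L size_rev size_enum_ord -/D.
under eq_integral do rewrite (powR_mulrn 2 (nnb_ge0 _ nT)).
by under [X in (_ <= _ * X)%E -> _]eq_integral do rewrite (powR_mulrn 2 (nnb_ge0 _ nf)).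
Qed.

Let nnb_sqr (f : Rn R d.+1 -> R) : nnb f -> nnb (fun x => f x ^+ 2).
Proof. by move=> nf; under eq_fun do rewrite expr2; exact: nnbM. Qed.

(* the weighted inequality removes the maximal operator from 1_F, then 1_F is
   bounded by the maximal function of the fresh part, and the weighted
   inequality is used again *)
Let term_le j I w : nnb w ->
  (\int[leb d.+1]_x (itermax n L \1_(F j I) x ^+ 2 * w x)%:E <=
   (c^-2 * D ^+ 2)%:E * \int[leb d.+1]_x (\1_(fresh a c U U' n j I) x * dualmax w x)%:E)%E.
Proof.
move=> nw.
have nF : nnb (\1_(F j I) : Rn R d.+1 -> R) by apply: nnb_indic; exact: measurable_Fset.
have nH : nnb (\1_(fresh a c U U' n j I) : Rn R d.+1 -> R).
  by apply: nnb_indic; exact: measurable_fresh.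
have nw1 := itermax_nnb n (rev L) nw.
have nw2 := itermax_nnb n (rev L) nw1.
have c2 : 0 <= c ^- 2 by rewrite invr_ge0 exprn_ge0// ltW//; case/andP: c01.
have nTH := itermax_nnb n L nH.
apply: le_trans (weighted_sqr nF nw) _.
apply: (@le_trans _ _ (D%:E * \int[leb d.+1]_x
   (c ^- 2 * (itermax n L \1_(fresh a c U U' n j I) x ^+ 2 * itermax n (rev L) w x))%:E)%E).
  apply: lee_wpmul2l; first by rewrite lee_fin.
  apply: ge0_le_nnb; first by apply: nnbM => //; exact: nnb_sqr.
    apply: nnbM; first exact: nnb_cst.
    by apply: nnbM => //; exact: nnb_sqr.
  move=> x; rewrite mulrA ler_wpM2r ?(nnb_ge0 x nw1)//.
  have := @Fset_le_itermax R d a c U U' n U'U j I x; rewrite -/V -/(F j I) -/L => h.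
  have cc : 0 < c by case/andP: c01.
  rewrite mulrC ler_pdivlMr ?exprn_gt0// -exprMn [_ * c]mulrC.
  rewrite ler_pXn2r// ?nnegrE ?mulr_ge0 ?(nnb_ge0 x nF) ?(nnb_ge0 x nTH)//.
  exact: ltW.
rewrite ge0_integralZl_nnb//; last by apply: nnbM => //; exact: nnb_sqr.
rewrite muleA -EFinM.
apply: (@le_trans _ _ ((D * c ^- 2)%:E * (D%:E * \int[leb d.+1]_x
    (\1_(fresh a c U U' n j I) x ^+ 2 * dualmax w x)%:E))%E).
  apply: lee_wpmul2l; first by rewrite lee_fin mulr_ge0.
  exact: weighted_sqr.
rewrite muleA -EFinM (_ : D * c ^- 2 * D = c ^- 2 * D ^+ 2); last by rewrite expr2; ring.
rewrite (_ : \int[leb d.+1]_x _ = \int[leb d.+1]_x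
   (\1_(fresh a c U U' n j I) x * dualmax w x)%:E)%E//.
apply: eq_integral => x _; rewrite indicE; case: (_ \in _); rewrite ?expr1n// expr0n.
by [].
Qed.

Lemma dualmax_nnb w : nnb w -> nnb (dualmax w).
Proof. by move=> nw; do 2 apply: itermax_nnb. Qed.

Definition sqrsum (r : nat -> R) (s : seq dyadic) (x : Rn R d.+1) : R :=
  \sum_(1 <= j < n.+1) r j * \sum_(I <- s) itermax n L \1_(F j I) x ^+ 2.

Let nnb_level j (s : seq dyadic) : nnb (fun x => \sum_(I <- s) itermax n L \1_(F j I) x ^+ 2).
Proof.
apply: nnb_sum => I; apply/nnb_sqr/itermax_nnb/nnb_indic; exact: measurable_Fset.
Qed.

Lemma sqrsum_nnb r s : (forall j, 0 <= r j) -> nnb (sqrsum r s).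
Proof.
by move=> r0; apply: nnb_sum => j; apply: nnbM => //; exact: nnb_cst.
Qed.

Let level_le j (s : seq dyadic) w : uniq s -> (0 < j)%N -> nnb w ->
  (\int[leb d.+1]_x ((\sum_(I <- s) itermax n L \1_(F j I) x ^+ 2) * w x)%:E <=
   (c^-2 * D ^+ 2 * (j + a)%:R)%:E *
   \int[leb d.+1]_x (\1_(shadow U') x * dualmax w x)%:E)%E.
Proof.
move=> us j0 nw.
have nd := dualmax_nnb nw.
have nT I : nnb (fun x => itermax n L \1_(F j I) x ^+ 2 * w x).
  by apply: nnbM => //; apply/nnb_sqr/itermax_nnb/nnb_indic; exact: measurable_Fset.
have nH I : nnb (\1_(fresh a c U U' n j I) : Rn R d.+1 -> R).
  by apply: nnb_indic; exact: measurable_fresh.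
have nHd I : nnb (fun x => \1_(fresh a c U U' n j I) x * dualmax w x) by exact: nnbM.
have nU : nnb (\1_(shadow U') : Rn R d.+1 -> R) by apply: nnb_indic; exact: measurable_shadow.
under eq_integral do rewrite mulr_suml -sumEFin.
rewrite ge0_integral_sum//; last 2 first.
- by move=> I; exact: nnb_EFin.
- by move=> I x _; rewrite lee_fin (nnb_ge0 x (nT I)).
apply: (@le_trans _ _ (\sum_(I <- s) (c ^- 2 * D ^+ 2)%:E *
    \int[leb d.+1]_x (\1_(fresh a c U U' n j I) x * dualmax w x)%:E)%E).
  by apply: lee_sum => I _; exact: term_le.
rewrite -ge0_sume_distrr; last first.
  by move=> I _; apply: integral_ge0 => x _; rewrite lee_fin (nnb_ge0 x (nHd I)).
rewrite [in leRHS]EFinM -[leRHS]muleA; apply: lee_wpmul2l; first by rewrite lee_fin.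
rewrite -ge0_integral_sum//; last 2 first.
- by move=> I; exact: nnb_EFin.
- by move=> I x _; rewrite lee_fin (nnb_ge0 x (nHd I)).
rewrite -ge0_integralZl_nnb//; last exact: nnbM.
under eq_integral do rewrite sumEFin.
apply: ge0_le_nnb; first exact: nnb_sum.
  by apply: nnbM; [exact: nnb_cst|exact: nnbM].
move=> x; rewrite -mulr_suml mulrA ler_wpM2r ?(nnb_ge0 x nd)//.
exact: sum_fresh.
Qed.

(** On the right the fresh parts of level j stand in place of the sets F(I, j),
    and j + a bounds their overlap. *)
Lemma sqrsum_dual r s w : (forall j, 0 <= r j) -> uniq s -> nnb w ->
  (\int[leb d.+1]_x (sqrsum r s x * w x)%:E <=
   (c^-2 * D ^+ 2 * \sum_(1 <= j < n.+1) r j * (j + a)%:R)%:E *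
   \int[leb d.+1]_x (\1_(shadow U') x * dualmax w x)%:E)%E.
Proof.
move=> r0 us nw.
have nl j : nnb (fun x => (\sum_(I <- s) itermax n L \1_(F j I) x ^+ 2) * w x) by exact: nnbM.
set Y := (\int[leb d.+1]_x (\1_(shadow U') x * dualmax w x)%:E)%E.
have nU : nnb (\1_(shadow U') : Rn R d.+1 -> R) by apply: nnb_indic; exact: measurable_shadow.
have Y0 : (0 <= Y)%E.
  apply: integral_ge0 => x _; rewrite lee_fin mulr_ge0 ?(nnb_ge0 x nU)//.
  exact: (nnb_ge0 x (dualmax_nnb nw)).
have nrl j : nnb (fun x => r j * ((\sum_(I <- s) itermax n L \1_(F j I) x ^+ 2) * w x)).
  by apply: nnbM => //; exact: nnb_cst.
rewrite (_ : \int[leb d.+1]_x _ = \int[leb d.+1]_x (\sum_(1 <= j < n.+1)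
    (r j * ((\sum_(I <- s) itermax n L \1_(F j I) x ^+ 2) * w x))%:E))%E; last first.
  apply: eq_integral => x _; rewrite sumEFin /sqrsum mulr_suml; congr EFin.
  by apply: eq_bigr => j _; rewrite mulrA.
rewrite ge0_integral_sum//; last 2 first.
- by move=> j; exact: nnb_EFin.
- by move=> j x _; rewrite lee_fin (nnb_ge0 x (nrl j)).
rewrite mulr_sumr -sumEFin ge0_sume_distrl; last first.
  by move=> j _; rewrite lee_fin mulr_ge0// mulr_ge0.
rewrite big_seq [leRHS]big_seq; apply: lee_sum => j; rewrite mem_index_iota => /andP[j1 _].
rewrite ge0_integralZl_nnb//.
apply: le_trans (lee_wpmul2l _ (level_le us j1 nw)) _; first by rewrite lee_fin.
by rewrite muleA -EFinM -/Y mulrCA mulrA.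
Qed.

End SquareSum.

(** * The strong maximal function of an indicator *)

Section StrongMaximal.
Context {R : realType}.
Local Notation mu := (@lebesgue_measure R).

Lemma exp2_bracket (t : R) : 0 < t -> exists k : int, t < 2 ^ k <= 2 * t.
Proof.
move=> t0; have l2 : 0 < ln 2 :> R by rewrite ln_gt0// ltr1n.
have E (k : int) : 2 ^ k = expR (k%:~R * ln 2) :> R.
  by rewrite -powR_intmul// /powR gt_eqF.
exists (Num.floor (ln t / ln 2) + 1); apply/andP; split.
  rewrite E -{1}(lnK t0) ltr_expR -ltr_pdivrMr//; exact: floorD1_gt.
rewrite expfzDr// expr1z mulrC ler_pM2l// E -[leRHS](lnK t0) ler_expR -ler_pdivlMr//.
exact: floor_le.
Qed.

(** The endpoints of the two grids stay a third of the mesh apart, so a set of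
    smaller diameter lies in a single cell of one of them. *)
Lemma one_grid (A : set R) (k : int) (l : R) : 3 * l < 2 ^ k ->
  (forall x y, A x -> A y -> y - x <= l) ->
  exists g, forall x y, A x -> A y -> gidx g k x = gidx g k y.
Proof.
move=> lk Al; apply: contrapT => no.
have sep g : exists e : int, exists x y, [/\ A x, A y, x < (e%:~R + gshift g k) * 2 ^ k &
    (e%:~R + gshift g k) * 2 ^ k <= y].
  have [x [y [Ax Ay xy]]] : exists x y, [/\ A x, A y & gidx g k x < gidx g k y].
    apply: contrapT => no2; apply: no; exists g => x y Ax Ay.
    apply/eqP; rewrite eq_le; apply/andP; split; rewrite leNgt; apply/negP => h; apply: no2.
      by exists y, x.
    by exists x, y.
  exists (gidx g k y), x, y; split => //.
    have := gidxE g k x (gidx g k x); rewrite eqxx => /esym/andP[_ h].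
    apply: lt_le_trans h _; rewrite ler_pM2r ?exp2_gt0// lerD2r ler_int; lia.
  by have := gidxE g k y (gidx g k y); rewrite eqxx => /esym/andP[].
have [e [x [y [Ax Ay xe ey]]]] := sep false.
have [e' [x' [y' [Ax' Ay' xe' ey']]]] := sep true.
have h1 := Al _ _ Ax Ay'; have h2 := Al _ _ Ax' Ay.
have P0 : 0 < 2 ^ k :> R by exact: exp2_gt0.
move: xe ey xe' ey'; rewrite /gshift addr0.
set P := 2 ^ k in lk P0 *.
have {Al sep no} : forall s : R, s = 1 \/ s = -1 -> x < e%:~R * P -> e%:~R * P <= y ->
    x' < (e'%:~R + s / 3) * P -> (e'%:~R + s / 3) * P <= y' -> False.
  move=> s sE a1 a2 a3 a4.
  have b1 : (e%:~R - (e'%:~R + s / 3)) * P < P / 3 by lra.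
  have b2 : - (P / 3) < (e%:~R - (e'%:~R + s / 3)) * P by lra.
  have {b1} b1 : e%:~R - (e'%:~R + s / 3) < 1 / 3 by rewrite -(ltr_pM2r P0); lra.
  have {b2} b2 : - (1 / 3) < e%:~R - (e'%:~R + s / 3) by rewrite -(ltr_pM2r P0); lra.
  case: sE => sE; rewrite sE in b1 b2.
    have c1 : (e - e')%:~R < 1%:~R :> R by rewrite intrB; lra.
    have c2 : 0%:~R < (e - e')%:~R :> R by rewrite intrB; lra.
    by move: c1 c2; rewrite !ltr_int; clear; lia.
  have c1 : (e - e')%:~R < 0%:~R :> R by rewrite intrB; lra.
  have c2 : (-1)%:~R < (e - e')%:~R :> R by rewrite intrB intrN; lra.
  by move: c1 c2; rewrite !ltr_int; clear; lia.
apply.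
have [->|->] : (-1) ^ k = 1 :> R \/ (-1) ^ k = -1 :> R; [|by left|by right].
have sq : ((-1) ^ k) ^+ 2 = 1 :> R.
  by rewrite expr2 -expfzMl mulrNN mulr1 exp1rz.
by move/eqP: sq; rewrite sqrf_eq1 => /orP[]/eqP ->; [left|right].
Qed.

(** Choose 2 ^ k between 3 |A| and 6 |A|: [one_grid] needs the mesh to exceed
    three times the length. *)
Lemma interval_cell (A : set R) : is_interval A -> (0 < mu A < +oo)%E ->
  exists g k, (forall x y, A x -> A y -> gidx g k x = gidx g k y) /\
    ((2 ^ k)%:E <= 6%:E * mu A)%E.
Proof.
move=> iA /andP[A0 Aoo].
have finA : mu A \is a fin_num by rewrite ge0_fin_numE// ltW.
have mA : measurable (A : set (measurableTypeR R)) by exact: is_interval_measurable.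
pose l := fine (mu A).
have l0 : 0 < l by rewrite fine_gt0// A0.
have [k /andP[k1 k2]] := exp2_bracket (mulr_gt0 (ltr0n _ 3) l0 : 0 < 3 * l).
have [|g gP] := @one_grid A k l k1.
  move=> x y Ax Ay; have [xy|yx] := leP x y; last by apply: le_trans (ltW l0); lra.
  rewrite -lee_fin /l fineK//.
  have -> : ((y - x)%:E = mu `[x, y])%E.
    rewrite lebesgue_measure_itv /= lte_fin; case: ltP => h; first by rewrite EFinB.
    by have -> : y - x = 0 by lra.
  apply: le_measure; rewrite ?inE//.
  by move=> z; rewrite /= in_itv /= => h; exact: iA Ax Ay _ h.
exists g, k; split => //; rewrite -(fineK finA) -EFinM lee_fin -/l.
by apply: le_trans k2 _; lra.
Qed.

Context {d : nat}.
Local Notation L := (rev (enum 'I_d)).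

(** B lies in a box of cells at most 6 ^ d times as large; n0 bounds the
    absolute values of its scales. *)
Lemma rectangle_average (B : set (Rn R d)) x : is_rectangle B -> B x ->
  exists n0, forall n f, (n0 <= n)%N -> nnb f ->
    (\int[leb d]_(y in B) (f y)%:E <=
     (6 ^+ d)%:E * leb d B * (itermax n L f x)%:E)%E.
Proof.
move=> [A hA ->] Bx.
have hgk i := interval_cell (proj1 (hA i)) (proj2 (hA i)).
pose gr i := projT1 (cid (hgk i)).
pose sc i := projT1 (cid (projT2 (cid (hgk i)))).
have gsP i : (forall x y, A i x -> A i y -> gidx (gr i) (sc i) x = gidx (gr i) (sc i) y) /\
    ((2 ^ sc i)%:E <= 6%:E * mu (A i))%E by exact: (projT2 (cid (projT2 (cid (hgk i))))).
have mA i : measurable (A i : set (measurableTypeR R)).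
  exact: is_interval_measurable (proj1 (hA i)).
exists (\max_(i < d) `|sc i|%N) => n f nn nf.
apply: le_trans (boxavg_ge_int (gr := gr) (sc := sc) (x := x) nf mA _) _.
  by move=> i y Ay; apply: (proj1 (gsP i)) => //; exact: Bx.
have b0 : 0 <= boxavg gr sc L f x by apply: nnb_ge0; exact: boxavg_nnb.
rewrite EFinM leb_box//.
apply: lee_pmul.
- by rewrite lee_fin; apply: prodr_ge0 => i _; exact/ltW/exp2_gt0.
- by rewrite lee_fin.
- have -> : ((6 ^+ d)%:E = \prod_(i < d) 6%:E :> \bar R)%E.
    by rewrite prodEFin big_const_ord iter_mulr mulr1.
  rewrite -prodEFin -big_split /=.
  apply: (@proj2 (0 <= \prod_(i < d) (2 ^ sc i)%:E)%E).
  apply: (big_ind2 (fun u v : \bar R => 0 <= u /\ u <= v)%E); first by split; rewrite ?lee_fin.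
    move=> x1 x2 y1 y2 [h1 h2] [h3 h4]; split; first exact: mule_ge0.
    exact: lee_pmul.
  move=> i _; split; last exact: (proj2 (gsP i)).
  by rewrite lee_fin ltW// exp2_gt0.
- rewrite lee_fin; apply: boxavg_le_itermax => // i.
  have : (`|sc i|%N <= \max_(i < d) `|sc i|%N)%N by apply: (leq_bigmax i).
  by move=> h; have := leq_trans h nn; lia.
Qed.

Lemma leb_rectangle (B : set (Rn R d)) : is_rectangle B ->
  [/\ measurable B, (0 < leb d B)%E & leb d B \is a fin_num].
Proof.
move=> [A hA ->].
have mA i : measurable (A i : set (measurableTypeR R)).
  exact: is_interval_measurable (proj1 (hA i)).
split; first exact: measurable_box.
  rewrite leb_box//; apply: (big_ind (fun x : \bar R => 0 < x)%E) => //.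
    by move=> x y x0 y0; exact: mule_gt0.
  by move=> i _; case/andP: (proj2 (hA i)).
rewrite leb_box//; apply: prode_fin_num => i _; case/andP: (proj2 (hA i)) => h1 h2.
by rewrite ge0_fin_numE// ltW.
Qed.

Lemma rectangle_through (x : Rn R d) : exists2 B : set (Rn R d), is_rectangle B & B x.
Proof.
exists (box (fun i => `[tnth x i, tnth x i + 1]%classic)).
  exists (fun i => `[tnth x i, tnth x i + 1]%classic) => // i; split.
    exact: interval_is_interval.
  rewrite lebesgue_measure_itv /= lte_fin ltrDl ltr01 -EFinD addrAC subrr add0r.
  by rewrite lte_fin ltr01 ltry.
by move=> i /=; rewrite in_itv /= lexx lerDl ler01.
Qed.

Let abs_indic (F : set (Rn R d)) B : measurable F -> measurable B ->
  (\int[leb d]_(y in B) `|\1_F y|%:E = leb d (F `&` B))%E.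
Proof.
move=> mF mB; rewrite -integral_indic//; apply: eq_integral => y _.
by rewrite ger0_norm// indicE.
Qed.

Lemma strong_maximal_indic_ge0 (F : set (Rn R d)) x : measurable F ->
  (0 <= strong_maximal \1_F x)%E.
Proof.
move=> mF; have [B rB Bx] := rectangle_through x.
have [mB B0 Bfin] := leb_rectangle rB.
apply: (@le_trans _ _ ((leb d B)^-1 * \int[leb d]_(y in B) `|\1_F y|%:E)%E); last first.
  by apply: ereal_sup_ubound; exists B.
by apply: mule_ge0; [rewrite inve_ge0|exact: integral_ge0].
Qed.

Lemma strong_maximal_indic_le1 (F : set (Rn R d)) x : measurable F ->
  (strong_maximal \1_F x <= 1)%E.
Proof.
move=> mF; apply: ge_ereal_sup => _ [B [rB Bx] <-].
have [mB B0 Bfin] := leb_rectangle rB.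
rewrite abs_indic//.
apply: (@le_trans _ _ ((leb d B)^-1 * leb d B)%E).
  apply: lee_wpmul2l; first by rewrite inve_ge0.
  by apply: le_measure; rewrite ?inE//; exact: measurableI.
by rewrite -(fineK Bfin) inver gt_eqF ?fine_gt0 ?B0 ?ltey_eq ?Bfin// -EFinM mulVf// gt_eqF// fine_gt0// B0 ltey_eq Bfin.
Qed.

(** A single rectangle involves finitely many scales, so it is controlled by
    the truncated operators from some n on; continuity from below of the
    measure does the rest. *)
Lemma strong_maximal_le_lim (F : (set (Rn R d))^nat) (x : Rn R d) (b : R) :
  (forall n, measurable (F n)) -> nondecreasing_seq F ->
  (forall n, itermax n L \1_(F n) x <= b) ->
  (strong_maximal \1_(\bigcup_n F n) x <= (6 ^+ d * b)%:E)%E.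
Proof.
move=> mF ndF hb; have mU : measurable (\bigcup_n F n) by exact: bigcupT_measurable.
apply: ge_ereal_sup => _ [B [rB Bx] <-].
have [mB B0 Bfin] := leb_rectangle rB.
have f0 : 0 < fine (leb d B) by rewrite fine_gt0// B0 ltey_eq Bfin.
rewrite abs_indic// -(fineK Bfin) inver gt_eqF// setI_bigcupl.
have mFB n : measurable (F n `&` B) by exact: measurableI.
have ndFB : nondecreasing_seq (fun n => F n `&` B).
  by move=> n m nm; apply/subsetPset; apply: setSI; apply/subsetPset; exact: ndF.
have mUB : measurable (\bigcup_n (F n `&` B)) by exact: bigcupT_measurable.
have cv := nondecreasing_cvg_mu (mu := leb d) mFB mUB ndFB.
rewrite -(@lee_pmul2l _ (fine (leb d B))%:E)// muleA -EFinM mulfV ?gt_eqF// mul1e -EFinM.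
rewrite -(cvg_lim _ cv)//; apply: lime_le; first by apply/cvg_ex; eexists; exact: cv.
have [n0 hn0] := rectangle_average rB Bx.
exists n0 => // n /= nn.
have := hn0 n _ nn (nnb_indic (mF n)); rewrite integral_indic// => h.
apply: le_trans h _; rewrite -{1}(fineK Bfin) -!EFinM lee_fin.
rewrite [leRHS]mulrCA [leRHS]mulrA; exact: ler_wpM2l.
Qed.

End StrongMaximal.

(** * Passage to the limit *)

Section Limits.
Context {R : realType}.

(** The integral of a nonnegative function is a supremum over the simple
    functions below it, hence monotone.  It is used with f a power of a sum of
    strong maximal functions, and h a limit of measurable functions. *)
Lemma ge0_integral_mono dT (T : measurableType dT)
    (P : {measure set T -> \bar R}) (f h : T -> \bar R) :
  (forall x, 0 <= f x)%E -> (forall x, f x <= h x)%E ->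
  (\int[P]_x f x <= \int[P]_x h x)%E.
Proof.
move=> f0 fh; rewrite !ge0_integralTE//; last by move=> x; exact: le_trans (fh x).
by apply: ereal_sup_le => _ [k kf <-]; exists k => // x; exact: le_trans (fh x).
Qed.

Lemma lee_sum_subseq (T : eqType) (s s' : seq T) (f : T -> \bar R) :
  uniq s -> uniq s' -> {subset s <= s'} -> (forall x, 0 <= f x)%E ->
  (\sum_(x <- s) f x <= \sum_(x <- s') f x)%E.
Proof.
move=> us us' ss f0; rewrite [leRHS](bigID (mem s)) /=.
rewrite -[leLHS]adde0 leeD//; last exact: sume_ge0.
rewrite -[in leRHS]big_filter (perm_big [seq x <- s' | x \in s])//.
apply: uniq_perm => //; first exact: filter_uniq.
by move=> x; rewrite mem_filter; case: (boolP (x \in s)) => //= /ss ->.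
Qed.

Section Exhaustion.
Variables (T : choiceType) (D : nat -> seq T).
Hypotheses (uD : forall n, uniq (D n)).
Hypothesis ndD : forall n m, (n <= m)%N -> {subset D n <= D m}.
Hypothesis exD : forall x, exists n, x \in D n.

Lemma esum_le_lim (t : T -> \bar R) (b : nat -> T -> \bar R) :
  (forall x, 0 <= t x)%E -> (forall n x, 0 <= b n x)%E ->
  (forall x, nondecreasing_seq (b ^~ x)) ->
  (forall x, t x <= limn (b ^~ x))%E ->
  (\esum_(x in [set: T]) t x <= limn (fun n => \sum_(x <- D n) b n x))%E.
Proof.
move=> t0 b0 ndb tb; apply: ge_ereal_sup => _ [A [finA _] <-].
have cb x : cvgn (b ^~ x) by exact: ereal_nondecreasing_is_cvgn.
have [m Am] : exists m, A `<=` [set` D m].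
  have [s ->] := iffLR (finite_seqP _) finA.
  elim: s => [|x s [m sm]]; first by exists 0%N.
  have [k xk] := exD x; exists (maxn m k) => y /=; rewrite inE => /orP[/eqP ->|ys].
    exact: ndD (leq_maxr _ _) _ xk.
  exact: ndD (leq_maxl _ _) _ (sm _ ys).
apply: (@le_trans _ _ (\sum_(x <- D m) t x)%E).
  rewrite [leRHS]fsbig_seq//; apply: lee_fsum_nneg_subset => //.
  exact/subsetP.
apply: (@le_trans _ _ (\sum_(x <- D m) limn (b ^~ x))%E).
  exact: lee_sum.
rewrite -lim_nnesum//; last by move=> x _; apply: nearW => n.
apply: lee_lim.
- apply: ereal_nondecreasing_is_cvgn => n k nk; apply: lee_sum => x _.
  exact: ndb.
- apply: ereal_nondecreasing_is_cvgn => n k nk.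
  apply: (@le_trans _ _ (\sum_(x <- D n) b k x)%E).
    by apply: lee_sum => x _; exact: ndb.
  by apply: lee_sum_subseq => //; exact: ndD.
exists m => // n /= mn.
by apply: lee_sum_subseq => //; exact: ndD.
Qed.

(** A doubly infinite sum is the supremum of its finite parts, and a finite
    part is eventually covered by the n-th truncation. *)
Lemma nneseries_esum_le_lim (t : nat -> T -> \bar R) (b : nat -> nat -> T -> \bar R) :
  (forall j x, 0 <= t j x)%E -> (forall j n x, 0 <= b j n x)%E ->
  (forall j x, nondecreasing_seq (b j ^~ x)) ->
  (forall j x, (0 < j)%N -> t j x <= limn (b j ^~ x))%E ->
  (\sum_(1 <= j <oo) \esum_(x in [set: T]) t j x <=
   limn (fun n => \sum_(1 <= j < n.+1) \sum_(x <- D n) b j n x))%E.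
Proof.
move=> t0 b0 ndb tb.
have ndc j : nondecreasing_seq (fun n => \sum_(x <- D n) b j n x)%E.
  move=> n k nk; apply: (@le_trans _ _ (\sum_(x <- D n) b j k x)%E).
    by apply: lee_sum => x _; exact: ndb.
  by apply: lee_sum_subseq => //; exact: ndD.
have ndC : nondecreasing_seq (fun n => \sum_(1 <= j < n.+1) \sum_(x <- D n) b j n x)%E.
  move=> n k nk; apply: (@le_trans _ _ (\sum_(1 <= j < n.+1) \sum_(x <- D k) b j k x)%E).
    by apply: lee_sum => j _; exact: ndc.
  apply: lee_sum_subseq; rewrite ?iota_uniq//.
    by move=> j; rewrite !mem_index_iota; lia.
  by move=> j; exact: sume_ge0.
have cS : cvgn (fun m => \sum_(1 <= j < m) \esum_(x in [set: T]) t j x)%E.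
  by apply: is_cvg_nneseries => j _ _; exact: esum_ge0.
apply: (lime_le cS).
apply: nearW => m.
apply: (@le_trans _ _ (\sum_(1 <= j < m) limn (fun n => \sum_(x <- D n) b j n x))%E).
  rewrite big_seq [leRHS]big_seq; apply: lee_sum => j.
  rewrite mem_index_iota => /andP[j1 _].
  by apply: esum_le_lim => // x; exact: tb.
rewrite -(lim_nnesum _ (fun=> 0%E)); last 2 first.
- by move=> j _; apply: nearW => n; exact: sume_ge0.
- by move=> j _; exact: (ereal_nondecreasing_is_cvgn (ndc j)).
apply: lee_lim.
- apply: ereal_nondecreasing_is_cvgn => n k nk; apply: lee_sum => j _.
  exact: ndc.
- exact: (ereal_nondecreasing_is_cvgn ndC).
exists m => // n /= mn.
apply: lee_sum_subseq; rewrite ?iota_uniq//.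
  by move=> j; rewrite !mem_index_iota; lia.
by move=> j; exact: sume_ge0.
Qed.

End Exhaustion.

Definition dyadics (n : nat) : seq dyadic :=
  let r := [seq m%:Z - n%:Z | m <- iota 0 (2 * n).+1] in
  [seq (i, k) | i <- r, k <- r].

Lemma mem_dyadics n (I : dyadic) :
  (I \in dyadics n) = (`|I.1| <= n%:Z) && (`|I.2| <= n%:Z).
Proof.
have mr (z : int) : (z \in [seq m%:Z - n%:Z | m <- iota 0 (2 * n).+1]) = (`|z| <= n%:Z).
  apply/mapP/idP => [[m + ->]|h]; first by rewrite mem_iota; lia.
  by exists (absz (z + n%:Z)); [rewrite mem_iota; lia|lia].
apply/allpairsP/idP => [[[i k] /= [+ + ->]]|/andP[h1 h2]]; first by rewrite !mr /= => -> ->.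
by exists I; rewrite !mr; split => //; case: I {h1 h2}.
Qed.

Lemma dyadics_uniq n : uniq (dyadics n).
Proof.
have ur : uniq [seq m%:Z - n%:Z | m <- iota 0 (2 * n).+1].
  by rewrite map_inj_uniq ?iota_uniq// => x y /addIr [].
by apply: allpairs_uniq => // -[i k] [i' k'] _ _ [-> ->].
Qed.

Lemma dyadics_nd n m : (n <= m)%N -> {subset dyadics n <= dyadics m}.
Proof. by move=> nm I; rewrite !mem_dyadics; lia. Qed.

Lemma dyadics_exhaust (I : dyadic) : exists n, I \in dyadics n.
Proof. by exists (absz I.1 + absz I.2)%N; rewrite mem_dyadics; lia. Qed.

End Limits.

Section Estimates.
Context {R : realType} {d : nat}.
Variables (a : nat) (c : R) (U U' : set (drect d.+1)) (r : nat -> R) (Kr : R).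
Hypotheses (c01 : 0 < c < 1) (U'U : U' `<=` U).
Hypothesis finU : (leb d.+1 (shadow U : set (Rn R d.+1)) < +oo)%E.
Hypotheses (r0 : forall j, 0 <= r j) (Kr0 : 0 < Kr).
Hypothesis rK : forall n, \sum_(1 <= j < n.+1) r j * (j + a)%:R <= Kr.
Let V := enlarge (2 ^- a) c U.
Let Fn n j I : set (Rn R d.+1) := Fset V I j (truncated n U').
Let F j I : set (Rn R d.+1) := Fset V I j U'.
Let D : R := doobC 2 ^+ d.+1.
Let B : R := c ^- 2 * D ^+ 2 * Kr.
Let A (p : R) : R := (doobC (p / (p - 1)) ^+ d.+1) ^+ 2.
Let S : set (Rn R d.+1) := shadow U'.
Let L := rev (enum 'I_d.+1).
Let g n := sqrsum a c U U' n r (dyadics n).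

Let doobC_gt0 (q : R) : 1 < q -> 0 < doobC q.
Proof.
move=> q1; rewrite /doobC mulr_gt0// mulr_gt0 ?powR_gt0// divr_gt0//; last by rewrite subr_gt0.
exact: lt_trans q1.
Qed.

Let conj_gt1 (p : R) : 1 < p -> 1 < p / (p - 1).
Proof. by move=> p1; rewrite ltr_pdivlMr ?subr_gt0//; lra. Qed.

Let c0 : 0 < c. Proof. by case/andP: c01. Qed.

Let B0 : 0 < B.
Proof.
have D0 : 0 < D by rewrite exprn_gt0// doobC_gt0// ltr1n.
apply: mulr_gt0 => //; apply: mulr_gt0; last exact: exprn_gt0.
by rewrite invr_gt0 exprn_gt0.
Qed.

Let A0 p : 1 < p -> 0 < A p.
Proof. by move=> p1; rewrite exprn_gt0// exprn_gt0// doobC_gt0// conj_gt1. Qed.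

Let mS : measurable S. Proof. exact: measurable_shadow. Qed.

Let finS : (leb d.+1 S < +oo)%E.
Proof.
apply: le_lt_trans finU; apply: le_measure; rewrite ?inE//; first exact: measurable_shadow.
by move=> x [T UT Tx]; exists T => //; exact: U'U.
Qed.

Let nS : nnb (\1_S : Rn R d.+1 -> R). Proof. exact: nnb_indic. Qed.

Let ng n : nnb (g n). Proof. exact: sqrsum_nnb. Qed.

Let nM n (w : Rn R d.+1 -> R) : nnb w -> nnb (dualmax n w).
Proof. exact: dualmax_nnb. Qed.

Let M1 n (x : Rn R d.+1) : dualmax n (fun=> 1) x <= 1.
Proof.
have n1 : nnb (fun _ : Rn R d.+1 => 1 : R) by exact: nnb_cst.
apply: itermax_bound => //; first exact: itermax_nnb.
by move=> y; exact: itermax_bound.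
Qed.

Let dualM n (w : Rn R d.+1 -> R) : nnb w ->
  (\int[leb d.+1]_x (g n x * w x)%:E <=
   B%:E * \int[leb d.+1]_x (\1_S x * dualmax n w x)%:E)%E.
Proof.
move=> nw; apply: le_trans (sqrsum_dual a n c01 U'U r0 (dyadics_uniq n) nw) _.
apply: lee_wpmul2r.
  apply: integral_ge0 => x _; rewrite lee_fin mulr_ge0 ?(nnb_ge0 x nS)//.
  exact: (nnb_ge0 x (nM n nw)).
rewrite lee_fin -/D ler_wpM2l// mulr_ge0 ?exprn_ge0//.
  by rewrite invr_ge0 exprn_ge0// ltW.
by rewrite ltW// doobC_gt0// ltr1n.
Qed.

Let powM n p (w : Rn R d.+1 -> R) : 1 < p -> nnb w ->
  (\int[leb d.+1]_x (dualmax n w x `^ (p / (p - 1)))%:E <=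
   (A p)%:E * \int[leb d.+1]_x (w x `^ (p / (p - 1)))%:E)%E.
Proof.
move=> p1 nw; have q1 := conj_gt1 p1; set q := p / (p - 1) in q1 *.
have q0 : 0 <= q by rewrite ltW// (lt_trans ltr01).
have n1 : nnb (fun _ : Rn R d.+1 => 1 : R) by exact: nnb_cst.
have C0 : 0 <= doobC q ^+ d.+1 by rewrite exprn_ge0// ltW// doobC_gt0.
have one f : nnb f -> (\int[leb d.+1]_x (itermax n (rev L) f x `^ q)%:E <=
    (doobC q ^+ d.+1)%:E * \int[leb d.+1]_x (f x `^ q)%:E)%E.
  move=> nf.
  have nfq : nnb (fun x => f x `^ q) by exact: nnb_powR.
  have := itermax_weighted n (rev L) q1 nf n1.
  rewrite {2}/L !size_rev size_enum_ord.
  under eq_integral do rewrite mulr1.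
  move=> h; apply: le_trans h _; apply: lee_wpmul2l; first by rewrite lee_fin.
  apply: ge0_le_nnb => //; first by apply: nnbM => //; exact: itermax_nnb.
  move=> x; rewrite -[leRHS]mulr1 ler_wpM2l ?powR_ge0//.
  exact: itermax_bound.
apply: le_trans (one _ (itermax_nnb n (rev L) nw)) _.
rewrite /A expr2 EFinM -muleA; apply: lee_wpmul2l; first by rewrite lee_fin.
exact: one.
Qed.

Let L1 n : (\int[leb d.+1]_x (g n x)%:E <= B%:E * leb d.+1 S)%E.
Proof. exact: (duality_L1 B0 mS (@nM n) (@M1 n) (@dualM n)). Qed.

Let Lp n p : 1 < p ->
  (\int[leb d.+1]_x (g n x `^ p)%:E <= (dualC (A p) B p)%:E * leb d.+1 S)%E.
Proof.
move=> p1; apply: (@duality_Lp _ _ (g n) S (dualmax n)) => //.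
- exact: A0.
- exact: nM.
- exact: dualM.
- by move=> w nw; exact: powM.
Qed.

Let truncated_nd : {homo truncated^~ U' : n m / (n <= m)%N >-> n `<=` m}.
Proof.
move=> n m nm T [UT h]; split => // i; have [h1 h2] := h i.
by split; [apply: le_trans h1 _|apply: le_trans h2 _]; rewrite lez_nat.
Qed.

Let Fn_nd j I : nondecreasing_seq (fun n => Fn n j I).
Proof.
move=> n m nm; apply/subsetPset => x [T [tT hT] Tx]; exists T => //; split => //.
exact: truncated_nd tT.
Qed.

Let mFn n j I : measurable (Fn n j I). Proof. exact: measurable_Fset. Qed.

Let leb_Fn_le j I n m : (n <= m)%N -> (leb d.+1 (Fn n j I) <= leb d.+1 (Fn m j I))%E.
Proof.
move=> nm; apply: le_measure; [by rewrite inE; exact: mFn..|].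
by apply/subsetPset; exact: Fn_nd.
Qed.

Let mF j I : measurable (F j I). Proof. exact: measurable_Fset. Qed.

Let F_bigcup j I : F j I = \bigcup_n Fn n j I.
Proof.
apply/seteqP; split => x; last first.
  by move=> [n _ [T [[UT _] hT] Tx]]; exists T.
move=> [T [UT hT] Tx].
exists (\max_(i < d.+1) maxn (absz (tnth T i).1) (absz (tnth T i).2))%N => //.
exists T => //; split => //; split => // i.
have h : (maxn (absz (tnth T i).1) (absz (tnth T i).2) <=
  \max_(i < d.+1) maxn (absz (tnth T i).1) (absz (tnth T i).2))%N by apply: (leq_bigmax i).
split; rewrite -abszE lez_nat.
  exact: leq_trans (leq_maxl _ _) h.
exact: leq_trans (leq_maxr _ _) h.
Qed.

Let nFn n j I : nnb (\1_(Fn n j I) : Rn R d.+1 -> R). Proof. exact: nnb_indic. Qed.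

Let b n j I x := itermax n L \1_(Fn n j I) x.

Let b_ge0 n j I x : 0 <= b n j I x.
Proof. by apply: nnb_ge0; exact: itermax_nnb. Qed.

Let b_le1 n j I x : b n j I x <= 1.
Proof. by apply: itermax_bound => // y; rewrite indicE; case: (_ \in _). Qed.

Let b_nd j I x : nondecreasing_seq (fun n => b n j I x).
Proof.
move=> n m nm; apply: (@le_trans _ _ (itermax n L \1_(Fn m j I) x)).
  apply: itermax_mono => // y; rewrite !indicE.
  have /subsetPset sub := Fn_nd j I nm.
  case: (boolP (y \in Fn n j I)) => //; rewrite inE => /sub h.
  by rewrite mem_set.
exact: itermax_scale.
Qed.

(* pointwise, an indicator is at most c ^ -2 times a square of its maximal
   function, so that the bound for the squares applies to the measures *)
Let sq_indic n j I x : \1_(Fn n j I) x <= c ^- 2 * b n j I x ^+ 2.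
Proof.
have h1 := @Fset_le_itermax R d a c U U' n U'U j I x.
have h2 : c * \1_(Fn n j I) x <= b n j I x.
  apply: le_trans h1 _; apply: itermax_mono => //.
    by apply: nnb_indic; exact: measurable_fresh.
  move=> y; rewrite !indicE.
  case: (boolP (y \in fresh _ _ _ _ _ _ _)) => //; rewrite inE => -[h _].
  by rewrite mem_set.
rewrite mulrC ler_pdivlMr ?exprn_gt0//.
move: h2; rewrite indicE; case: (_ \in _) => h2; last by rewrite mul0r sqr_ge0.
rewrite mulr1 in h2; rewrite mul1r ler_pXn2r ?nnegrE ?b_ge0//; exact: ltW.
Qed.

Let g_lim t (e : nat -> nat -> dyadic -> \bar R) :=
  @nneseries_esum_le_lim R _ dyadics dyadics_uniq dyadics_nd dyadics_exhaust t e.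

Lemma sum_measure_Fset :
  (\sum_(1 <= j <oo) \esum_(I in [set: dyadic]) ((r j)%:E * leb d.+1 (F j I)) <=
   (c ^- 2 * B)%:E * leb d.+1 S)%E.
Proof.
have r0' j : (0 <= (r j)%:E)%E by rewrite lee_fin.
apply: le_trans (g_lim (e := fun j n I => ((r j)%:E * leb d.+1 (Fn n j I))%E) _ _ _ _) _.
- by move=> j I; exact: mule_ge0.
- by move=> j n I; exact: mule_ge0.
- by move=> j I n m nm; apply: lee_wpmul2l; [exact: r0'|exact: leb_Fn_le].
- move=> j I _; have mU : measurable (\bigcup_n Fn n j I) by exact: bigcupT_measurable.
  have cv := nondecreasing_cvg_mu (mu := leb d.+1) (fun n => mFn n j I) mU (Fn_nd j I).
  have cvr : ((r j)%:E * leb d.+1 (Fn n j I))%E @[n --> \oo] -->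
      ((r j)%:E * leb d.+1 (F j I))%E.
    by rewrite F_bigcup; apply: cvgeZl.
  by rewrite (cvg_lim _ cvr).
apply: lime_le.
  apply: ereal_nondecreasing_is_cvgn => n m nm.
  apply: (@le_trans _ _ (\sum_(1 <= j < n.+1) \sum_(I <- dyadics m)
      ((r j)%:E * leb d.+1 (Fn m j I)))%E).
    apply: lee_sum => j _; apply: (@le_trans _ _ (\sum_(I <- dyadics n)
      ((r j)%:E * leb d.+1 (Fn m j I)))%E).
      by apply: lee_sum => I _; apply: lee_wpmul2l; [exact: r0'|exact: leb_Fn_le].
    apply: lee_sum_subseq; [exact: dyadics_uniq|exact: dyadics_uniq|exact: dyadics_nd|].
    by move=> I; exact: mule_ge0.
  apply: lee_sum_subseq; rewrite ?iota_uniq//.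
    by move=> j; rewrite !mem_index_iota; lia.
  by move=> j; apply: sume_ge0 => I _; exact: mule_ge0.
apply: nearW => n.
apply: (@le_trans _ _ (\int[leb d.+1]_x (c ^- 2 * g n x)%:E)%E); last first.
  rewrite ge0_integralZl_nnb ?invr_ge0 ?exprn_ge0 ?(ltW c0)//.
  rewrite EFinM -muleA; apply: lee_wpmul2l; last exact: L1.
  by rewrite lee_fin invr_ge0 exprn_ge0 ?(ltW c0).
have nt j I : nnb (fun x => r j * \1_(Fn n j I) x) by apply: nnbM => //; exact: nnb_cst.
rewrite (_ : (\sum_(1 <= j < n.+1) \sum_(I <- dyadics n) ((r j)%:E * leb d.+1 (Fn n j I)) =
    \int[leb d.+1]_x (\sum_(1 <= j < n.+1) \sum_(I <- dyadics n) r j * \1_(Fn n j I) x)%:E)%E).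
  apply: ge0_le_nnb.
  - by apply: nnb_sum => j; exact: nnb_sum.
  - by apply: nnbM => //; apply: nnb_cst; rewrite invr_ge0 exprn_ge0 ?(ltW c0).
  move=> x; rewrite /g /sqrsum mulr_sumr; apply: ler_sum => j _.
  rewrite [leRHS]mulrCA -mulr_sumr; apply: ler_wpM2l => //.
  rewrite mulr_sumr; apply: ler_sum => I _; exact: sq_indic.
under [RHS]eq_integral do rewrite -sumEFin.
rewrite ge0_integral_sum//; last 2 first.
- by move=> j; apply: nnb_EFin; exact: nnb_sum.
- by move=> j x _; rewrite lee_fin (nnb_ge0 x (nnb_sum _ (nt j))).
apply: eq_bigr => j _; under [RHS]eq_integral do rewrite -sumEFin.
rewrite ge0_integral_sum//; last 2 first.
- by move=> I; exact: nnb_EFin.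
- by move=> I x _; rewrite lee_fin (nnb_ge0 x (nt j I)).
apply: eq_bigr => I _; rewrite ge0_integralZl_nnb//.
by rewrite (integral_indic _ measurableT (mFn n j I)) setIT.
Qed.

Let G n x : \bar R := (((6 ^+ d.+1) ^+ 2 * g n x)%:E)%E.

(** The strong maximal function v of an indicator lies in [0, 1], so v ^ N is at
    most v ^ 2, which is at most 6 ^ (2 d) times the square of the limit of the
    truncated maximal functions. *)
Lemma sum_maximal_le (N : nat) x : (1 < N)%N ->
  (\sum_(1 <= j <oo) \esum_(I in [set: dyadic])
     ((r j)%:E * strong_maximal \1_(F j I) x ^+ N) <= limn (G ^~ x))%E.
Proof.
move=> N1.
pose k : R := (6 ^+ d.+1) ^+ 2.
have k0 : 0 <= k by rewrite !exprn_ge0.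
pose e j n I := (r j * (k * b n j I x ^+ 2))%:E.
have e_ge0 j n I : (0 <= e j n I)%E by rewrite lee_fin !mulr_ge0// exprn_ge0.
apply: le_trans (g_lim (e := e) _ e_ge0 _ _) _.
- move=> j I; apply: mule_ge0; first by rewrite lee_fin.
  by apply: expe_ge0; exact: strong_maximal_indic_ge0.
- move=> j I n m nm; rewrite lee_fin !ler_wpM2l// ler_pXn2r ?nnegrE//.
  exact: b_nd.
- move=> j I _.
  have cb : cvgn (fun n => b n j I x).
    by apply: nondecreasing_is_cvgn; [exact: b_nd|exists 1 => _ [n _ <-]].
  set l := limn (fun n => b n j I x).
  have bl n : b n j I x <= l by apply: nondecreasing_cvgn_le => //; exact: b_nd.
  have l0 : 0 <= l by exact: le_trans (bl 0%N).
  have ce : e j n I @[n --> \oo] --> (r j * (k * l ^+ 2))%:E.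
    apply: cvg_EFin; first by apply: nearW.
    by apply: cvgMr; apply: cvgMr; rewrite expr2; under eq_fun do rewrite expr2; apply: cvgM.
  rewrite (cvg_lim _ ce)//.
  have v0 := strong_maximal_indic_ge0 x (mF j I).
  have v1 := strong_maximal_indic_le1 x (mF j I).
  have vl : (strong_maximal \1_(F j I) x <= (6 ^+ d.+1 * l)%:E)%E.
    by rewrite F_bigcup; exact: strong_maximal_le_lim.
  move: v0 v1 vl; case: (strong_maximal _ x) => // v; rewrite !lee_fin => v0 v1 vl.
  rewrite -EFin_expe -EFinM lee_fin ler_wpM2l// /k -exprMn.
  apply: (@le_trans _ _ (v ^+ 2)).
    by rewrite ler_wiXn2l// v0.
  by rewrite ler_pXn2r ?nnegrE ?mulr_ge0 ?exprn_ge0.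
rewrite (_ : (fun n => \sum_(1 <= j < n.+1) \sum_(I <- dyadics n) e j n I)%E = G ^~ x)//.
apply/funext => n; rewrite /G /e /g /sqrsum mulr_sumr -sumEFin.
apply: eq_bigr => j _; rewrite sumEFin; congr EFin.
by rewrite mulrCA !mulr_sumr; apply: eq_bigr.
Qed.

Let g_nd x : nondecreasing_seq (g ^~ x).
Proof.
move=> n m nm; rewrite -lee_fin /g /sqrsum -!sumEFin.
apply: (@le_trans _ _ (\sum_(1 <= j < n.+1)
    (r j * \sum_(I <- dyadics m) itermax m L \1_(Fn m j I) x ^+ 2)%:E)%E).
  apply: lee_sum => j _; rewrite lee_fin ler_wpM2l// -lee_fin -!sumEFin.
  apply: (@le_trans _ _ (\sum_(I <- dyadics n) (b m j I x ^+ 2)%:E)%E).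
    apply: lee_sum => I _; rewrite lee_fin; apply: lerXn2r; rewrite ?nnegrE.
    - exact: b_ge0.
    - exact: b_ge0.
    - exact: b_nd.
  apply: lee_sum_subseq; [exact: dyadics_uniq|exact: dyadics_uniq|exact: dyadics_nd|].
  by move=> I; rewrite lee_fin exprn_ge0.
apply: lee_sum_subseq; rewrite ?iota_uniq//.
  by move=> j; rewrite !mem_index_iota; lia.
move=> j; rewrite lee_fin; apply: mulr_ge0 => //.
by apply: sumr_ge0 => I _; exact: sqr_ge0.
Qed.

Lemma Lnorm_sum_maximal (N : nat) p : (1 < N)%N -> 1 < p ->
  (Lnorm (leb d.+1) p%:E (fun x : Rn R d.+1 =>
     \sum_(1 <= j <oo) \esum_(I in [set: dyadic])
       ((r j)%:E * strong_maximal \1_(F j I) x ^+ N)) <=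
   ((6 ^+ d.+1) ^+ 2 * dualC (A p) B p `^ p^-1)%:E * leb d.+1 S `^ p^-1)%E.
Proof.
move=> N1 p1; have p0 : 0 < p by exact: lt_trans p1.
set Phi := (fun x : Rn R d.+1 => _).
have Phi0 x : (0 <= Phi x)%E.
  apply: nneseries_ge0 => j _ _; apply: esum_ge0 => I _; apply: mule_ge0.
    by rewrite lee_fin.
  by apply: expe_ge0; exact: strong_maximal_indic_ge0.
have k0 : 0 <= (6 ^+ d.+1) ^+ 2 :> R by rewrite !exprn_ge0.
set k : R := (6 ^+ d.+1) ^+ 2 in k0 *.
pose h n x := ((k * g n x) `^ p)%:E.
have kg0 n x : 0 <= k * g n x by rewrite mulr_ge0// (nnb_ge0 x (ng n)).
have h_nd x : nondecreasing_seq (h ^~ x).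
  move=> n m nm; rewrite lee_fin; apply: ge0_ler_powR.
  - exact: ltW.
  - by rewrite nnegrE.
  - by rewrite nnegrE.
  - by apply: ler_wpM2l => //; exact: g_nd.
have nh n : nnb (fun x => (k * g n x) `^ p).
  by apply: nnb_powR; [exact: ltW|apply: nnbM => //; exact: nnb_cst].
have mh n : measurable_fun setT (h n) by exact: nnb_EFin.
have h0 n x : (0 <= h n x)%E by rewrite lee_fin powR_ge0.
have ch x : cvgn (h ^~ x) by exact: ereal_nondecreasing_is_cvgn.
have lim0 x : (0 <= limn (h ^~ x))%E by apply: lime_ge => //; exact: nearW.
have in0 (y : \bar R) : (0 <= y)%E -> y \in `[0, +oo]%E.
  by move=> y0; rewrite in_itv /= y0 leey.
(* passing to p-th roots compares the limits of h and of G *)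
have Phi_le x : (`|Phi x| `^ p <= limn (h ^~ x))%E.
  rewrite gee0_abs//.
  have : (Phi x <= limn (h ^~ x) `^ p^-1)%E.
    apply: le_trans (sum_maximal_le x N1) _.
    apply: lime_le.
      apply: ereal_nondecreasing_is_cvgn => n m nm; rewrite lee_fin ler_wpM2l//.
      exact: g_nd.
    apply: nearW => n.
    have -> : G n x = (h n x `^ p^-1)%E.
      by rewrite /h poweR_EFin -powRrM mulfV ?gt_eqF// powRr1.
    apply: gt0_ler_poweR; rewrite ?invr_ge0 ?(ltW p0)//; try exact: in0.
    rewrite (cvg_lim _ (ereal_nondecreasing_cvgn (h_nd x)))//.
    by apply: ereal_sup_ubound; exists n.
  move=> le; have := gt0_ler_poweR (ltW p0) (in0 _ (Phi0 x)) (in0 _ (poweR_ge0 _ _)) le.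
  by rewrite -poweRrM mulVf ?gt_eqF// poweRe1.
rewrite unlock.
have key : (\int[leb d.+1]_x (`|Phi x| `^ p) <=
    (k `^ p * dualC (A p) B p)%:E * leb d.+1 S)%E.
  apply: le_trans (ge0_integral_mono _ _ Phi_le) _.
    by move=> x; exact: poweR_ge0.
  rewrite monotone_convergence//.
  apply: lime_le.
    apply: ereal_nondecreasing_is_cvgn => n m nm; apply: (ge0_le_nnb (nh n) (nh m)) => x.
    by rewrite -lee_fin; exact: h_nd.
  apply: nearW => n.
  have -> : (\int[leb d.+1]_x h n x = \int[leb d.+1]_x (k `^ p * g n x `^ p)%:E)%E.
    by apply: eq_integral => x _; rewrite /h powRM// (nnb_ge0 x (ng n)).
  rewrite ge0_integralZl_nnb ?powR_ge0//; last by apply: nnb_powR => //; exact: ltW.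
  rewrite EFinM -muleA; apply: lee_wpmul2l; first by rewrite lee_fin powR_ge0.
  exact: Lp.
have dC0 : 0 <= dualC (A p) B p.
  by apply: mulr_ge0; [rewrite mulr_ge0// ltW|exact: powR_ge0].
have pi0 : 0 <= p^-1 by rewrite invr_ge0 ltW.
apply: le_trans (gt0_ler_poweR pi0 _ _ key) _.
- by apply: in0; apply: integral_ge0 => x _; exact: poweR_ge0.
- by apply: in0; rewrite mule_ge0// lee_fin mulr_ge0 ?powR_ge0.
rewrite poweRM//; last by rewrite lee_fin mulr_ge0 ?powR_ge0.
by rewrite poweR_EFin powRM ?powR_ge0// -powRrM mulfV ?gt_eqF// powRr1.
Qed.

End Estimates.

(** * Choice of the constants *)
Section Constants.
Context {R : realType}.

Lemma bernoulli_le (n : nat) (x : R) : 0 <= x <= 1 -> 1 - n%:R * x <= (1 - x) ^+ n.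
Proof.
move=> /andP[x0 x1]; elim: n => [|n IH]; first by rewrite mul0r subr0 expr0.
rewrite exprS; apply: (@le_trans _ _ ((1 - x) * (1 - n%:R * x))); last first.
  by apply: ler_wpM2l => //; rewrite subr_ge0.
rewrite -natr1; have : 0 <= n%:R * x * x :> R by rewrite !mulr_ge0.
lra.
Qed.

(** Since j + a <= (a + 1) (j + 1), the series of (j + 1) q ^ j suffices. *)
Lemma arith_geom_le (q : R) (a n : nat) : 0 < q < 1 ->
  \sum_(1 <= j < n.+1) q ^+ j * (j + a)%:R <= a.+1%:R / (1 - q) ^+ 2.
Proof.
move=> /andP[q0 q1].
have s0 : 0 < (1 - q) ^+ 2 by rewrite exprn_gt0// subr_gt0.
have H m : (1 - q) ^+ 2 * \sum_(0 <= j < m) q ^+ j * j.+1%:R =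
    1 - q ^+ m * (m%:R * (1 - q) + 1) :> R.
  elim: m => [|m IH]; first by rewrite big_nil expr0; ring.
  rewrite big_nat_recr//= mulrDr IH (exprS q) -!natr1; ring.
rewrite ler_pdivlMr// mulrC.
apply: (@le_trans _ _ ((1 - q) ^+ 2 * (a.+1%:R * \sum_(0 <= j < n.+1) q ^+ j * j.+1%:R))).
  apply: ler_wpM2l; first exact: ltW.
  rewrite [in leRHS]big_nat_recl// mulrDr.
  apply: ler_wpDl; first by rewrite !mulr_ge0.
  rewrite big_add1 /= mulr_sumr; apply: ler_sum => j _.
  rewrite mulrCA; apply: ler_wpM2l; first by rewrite exprn_ge0// ltW.
  by rewrite -natrM ler_nat; nia.
rewrite mulrCA H -[leRHS]mulr1; apply: ler_wpM2l => //.
rewrite gerBl; apply: mulr_ge0; first by rewrite exprn_ge0// ltW.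
by rewrite addr_ge0// mulr_ge0// subr_ge0 ltW.
Qed.

Lemma exists_small_pow (x : R) : 0 < x -> exists a : nat, 2 ^- a <= x.
Proof.
move=> x0; exists (Num.truncn x^-1).+1.
rewrite -[leRHS]invrK lef_pV2 ?posrE ?exprn_gt0 ?invr_gt0//.
apply: le_trans (ltW (truncnS_gt _)) _.
by rewrite -natrX ler_nat ltnW// ltn_expl.
Qed.

End Constants.

Theorem lemma34 (R : realType) (d : nat) (hd : (2 <= d)%N) (delta eps : R)
    (hdelta : 0 < delta) (heps : 0 < eps) :
  exists (K : R) (C : R -> R),
  forall U : set (drect d), (leb d (shadow U : set (Rn R d)) < +oo)%E ->
  exists V : set (Rn R d),
    [/\ measurable V, shadow U `<=` V,
        (leb d V <= (1 + delta)%:E * leb d (shadow U))%E &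
        forall U' : set (drect d), U' `<=` U ->
          (\sum_(1 <= j <oo) \esum_(I in [set: dyadic])
             ((2 `^ (- (eps * j%:R)))%:E * leb d (Fset V I j U'))
           <= K%:E * leb d (shadow U'))%E
          /\
          forall (n : nat) (p : R), (1 < n)%N -> 1 < p ->
            (Lnorm (leb d) p%:E (fun x : Rn R d =>
               \sum_(1 <= j <oo) \esum_(I in [set: dyadic])
                 ((2 `^ (- (eps * j%:R)))%:E *
                  strong_maximal \1_(Fset V I j U') x ^+ n))
             <= (C p)%:E * leb d (shadow U') `^ p^-1)%E].
Proof.
case: d hd => [//|d' _].
(* this eta makes (1 + delta) (1 - d eta) equal to 1 + delta / 2, which leaves
   the factor 1 + delta / 2 for the dilation by 1 + 2 ^ -a *)
pose eta : R := delta / (2 * (1 + delta) * d'.+1%:R).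
have den0 : 0 < 2 * (1 + delta) * d'.+1%:R :> R.
  by rewrite mulr_gt0// mulr_gt0//; lra.
have eta0 : 0 < eta by rewrite divr_gt0.
have eta1 : eta < 1.
  rewrite ltr_pdivrMr// mul1r.
  have : 1 <= d'.+1%:R :> R by rewrite ler1n.
  by nra.
pose c := eta ^+ d'.+1.
have c01 : 0 < c < 1 by rewrite exprn_gt0//= exprn_ilt1// ltW.
have [a ha] := exists_small_pow (divr_gt0 hdelta (ltr0n R 2)).
pose q : R := 2 `^ (- eps).
have q01 : 0 < q < 1.
  rewrite /q powR_gt0//= powRN invf_lt1 ?powR_gt0//.
  suff : 1 `^ eps < 2 `^ eps :> R by rewrite powR1.
  by apply: gt0_ltr_powR; rewrite ?nnegrE// ltr1n.
have rE j : 2 `^ (- (eps * j%:R)) = q ^+ j :> R.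
  by rewrite -powR_mulrn ?powR_ge0// -powRrM mulNr.
pose r (j : nat) : R := 2 `^ (- (eps * j%:R)).
have r0 j : 0 <= r j by exact: powR_ge0.
pose Kr : R := a.+1%:R / (1 - q) ^+ 2.
have Kr0 : 0 < Kr by rewrite divr_gt0// exprn_gt0// subr_gt0; case/andP: q01.
have rK n : \sum_(1 <= j < n.+1) r j * (j + a)%:R <= Kr.
  under eq_bigr do rewrite /r rE.
  exact: arith_geom_le.
pose B : R := c ^- 2 * (doobC 2 ^+ d'.+1) ^+ 2 * Kr.
exists (c ^- 2 * B).
exists (fun p => (6 ^+ d'.+1) ^+ 2 *
  dualC ((doobC (p / (p - 1)) ^+ d'.+1) ^+ 2) B p `^ p^-1).
move=> U finU; exists (enlarge (2 ^- a) c U).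
have t0 : 0 <= 2 ^- a :> R by rewrite invr_ge0 exprn_ge0.
have he : 0 < eta < 1 by rewrite eta0.
split.
- exact: measurable_enlarge.
- by apply: shadow_sub_enlarge => //; case/andP: c01.
- apply: le_trans (leb_enlarge _ t0 he) _; apply: lee_wpmul2r => //.
  rewrite lee_fin exprVn ler_pdivrMr ?exprn_gt0 ?subr_gt0//.
  have bern : 1 - d'.+1%:R * eta <= (1 - eta) ^+ d'.+1 by rewrite bernoulli_le// !ltW.
  apply: (@le_trans _ _ ((1 + delta) * (1 - d'.+1%:R * eta))); last first.
    by apply: ler_wpM2l => //; lra.
  have -> : (1 + delta) * (1 - d'.+1%:R * eta) = 1 + delta / 2.
    rewrite /eta; move: d'.+1%:R (ltr0Sn R d') => m m0; field; lra.
  by rewrite lerD2l.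
move=> U' U'U; split.
  exact: sum_measure_Fset.
by move=> n p n1 p1; exact: Lnorm_sum_maximal.
Qed.
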